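(* Let $t>0$ and $\phi\in\mathbb{R}^d$ be fixed, and let $\Phi_t$ be the solution of the initial value problem $$\frac{\partial\Phi_t}{\partial t}(\phi)=\mu\Delta\Phi_t(\phi)-\sum_{X=1}^da_X\frac{\partial}{\partial\phi_X}\Phi_t(\phi)+z\int_{\mathbb{R}^d\setminus\{0\}}[\Phi_t(\phi+\varphi)-\Phi_t(\phi)]\,dr(\varphi),\qquad\Phi_0=\delta_0,$$ where $\mu>0$. Put $\beta=1/(4\mu t)$. In the sense of asymptotic series in $\beta$ (as $\beta\searrow0$, i.e. $\mu\to\infty$, with $t,\phi,a,z,r$ fixed) one has the large diffusion expansion $$\Big(\frac{\beta}{\pi}\Big)^{-d/2}\Phi_t(\phi)=\sum_{m=0}^\infty\frac{(-\beta)^m}{m!}\sum_{G\in\bar Q(m)}\mathcal{V}[G](t,\phi).$$ Furthermore, again in the sense of asymptotic series in $\beta$, $$\log\Big[\Big(\frac{\beta}{\pi}\Big)^{-d/2}\Phi_t(\phi)\Big]=\sum_{m=1}^\infty\frac{(-\beta)^m}{m!}\sum_{G\in\bar Q_c(m)}\mathcal{V}[G](t,\phi).$$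
   Context: Data: $a\in\mathbb{R}^d$, $z\ge0$, $r$ a probability measure on $\mathbb{R}^d\setminus\{0\}$ whose Fourier transform is entire analytic; $\delta_0$ is the Dirac measure at $0$, $\Delta$ the Laplacian. Solution: with $\mathcal{F}(g)(\xi)=\int g(\varphi)e^{i\langle\xi,\varphi\rangle}d\varphi$, let $\Psi^{\rm jump}(\eta)=-\langle a,\eta\rangle+z\int(e^{\langle\eta,\varphi\rangle}-1)\,dr(\varphi)$ be the symbol of the non-diffusive part, $\nu_t=\mathcal{F}^{-1}(e^{t\Psi^{\rm jump}(-i\xi)})$, and $\Phi_t^{\rm diff.}(\phi)=(4\pi\mu t)^{-d/2}e^{-\|\phi\|^2/(4\mu t)}=(\beta/\pi)^{d/2}e^{-\beta\|\phi\|^2}$; the solution is the convolution $\Phi_t=\nu_t*\Phi_t^{\rm diff.}$. Coefficients: $C^{(n)}_{X_1\cdots X_n}=\frac{\partial^n}{\partial\eta_{X_1}\cdots\partial\eta_{X_n}}\Psi^{\rm jump}(\eta)|_{\eta=0}$, i.e. $C^{(1)}_X=-a_X+z\int\varphi_X\,dr(\varphi)$ and $C^{(n)}_{X_1\cdots X_n}=z\int\varphi_{X_1}\cdots\varphi_{X_n}\,dr(\varphi)$ for $n\ge2$. A formal series $\sum_mb_m\beta^m$ is asymptotic to $h(\beta)$ at $\beta=0$ if $\lim_{\beta\searrow0}\beta^{-N}|h(\beta)-\sum_{m=0}^Nb_m\beta^m|=0$ for every $N\in\mathbb{N}$. Graphs: $\bar Q(m)$ is the set of graphs with $m$ distinguishable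 (numbered $1,\dots,m$) directed edges and with two types of vertices, ''inner empty'' and ''outer empty'', indistinguishable within each type; multiple edges and edges joining a vertex to itself are allowed; every vertex is met by at least one edge-end and every outer empty vertex by exactly one edge-end. (Equivalently: surjective maps from the set $\{1,\dots,m\}\times\{1,2\}$ of edge-ends to a finite set of vertices each marked inner or outer, injective over outer ones, up to type-preserving relabelling of vertices.) $\bar Q(0)$ consists of the empty graph, of value $1$. $\bar Q_c(m)$ is the set of connected graphs in $\bar Q(m)$. Value: for $G\in\bar Q(m)$, $\mathcal{V}[G](t,\phi)$ is obtained by assigning to each edge $j$ an index $X_j\in\{1,\dots,d\}$, multiplying by $t\,C^{(l)}_{X_{j_1}\cdots X_{j_l}}$ for each inner empty vertex met by edge-ends belonging to the edges $j_1,\dots,j_l$ (an edge joining the vertex to itself is listed twice), multiplying by $\phi_{X_j}$ for each outer empty vertex met by edge $j$, and summing over $X_1,\dots,X_m\in\{1,\dots,d\}$. *)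

(* Defs.v *)
From HB Require Import structures.
From mathcomp Require Import all_boot all_order all_algebra all_fingroup.
From mathcomp Require Import complex.
From mathcomp Require Import all_classical all_reals all_analysis.

Set Implicit Arguments.
Unset Strict Implicit.
Unset Printing Implicit Defensive.

Import Order.TTheory GRing.Theory Num.Theory.
Import numFieldNormedType.Exports.

Local Open Scope ring_scope.
Local Open Scope complex_scope.

(* R^d with its Borel sigma-algebra; convertible to 'rV[R]_d. *)
Definition Rd (R : realType) (d : nat) := g_sigma_algebraType (@open 'rV[R]_d).

Section Analysis.
Local Open Scope classical_set_scope.
Variables (R : realType) (d : nat).
Implicit Types (x y xi eta phi a : 'rV[R]_d) (w : 'rV[R[i]]_d).

(* The norm of the library on 'rV[R]_d is the sup norm, hence: *)
Definition sqnorm x : R := \sum_(X < d) x 0 X ^+ 2.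

Definition toC x : 'rV[R[i]]_d := map_mx (real_complex R) x.

(* bilinear, not sesquilinear *)
Definition cdot w x : R[i] := \sum_(X < d) w 0 X * (x 0 X)%:C.

Definition cexp (u : R[i]) : R[i] :=
  (expR (complex.Re u) * cos (complex.Im u)) +i* (expR (complex.Re u) * sin (complex.Im u)).

Definition cintegral (nu : {measure set (Rd R d) -> \bar R})
    (f : 'rV[R]_d -> R[i]) : R[i] :=
  (\int[nu]_y complex.Re (f y)) +i* (\int[nu]_y complex.Im (f y)).

Definition fourier (nu : {measure set (Rd R d) -> \bar R}) xi : R[i] :=
  cintegral nu (fun y => cexp ('i * cdot (toC xi) y)).

(* F is the sum of a power series in d variables that converges absolutely on
   all of C^d; the partial sums run over the multi-indices in {0,...,n-1}^d. *)
Definition entire (F : 'rV[R[i]]_d -> R[i]) : Prop :=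
  exists c : ('I_d -> nat) -> R[i], forall w,
    let term (n : nat) (al : {ffun 'I_d -> 'I_n}) : R[i] :=
      c (fun X => al X : nat) * \prod_(X < d) w 0 X ^+ al X in
    cvgn (fun n => \sum_(al : {ffun 'I_d -> 'I_n})
                     ComplexField.Normc.normc (term n al)) /\
    ((fun n => \sum_(al : {ffun 'I_d -> 'I_n}) term n al : (R[i])^o)
       @ \oo --> (F w : (R[i])^o)).

Definition entire_analytic (g : 'rV[R]_d -> R[i]) : Prop :=
  exists F, entire F /\ forall xi, F (toC xi) = g xi.

Definition Psi_jump a (z : R) (r : {measure set (Rd R d) -> \bar R}) w : R[i] :=
  - cdot w a + z%:C * cintegral r (fun y => cexp (cdot w y) - 1).

(* nu = F^-1 (exp (t Psi_jump (- i xi))) *)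
Definition is_nu a (z : R) (r : {measure set (Rd R d) -> \bar R}) (t : R)
    (nu : {measure set (Rd R d) -> \bar R}) : Prop :=
  forall xi, fourier nu xi = cexp (t%:C * Psi_jump a z r (- 'i *: toC xi)).

Definition Phi_diff (mu t : R) x : R :=
  (4 * pi * mu * t) `^ (- (d%:R / 2)) * expR (- sqnorm x / (4 * mu * t)).

Definition convolution (nu : {measure set (Rd R d) -> \bar R})
    (f : 'rV[R]_d -> R) phi : R :=
  \int[nu]_y f (phi - y).

(* With nu = nu_t as in is_nu, this is the solution at time t of
     d/dt Phi = mu Laplacian(Phi) - <a, grad Phi>
                + z int (Phi (. + y) - Phi) dr(y),    Phi_0 = delta_0:
   the Fourier transform turns the right-hand side into multiplication by
   Psi_jump (- i xi) - mu |xi|^2, and nu_t and Phi_diff mu t have Fourier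
   transforms exp (t Psi_jump (- i xi)) and exp (- mu t |xi|^2). *)
Definition levy_solution (nu : {measure set (Rd R d) -> \bar R}) (mu t : R) :
    'rV[R]_d -> R :=
  convolution nu (Phi_diff mu t).

Definition partial (X : 'I_d) (f : 'rV[R]_d -> R) : 'rV[R]_d -> R :=
  fun eta => 'D_(delta_mx 0 X) f eta.

(* Psi_jump is real at real arguments, so that taking the real part only
   changes the type. *)
Definition coefC a (z : R) (r : {measure set (Rd R d) -> \bar R})
    (Xs : seq 'I_d) : R :=
  foldr partial (fun eta => complex.Re (Psi_jump a z r (toC eta))) Xs 0.

Definition asymptotic_series (h : R -> R) (b : nat -> R) : Prop :=
  forall N : nat,
    beta ^- N * `|h beta - \sum_(m < N.+1) b m * beta ^+ m|
      @[beta --> 0^'+] --> (0 : R).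

End Analysis.

(* (j, false) and (j, true) are the initial and the terminal end of edge j. *)
Definition edge_end (m : nat) := ('I_m * bool)%type.

(* (true, _) is an inner, (false, _) an outer empty vertex. A graph with m edges
   has at most 2m vertices, each being met by an edge-end, so that 2m names per
   type suffice. Names that are not used by a graph are not vertices of it. *)
Definition vertex (m : nat) := (bool * 'I_(2 * m))%type.
Definition inner (m : nat) (v : vertex m) : bool := v.1.

Section Graphs.
Variable m : nat.
Implicit Types G H : {ffun edge_end m -> vertex m}.

Definition vertices G : {set vertex m} := [set G e | e : edge_end m].

Definition is_graph G : bool :=
  [forall e, forall e', ~~ inner (G e) ==> (G e == G e') ==> (e == e')].

(* The edges are numbered and directed, so only the vertices are renamed. *)
Definition graph_iso G H : bool :=
  [exists s : {perm vertex m},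
     [forall v, inner (s v) == inner v] && [forall e, H e == s (G e)]].

(* one representative of each class modulo renaming of the vertices *)
Definition Qbar : {set {ffun edge_end m -> vertex m}} :=
  let D := [set G | is_graph G] in
  transversal (equivalence_partition graph_iso D) D.

Definition adjacent G : rel (vertex m) :=
  fun u v => [exists j : 'I_m,
    ((G (j, false) == u) && (G (j, true) == v)) ||
    ((G (j, false) == v) && (G (j, true) == u))].

Definition connected_graph G : bool :=
  [forall u in vertices G, forall v in vertices G, connect (adjacent G) u v].

Definition Qbar_c : {set {ffun edge_end m -> vertex m}} :=
  [set G in Qbar | connected_graph G].

Definition ends_at G (v : vertex m) : seq (edge_end m) :=
  [seq e <- enum {: edge_end m} | G e == v].

Definition value (R : realType) (d : nat) (a : 'rV[R]_d) (z : R)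
    (r : {measure set (Rd R d) -> \bar R}) (t : R) (phi : 'rV[R]_d) G : R :=
  \sum_(X : {ffun 'I_m -> 'I_d})
    (\prod_(v in vertices G | inner v)
        (t * coefC a z r [seq X e.1 | e <- ends_at G v])) *
    (\prod_(v in vertices G | ~~ inner v)
        \prod_(e <- ends_at G v) phi 0 (X e.1)).

End Graphs.

(* Main.v *)
Require Import Defs.
From HB Require Import structures.
From mathcomp Require Import all_boot all_order all_algebra.
From mathcomp Require Import fingroup perm.

Set Implicit Arguments.
Unset Strict Implicit.
Unset Printing Implicit Defensive.

Import Order.TTheory GRing.Theory Num.Theory.

Local Open Scope ring_scope.

(** The solution is an average of Gaussians over nu, and the Gaussian
    prefactor cancels the power of beta / pi, so that for beta > 0

      h(beta) = E exp (- beta |W|^2),   W = phi - Y with Y distributed by nu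

    ([gaussian_average]). Since |exp (- x) - its Taylor sum of order N| is at
    most x^(N+1) / (N+1)! for x >= 0, the first expansion holds with
    coefficients (-1)^m / m! E |W|^(2m), as soon as W has moments of all orders
    ([gaussian_average_taylor]). It remains to see that E |W|^(2m) is the sum of
    the values of the graphs with m edges, and to take the logarithm.

    Moments as sums over set partitions. The characteristic function of W is
    exp (Theta (i xi)) with Theta w = <w, phi> + t Psi_jump w. Differentiating an
    exponential repeatedly gives, for labels X_e of a finite set D,

      E prod_(e in D) W_(X_e) = sum over the partitions P of D of
                                prod_(B in P) d_(X_B) Theta (0)

    ([moment_partition_sum]). Here d_(X_B) Theta (0) is t C_(X_B), plus phi_X if
    B is a single end with label X. Expanding |W|^(2m) into monomials indexed by
    the 2m edge-ends, the blocks of a partition are the vertices of a graph, and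
    the extra term phi_X is the choice of an outer instead of an inner vertex for
    a singleton block ([Qbar_value_sum]).

    Integrability. This is where analyticity enters. On a coordinate axis the
    real part of the Fourier transform of r is an even power series; comparing it
    with the Taylor polynomials of the cosine, whose remainders have a constant
    sign, yields by Fatou's lemma the even moments of each coordinate, and the
    absolute convergence of the power series bounds the exponential moments
    ([rintegrable_exp_abs], [norm_exp_integrable]). Hence Psi_jump can be
    differentiated under the integral sign at every complex point
    ([first_order_psi]), which also identifies the coefficients C
    ([coefC_psi_deriv]). The measure nu is only known through its Fourier
    transform, and its moments are obtained two orders at a time: if those up to
    order 2k are finite, the partition formula holds up to order 2k for the
    Fourier transforms of the measures (monomial) * nu ([moment_transformE]); as
    its right-hand side is smooth, E W_X^(2k) (2 - 2 cos (h W_X)) is O(h^2), and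
    Fatou's lemma bounds E W_X^(2k+2) ([moment_pow_integrable]).

    Logarithm. A partition of all edge-ends splits into the part that is
    connected to a chosen edge and an arbitrary partition of the remaining
    ends. If B_m and C_m are the sums over all and over the connected graphs,

      B_(m+1) = sum_(k <= m) binomial(m, k) C_(k+1) B_(m-k)

    ([labelled_sum_rec]). For the exponential generating functions this says
    B' = C' B, so that with p and q the truncations of the two series
    p exp (- q) has derivative O(beta^N), and log h agrees with q up to O(beta^(N+1))
    ([poly_exp_bound], [taylor_bound_ln]). *)

(** * Sums over set partitions *)

Section SetPartitions.
Variable E : finType.
Implicit Types (D S B : {set E}) (P Q : {set {set E}}).

(** Sets that are unions of blocks, if [P] covers them. *)
Definition saturated P S := [forall B in P, (B \subset S) || [disjoint B & S]].

Lemma saturatedP P S :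
  reflect (forall B, B \in P -> (B \subset S) || [disjoint B & S]) (saturated P S).
Proof. exact: forall_inP. Qed.

Lemma disjointDl D S : [disjoint D :\: S & S].
Proof.
by rewrite -setI_eq0; apply/eqP/setP => x; rewrite !inE; case: (x \in S); rewrite ?andbF.
Qed.

Lemma partitionU P1 P2 D1 D2 : [disjoint D1 & D2] ->
  partition P1 D1 -> partition P2 D2 -> partition (P1 :|: P2) (D1 :|: D2).
Proof.
move=> dD /and3P[/eqP c1 t1 n1] /and3P[/eqP c2 t2 n2].
apply/and3P; split; last by rewrite inE negb_or n1.
  by rewrite /cover bigcup_setU -/(cover P1) -/(cover P2) c1 c2.
by apply: trivIsetU => //; rewrite c1 c2.
Qed.

Lemma partition_sub_neq0 P D B S : partition P D -> B \in P -> B \subset S ->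
  ~~ [disjoint B & S].
Proof.
move=> pP BP /setIidPl BS; rewrite -setI_eq0 BS; exact: partition_neq0 pP BP.
Qed.

Lemma partitionU_restrict P1 P2 D1 D2 : [disjoint D1 & D2] ->
  partition P1 D1 -> partition P2 D2 -> (P1 :|: P2) ::&: D1 = P1.
Proof.
move=> dD p1 p2; apply/setP => B; rewrite !inE.
apply/andP/idP => [[/orP[//|B2] BD1]|B1]; last first.
  by rewrite B1; split => //; apply: partitionS p1 B1.
case/negP: (partition_sub_neq0 p2 B2 BD1).
by rewrite disjoint_sym; apply: disjointWr (partitionS p2 B2) dD.
Qed.

Lemma partitionU_saturated P1 P2 D1 D2 : [disjoint D1 & D2] ->
  partition P1 D1 -> partition P2 D2 -> saturated (P1 :|: P2) D1.
Proof.
move=> dD p1 p2; apply/saturatedP => B /setUP[B1|B2].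
  by rewrite (partitionS p1 B1).
by rewrite orbC disjoint_sym (disjointWr (partitionS p2 B2) dD).
Qed.

Lemma saturated_partition P D S : partition P D -> S \subset D ->
  saturated P S -> partition (P ::&: S) S.
Proof.
move=> pP SD /saturatedP sP; have /and3P[/eqP cP tP nP] := pP.
apply/and3P; split; last 2 first.
- exact: trivIsetI.
- by apply: contra nP; rewrite inE => /andP[].
rewrite eqEsubset (subset_trans (cover_setI P S)) ?subsetIr //=.
apply/subsetP => x xS; have /bigcupP[B BP xB] : x \in cover P.
  by rewrite cP (subsetP SD).
apply/bigcupP; exists B => //; rewrite inE BP /=.
by case/orP: (sP B BP) => // /disjoint_setI0/setP/(_ x); rewrite !inE xB xS.
Qed.

Lemma saturatedD P D S : partition P D -> saturated P S -> saturated P (D :\: S).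
Proof.
move=> pP /saturatedP sP; apply/saturatedP => B BP; have BD := partitionS pP BP.
case/orP: (sP B BP) => BS.
  by rewrite orbC disjoint_sym (disjointWr BS) // disjointDl.
by rewrite subsetD BD BS.
Qed.

Lemma saturated_split P D S : partition P D -> saturated P S ->
  (P ::&: S) :|: (P ::&: (D :\: S)) = P.
Proof.
move=> pP /saturatedP sP; apply/setP => B; rewrite !inE -andb_orr.
case BP: (B \in P) => //=; have BD := partitionS pP BP.
by rewrite subsetD BD /=; exact: sP.
Qed.

End SetPartitions.

Section PartitionSums.
Variables (E : finType) (R : comNzRingType) (th : {set E} -> R).
Implicit Types (D S B : {set E}) (P Q : {set {set E}}).

Definition partition_sum D : R := \sum_(P | partition P D) \prod_(B in P) th B.

(** A partition of [D] for which [S] is a union of blocks is the same thing as a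
    partition of [S] together with a partition of the complement. The condition
    [c] on the part inside [S] serves both [partition_sum_rec], where that part
    is one block, and [partition_sum_component], where it is connected. *)
Lemma partition_sum_split (c : pred {set {set E}}) D S : S \subset D ->
  \sum_(P | [&& partition P D, saturated P S & c (P ::&: S)]) \prod_(B in P) th B
  = (\sum_(P | partition P S && c P) \prod_(B in P) th B)
    * partition_sum (D :\: S).
Proof.
move=> SD.
have dS : [disjoint S & D :\: S] by rewrite disjoint_sym disjointDl.
have SDD : S :|: (D :\: S) = D by rewrite -{1}(setIidPr SD) setID.
rewrite /partition_sum big_distrlr /=.
rewrite pair_big /=.
rewrite (reindex_onto (fun p : {set {set E}} * {set {set E}} => p.1 :|: p.2)
  (fun P => (P ::&: S, P ::&: (D :\: S)))) /=; last first.
  by move=> P /and3P[pP sP _]; exact: saturated_split.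
apply: eq_big => [[P1 P2]|[P1 P2]] /=.
  apply/idP/idP.
    case/andP => /and3P[pP sP cP] /eqP[e1 e2]; rewrite e1 in cP; rewrite cP.
    have -> : partition P1 S by rewrite -e1; exact: saturated_partition pP SD sP.
    rewrite -e2; apply: saturated_partition pP (subsetDl _ _) (saturatedD pP sP).
  case/andP => /andP[p1 c1] p2.
  rewrite (partitionU_restrict dS p1 p2) c1 (partitionU_saturated dS p1 p2).
  rewrite -{1}SDD (partitionU dS p1 p2) /= xpair_eqE eqxx /= setUC.
  by rewrite (partitionU_restrict _ p2 p1) // disjoint_sym.
case/andP => /and3P[pP sP cP] /eqP[e1 e2].
have p1 := saturated_partition pP SD sP.
have p2 := saturated_partition pP (subsetDl _ _) (saturatedD pP sP).
rewrite e1 in p1; rewrite e2 in p2.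
have dP : [disjoint P1 & P2].
  rewrite -setI_eq0; apply/eqP/setP => B; rewrite !inE; apply/negP => /andP[B1 B2].
  case/negP: (partition_sub_neq0 p2 B2 (partitionS p1 B1)).
  by rewrite disjoint_sym; apply: disjointWr (partitionS p2 B2) dS.
by rewrite (eq_bigl [predU P1 & P2]) ?bigU // => B; exact: in_setU.
Qed.

Lemma partition_sum0 : partition_sum set0 = 1.
Proof.
rewrite /partition_sum (big_pred1 set0) => [|P]; first by rewrite big_set0.
by rewrite partition_set0.
Qed.

(** Split off the block that contains [x]. *)
Lemma partition_sum_rec D x : x \in D ->
  partition_sum D
  = \sum_(B : {set E} | (x \in B) && (B \subset D)) th B * partition_sum (D :\: B).
Proof.
move=> xD; rewrite /partition_sum.
rewrite (partition_big (fun P => pblock P x) (fun B : {set E} => (x \in B) && (B \subset D)))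
  /=; last first.
  move=> P pP; have xP : x \in cover P by rewrite (cover_partition pP).
  by rewrite mem_pblock xP (partitionS pP) // pblock_mem.
apply: eq_bigr => B /andP[xB BD].
have -> : th B = \sum_(P | partition P B && (P == [set B])) \prod_(C in P) th C.
  rewrite (big_pred1 [set B]) ?big_set1 // => P /=.
  rewrite andb_idl // => /eqP ->; apply/and3P.
  by rewrite cover1 trivIset1 eqxx inE eq_sym; split => //; apply/set0Pn; exists x.
rewrite -partition_sum_split //; apply: eq_bigl => P.
case pP: (partition P D) => //=.
have tP := partition_trivIset pP.
apply/eqP/andP => [eB|[sP /eqP eP]].
  have BP : B \in P by rewrite -eB pblock_mem // (cover_partition pP).
  split.
    apply/saturatedP => C CP; have [->|nCB] := eqVneq C B; first by rewrite subxx.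
    by rewrite orbC (trivIsetP tP).
  apply/eqP/setP => C; rewrite !inE; apply/andP/eqP => [[CP CB]|->]; last by [].
  apply/eqP/negPn/negP => nCB; case/negP: (partition_sub_neq0 pP CP CB).
  exact: (trivIsetP tP).
apply: def_pblock => //; have : B \in P ::&: B by rewrite eP set11.
by rewrite inE => /andP[].
Qed.

Lemma partition_sum1 f : partition_sum (f |: set0) = th (f |: set0).
Proof.
rewrite (@partition_sum_rec _ f) ?setU11 // (big_pred1 (f |: set0)) => [|B].
  by rewrite setDv partition_sum0 mulr1.
rewrite setU0 /= subset1; apply/andP/eqP => [[fB /orP[/eqP ->//|/eqP B0]]|->].
  by rewrite B0 inE in fB.
by rewrite set11 eqxx.
Qed.

(** Splitting off the block of [e] from a partition of [f |: D], according to
    whether that block contains [f]. Read as a product rule, this says that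
    adjoining [f] acts on the sum for [D] like a derivation. *)
Lemma partition_sumU1 f D e : f \notin D -> e \in D ->
  partition_sum (f |: D)
  = \sum_(B : {set E} | (e \in B) && (B \subset D))
      (th (f |: B) * partition_sum (D :\: B) + th B * partition_sum (f |: (D :\: B))).
Proof.
move=> fD eD; have fe : e != f by apply: contraNneq fD => <-.
have fB B : B \subset D -> f \notin B by move=> BD; apply: contra fD; exact: (subsetP BD).
rewrite (@partition_sum_rec _ e) ?inE ?eD ?orbT //.
rewrite big_split (bigID (fun B : {set E} => f \in B)) /=; congr (_ + _).
  rewrite (reindex_onto (fun B => f |: B) (fun B => B :\ f)) /=; last first.
    by move=> B /andP[_ fB']; exact: setD1K.
  apply: eq_big => [B|B /andP[/andP[/andP[eB BD] _] /eqP eq_B]].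
    rewrite setU11 andbT !inE (negPf fe) /=.
    apply/andP/andP => [[/andP[eB BD] /eqP eq_B]|[eB BD]].
      split => //; rewrite -eq_B subDset; exact: BD.
    by rewrite eB setUS // setU1K // fB.
  congr (_ * partition_sum _); apply/setP => y; rewrite !inE.
  have [->|//] := eqVneq y f; by rewrite (negPf fD) andbF.
apply: eq_big => [B|B /andP[/andP[eB BD] nfB]].
  case eB : (e \in B) => //=; apply/andP/idP => [[BD nfB]|BD].
    apply/subsetP => y yB; have := subsetP BD y yB; rewrite !inE.
    by case/predU1P => // yf; rewrite -yf yB in nfB.
  by rewrite fB // subsetU // BD orbT.
congr (_ * partition_sum _); apply/setP => y; rewrite !inE.
by have [->|] := eqVneq y f; rewrite ?nfB //= ?andbT ?orbF.
Qed.

End PartitionSums.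

Lemma eq_partition_sum (E : finType) (R : comNzRingType) (th th' : {set E} -> R) D :
  (forall B, B != set0 -> th B = th' B) -> partition_sum th D = partition_sum th' D.
Proof.
move=> tt'; apply: eq_bigr => P pP; apply: eq_bigr => B BP.
by apply: tt'; exact: partition_neq0 pP BP.
Qed.

Lemma rmorph_partition_sum (E : finType) (R S : comNzRingType)
    (g : {rmorphism R -> S}) (th : {set E} -> R) D :
  g (partition_sum th D) = partition_sum (fun B => g (th B)) D.
Proof. by rewrite rmorph_sum; apply: eq_bigr => P _; rewrite rmorph_prod. Qed.

(** * Connected components and the linked cluster recursion *)

Section EdgeEnds.
Variable I : finType.
Implicit Types (S T J : {set I}) (B : {set I * bool}) (P : {set {set I * bool}}).

Definition ends S : {set I * bool} := [set e | e.1 \in S].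

(** A partition of the ends of [S] is connected if no proper nonempty set of
    edges is separated from the others by the blocks. Stated with saturated sets
    of edges, connectedness is easily transported and restricted; it agrees with
    connectedness by paths by [connected_graph_shape]. *)
Definition edge_connected P S : bool :=
  [forall T : {set I},
    [&& T \subset S, T != set0 & saturated P (ends T)] ==> (T == S)].

Definition component P J j : {set I} :=
  \bigcap_(T : {set I} | [&& j \in T, T \subset J & saturated P (ends T)]) T.

Lemma endsS S T : (ends S \subset ends T) = (S \subset T).
Proof.
apply/subsetP/subsetP => sST x; last by rewrite !inE; exact: sST.
by move=> xS; have := sST (x, false); rewrite !inE; apply.
Qed.

Lemma endsT : ends setT = setT.
Proof. by apply/setP => e; rewrite !inE. Qed.

Lemma endsD S T : ends (S :\: T) = ends S :\: ends T.
Proof. by apply/setP => x; rewrite !inE. Qed.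

Lemma saturated_setD P (S T : {set I * bool}) :
  saturated P S -> saturated P T -> saturated P (S :\: T).
Proof.
move=> /saturatedP sS /saturatedP sT; apply/saturatedP => B BP.
case/orP: (sS B BP) => BS; last first.
  by rewrite (disjointWr _ BS) ?orbT // subsetDl.
case/orP: (sT B BP) => BT; last by rewrite subsetD BS BT.
by rewrite orbC disjoint_sym (disjointWr BT) // disjointDl.
Qed.

Lemma component_saturated P J j : saturated P (ends (component P J j)).
Proof.
apply/saturatedP => B BP.
case: (boolP [forall T : {set I}, [&& j \in T, T \subset J & saturated P (ends T)]
              ==> (B \subset ends T)]) => [/forall_inP Ball|].
  apply/orP; left; apply/subsetP => e eB; rewrite inE; apply/bigcapP => T hT.
  by have /subsetP/(_ _ eB) := Ball T hT; rewrite inE.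
case/forall_inPn => T hT nBT; apply/orP; right.
have /and3P[_ _ /saturatedP/(_ B BP)] := hT; rewrite (negPf nBT) /=.
apply: disjointWr; rewrite endsS; exact: bigcap_inf.
Qed.

(** The component of [j] is the only separated set of edges that contains [j]
    and is connected in itself. Minimality gives connectedness because the
    complement of a separated subset is separated too. *)
Lemma component_eq P J j S : j \in S -> S \subset J ->
  (component P J j == S)
  = saturated P (ends S) && edge_connected (P ::&: ends S) S.
Proof.
move=> jS SJ; apply/eqP/andP => [eS|[sS /forall_inP cS]]; last first.
  have cSS : component P J j \subset S by apply: bigcap_inf; rewrite jS SJ sS.
  apply/eqP/cS; rewrite cSS /=; apply/andP; split.
    by apply/set0Pn; exists j; apply/bigcapP => T /and3P[].
  apply/saturatedP => B; rewrite inE => /andP[BP _].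
  exact: (saturatedP _ _ (component_saturated P J j)).
have sS : saturated P (ends S) by rewrite -eS component_saturated.
split => //; apply/forall_inP => T /and3P[TS T0 /saturatedP sT].
have sPT : saturated P (ends T).
  apply/saturatedP => B BP; case/orP: (saturatedP _ _ sS B BP) => BS.
    by apply: sT; rewrite inE BP.
  by rewrite (disjointWr _ BS) ?orbT // endsS.
have cmin (U : {set I}) : j \in U -> U \subset J -> saturated P (ends U) -> S \subset U.
  by move=> jU UJ sU; rewrite -eS; apply: bigcap_inf; rewrite jU UJ.
rewrite eqEsubset TS /=; case jT : (j \in T).
  by apply: cmin => //; apply: subset_trans SJ.
case/negP: T0; rewrite -subset0; apply/subsetP => x xT.
have := cmin (S :\: T); rewrite !inE jT jS endsD => /(_ isT).
rewrite (subset_trans (subsetDl _ _) SJ) => /(_ isT (saturated_setD sS sPT)).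
by move/subsetP/(_ x); rewrite (subsetP TS _ xT) inE xT => /(_ isT).
Qed.

Variables (R : comNzRingType) (th : {set I * bool} -> R).

Definition connected_sum S : R :=
  \sum_(P | partition P (ends S) && edge_connected P S) \prod_(B in P) th B.

(** The linked cluster decomposition: sort the partitions by the component of
    [j]. *)
Lemma partition_sum_component J j : j \in J ->
  partition_sum th (ends J)
  = \sum_(S : {set I} | (j \in S) && (S \subset J))
      connected_sum S * partition_sum th (ends (J :\: S)).
Proof.
move=> jJ; rewrite {1}/partition_sum.
rewrite (partition_big (fun P => component P J j)
   (fun S : {set I} => (j \in S) && (S \subset J))) /=; last first.
  move=> P pP; apply/andP; split; first by apply/bigcapP => T /and3P[].
  apply: bigcap_inf; rewrite jJ subxx /=; apply/saturatedP => B BP.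
  by rewrite (partitionS pP).
apply: eq_bigr => S /andP[jS SJ].
rewrite endsD -partition_sum_split ?endsS //; apply: eq_bigl => P.
by rewrite component_eq.
Qed.

End EdgeEnds.

Lemma imset_subset_inj (aT rT : finType) (f : aT -> rT) (A B : {set aT}) :
  injective f -> ([set f x | x in A] \subset [set f x | x in B]) = (A \subset B).
Proof.
move=> f_inj; apply/idP/idP => [/subsetP sAB|]; last exact: imsetS.
by apply/subsetP => x xA; have := sAB _ (imset_f f xA); rewrite mem_imset.
Qed.

Section Transport.
Variables (I' I : finType) (f : I' -> I) (f_inj : injective f).
Variable R : comNzRingType.
Implicit Types (S T : {set I'}) (B : {set I' * bool}) (P : {set {set I' * bool}}).

Definition map_end (e : I' * bool) : I * bool := (f e.1, e.2).

Lemma map_end_inj : injective map_end.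
Proof. by move=> [x b] [y c] [/f_inj -> ->]. Qed.

Lemma ends_imset S : ends [set f x | x in S] = [set map_end e | e in ends S].
Proof.
apply/setP => -[x b]; rewrite inE /=; apply/imsetP/imsetP => [[y yS ->]|[[y c] yS]].
  by exists (y, b) => //; rewrite inE.
by case=> -> _; exists y => //; rewrite inE in yS.
Qed.

Lemma saturated_imset P S :
  saturated [set map_end @: (B : {set _}) | B in P] (ends [set f x | x in S])
  = saturated P (ends S).
Proof.
have e_inj := map_end_inj.
apply/saturatedP/saturatedP => sP B.
  move=> BP; have := sP (map_end @: B) (imset_f _ BP).
  by rewrite ends_imset imset_disjoint // imset_subset_inj.
by case/imsetP => C CP ->; rewrite ends_imset imset_disjoint // imset_subset_inj ?sP.
Qed.

Lemma edge_connected_imset P S :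
  edge_connected [set map_end @: (B : {set _}) | B in P] [set f x | x in S]
  = edge_connected P S.
Proof.
apply/forall_inP/forall_inP => cP T /and3P[TS T0 sT].
  have := cP (f @: T); rewrite saturated_imset sT imset_eq0 T0 imset_subset_inj // TS.
  by move=> /(_ isT); rewrite (inj_eq (imset_inj f_inj)).
have eT : T = f @: (f @^-1: T).
  apply/setP => x; apply/idP/imsetP => [xT|[y]]; last by rewrite inE => ? ->.
  have /imsetP[y yS ey] := subsetP TS x xT; exists y => //.
  by rewrite inE -ey.
move: TS T0 sT; rewrite eT saturated_imset imset_eq0 imset_subset_inj //.
by move=> TS T0 sT; rewrite (eqP (cP (f @^-1: T) _)) // TS T0.
Qed.

(** Set partitions are transported along an injection of the edges, so that the
    component of an edge can be renumbered as a graph in its own right. *)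
Lemma big_partition_imset (th : {set I * bool} -> R)
    (c' : pred {set {set I' * bool}}) (c : pred {set {set I * bool}}) S :
  (forall P, c [set map_end @: (B : {set _}) | B in P] = c' P) ->
  \sum_(Q | partition Q (ends [set f x | x in S]) && c Q) \prod_(B in Q) th B
  = \sum_(P | partition P (ends S) && c' P)
      \prod_(B in P) th [set map_end e | e in B].
Proof.
move=> cc'.
have im_inj : injective (fun B : {set _} => map_end @: B).
  exact: imset_inj map_end_inj.
rewrite (reindex_onto (fun P => [set map_end @: (B : {set _}) | B in P])
  (fun Q => [set map_end @^-1: (A : {set _}) | A in Q])) /=.
  apply: eq_big => [P|P _]; last by rewrite big_imset //; apply: in2W.
  rewrite cc' ends_imset imset_partition; last exact: map_end_inj.
  suff -> : [set map_end @^-1: (A : {set _})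
            | A in [set map_end @: (B : {set _}) | B in P]] = P.
    by rewrite eqxx andbT.
  rewrite -imset_comp -[RHS]imset_id; apply: eq_imset => B /=.
  by apply/setP => x; rewrite inE mem_imset //; exact: map_end_inj.
move=> P /andP[pP _]; rewrite -imset_comp -[RHS]imset_id.
apply: eq_in_imset => B BP /=; apply/setP => x.
apply/imsetP/idP => [[y]|xB]; first by rewrite inE => ? ->.
have := subsetP (partitionS pP BP) x xB; rewrite ends_imset => /imsetP[y yS ey].
by exists y => //; rewrite inE -ey.
Qed.

Lemma connected_sum_imset (th : {set I * bool} -> R) S :
  connected_sum th [set f x | x in S]
  = connected_sum (fun B => th [set map_end e | e in B]) S.
Proof.
by apply: big_partition_imset => P; exact: edge_connected_imset.
Qed.

Lemma partition_sum_imset (th : {set I * bool} -> R) S :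
  partition_sum th (ends [set f x | x in S])
  = partition_sum (fun B => th [set map_end e | e in B]) (ends S).
Proof.
have := @big_partition_imset th predT predT S (fun _ => erefl).
by under eq_bigl do rewrite andbT; under [X in _ = X]eq_bigl do rewrite andbT.
Qed.

End Transport.

Section LinkedCluster.
Variables (D : finType) (R : comNzRingType) (g : seq D -> R).
Hypothesis g_perm : forall s1 s2, perm_eq s1 s2 -> g s1 = g s2.

(** A vertex depends on its edge-ends only through the labels of their edges;
    [g] is invariant under permutations, so that the enumeration of [B] is
    irrelevant. *)
Definition block_weight (I : finType) (X : {ffun I -> D}) (B : {set I * bool}) : R :=
  g [seq X e.1 | e <- enum B].

Definition labelled_sum (n : nat) : R :=
  \sum_(X : {ffun 'I_n -> D}) partition_sum (block_weight X) (ends setT).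

Definition labelled_connected_sum (n : nat) : R :=
  \sum_(X : {ffun 'I_n -> D}) connected_sum (block_weight X) setT.

Lemma block_weight_imset (I' I : finType) (f : I' -> I) (X : {ffun I -> D})
    (B : {set I' * bool}) : injective f ->
  block_weight X [set map_end f e | e in B]
  = block_weight [ffun i => X (f i)] B.
Proof.
move=> f_inj; apply: g_perm.
have -> : [seq [ffun i => X (f i)] e.1 | e <- enum B]
        = [seq X e.1 | e <- [seq map_end f e | e <- enum B]].
  by rewrite -map_comp; apply: eq_map => e /=; rewrite ffunE.
apply: perm_map; apply: uniq_perm; rewrite ?enum_uniq ?map_inj_uniq ?enum_uniq //.
  exact: map_end_inj.
by move=> e; rewrite mem_enum; apply/imsetP/mapP => -[y]; rewrite ?mem_enum => yB ->;
  exists y; rewrite ?mem_enum.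
Qed.

Lemma imset_enum_val (I : finType) (S : {set I}) :
  [set enum_val i | i in [set: 'I_#|S|]] = S.
Proof.
apply/setP => x; apply/imsetP/idP => [[i _ ->]|xS]; first exact: enum_valP.
by exists (enum_rank_in xS x); rewrite ?enum_rankK_in.
Qed.

(** Labels of the edges in [S] and in its complement are chosen
    independently. *)
Lemma big_labels_split (I : finType) (S : {set I})
    (F : {ffun 'I_#|S| -> D} -> R) (G : {ffun 'I_#|~: S| -> D} -> R) :
  \sum_(X : {ffun I -> D})
     F [ffun i => X (enum_val i)] * G [ffun i => X (enum_val i)]
  = (\sum_Y F Y) * (\sum_Z G Z).
Proof.
rewrite big_distrlr /= pair_big /=.
(* Restriction to S and to its complement is injective, and both sides have the
   same number of elements. *)
pose phi (X : {ffun I -> D}) := ([ffun i : 'I_#|S| => X (enum_val i)],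
                                 [ffun i : 'I_#|~: S| => X (enum_val i)]).
rewrite (reindex phi) //=; apply: onW_bij.
apply: inj_card_bij; last first.
  by rewrite card_prod !card_ffun !card_ord -expnD cardsC.
move=> X Y [/ffunP eS /ffunP eC]; apply/ffunP => j.
case jS : (j \in S).
  by have := eS (enum_rank_in jS j); rewrite !ffunE enum_rankK_in.
have jC : j \in ~: S by rewrite inE jS.
by have := eC (enum_rank_in jC j); rewrite !ffunE enum_rankK_in.
Qed.

(** Decompose by the set [S] of the edges connected to edge 0. Only the number
    [k.+1] of its elements matters, and 'C(n, k) subsets containing edge 0 have
    that many elements. *)
Lemma labelled_sum_rec n :
  labelled_sum n.+1
  = \sum_(k < n.+1) ('C(n, k)%:R * labelled_connected_sum k.+1
                       * labelled_sum (n - k)).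
Proof.
pose H (S : {set 'I_n.+1}) := labelled_connected_sum #|S| * labelled_sum #|~: S|.
transitivity (\sum_(S : {set 'I_n.+1} | ord0 \in S) H S).
  rewrite /labelled_sum.
  under eq_bigr do rewrite (@partition_sum_component _ _ _ setT ord0) ?inE //.
  rewrite exchange_big /=; apply: eq_big => [S|S _]; first by rewrite subsetT andbT.
  rewrite /H /labelled_connected_sum /labelled_sum -big_labels_split.
  apply: eq_bigr => X _; rewrite setTD; congr (_ * _).
    rewrite -{1}(imset_enum_val S) connected_sum_imset; last exact: enum_val_inj.
    by apply: eq_bigr => P _; apply: eq_bigr => B _;
      rewrite block_weight_imset //; exact: enum_val_inj.
  rewrite -{1}(imset_enum_val (~: S)) partition_sum_imset; last exact: enum_val_inj.
  by apply: eq_bigr => P _; apply: eq_bigr => B _;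
    rewrite block_weight_imset //; exact: enum_val_inj.
rewrite (reindex_onto (fun T => ord0 |: T) (fun S => S :\ ord0)) /=; last first.
  by move=> S; exact: setD1K.
rewrite (eq_bigl (fun T : {set 'I_n.+1} => T \subset [set~ ord0])); last first.
  move=> T; rewrite setU11 /=; apply/eqP/idP => [<-|T0]; last first.
    by rewrite setU1K //; apply/negP => /(subsetP T0); rewrite !inE eqxx.
  by apply/subsetP => x; rewrite !inE => /andP[].
have cT (T : {set 'I_n.+1}) : T \subset [set~ ord0] -> (#|T| <= n)%N.
  by move=> /subset_leq_card; rewrite cardsC1 card_ord.
rewrite (partition_big (fun T : {set 'I_n.+1} => inord #|T| : 'I_n.+1) predT) //=.
apply: eq_bigr => k _.
transitivity (\sum_(T in [set T : {set 'I_n.+1} | T \subset [set~ ord0] & #|T| == k])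
   labelled_connected_sum k.+1 * labelled_sum (n - k)).
  apply: eq_big => [T|T /andP[T0 /eqP <-]].
    rewrite inE; case: (boolP (T \subset _)) => //= T0.
    by rewrite -val_eqE /= inordK // ltnS cT.
  have n0T : ord0 \notin T by apply/negP => /(subsetP T0); rewrite !inE eqxx.
  rewrite /H inordK ?ltnS ?cT // cardsU1 n0T add1n.
  have -> : #|~: (ord0 |: T)| = (n - #|T|)%N; last by [].
  have := cardsC (ord0 |: T); rewrite cardsU1 n0T card_ord add1n addSn => -[e].
  by apply: (canRL (addKn _)); rewrite e.
by rewrite sumr_const cards_draws cardsC1 card_ord /= -mulrA mulr_natl.
Qed.

End LinkedCluster.

(** * Isomorphism classes of graphs *)

(** Two functions with the same fibres and the same types differ by a
    type-preserving permutation of the values. The permutation is built one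
    argument at a time: a transposition corrects the value at a new argument, and
    it moves none of the values already attained. *)
Lemma extend_to_perm (E V : finType) (T : eqType) (type : V -> T) (f g : E -> V)
    (s : seq E) :
  {in s &, forall e e', (f e == f e') = (g e == g e')} ->
  {in s, forall e, type (f e) = type (g e)} ->
  exists p : {perm V}, (forall v, type (p v) = type v) /\ {in s, forall e, p (f e) = g e}.
Proof.
elim: s => [|e s IHs] ker typ; first by exists 1%g; split => // v; rewrite perm1.
have [||p [ptyp pf]] := IHs.
- by move=> x y xs ys; apply: ker; rewrite inE ?xs ?ys orbT.
- by move=> x xs; apply: typ; rewrite inE xs orbT.
have [/hasP[e' e's /eqP fe]|nf] := boolP (has (fun e' => f e == f e') s).
  exists p; split => // x; rewrite inE => /predU1P[->|/pf //].
  by rewrite fe pf //; apply/esym/eqP; rewrite -ker ?fe ?inE ?eqxx ?e's ?orbT.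
exists (p * tperm (p (f e)) (g e))%g; split => [v|x].
  have tfg : type (f e) = type (g e) by rewrite typ ?inE ?eqxx.
  by rewrite permM; case: tpermP => [pv|pv|_ _]; rewrite ?ptyp // -(ptyp v) pv ?ptyp.
rewrite inE permM => /predU1P[->|xs]; first by rewrite tpermL.
rewrite (pf x xs) tpermD //; last first.
  apply: contra nf => /eqP exg; apply/hasP; exists x => //.
  by rewrite ker ?inE ?eqxx ?xs ?orbT //; apply/eqP.
apply: contra nf => /eqP exg; apply/hasP; exists x => //.
by rewrite -(inj_eq (@perm_inj _ p)) exg pf.
Qed.

Section GraphShapes.
Variable m : nat.
Implicit Types (G H : {ffun edge_end m -> vertex m}) (v : vertex m).
Implicit Types (B : {set edge_end m}) (P Q : {set {set edge_end m}}).

Definition fibre G v : {set edge_end m} := [set e | G e == v].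

(** A complete invariant of graphs up to renaming of the vertices: the
    partition of the edge-ends into vertices, and the blocks of it that are outer
    vertices. *)
Definition shape G : {set {set edge_end m}} * {set {set edge_end m}} :=
  ([set fibre G v | v in vertices G],
   [set fibre G v | v in [set v in vertices G | ~~ inner v]]).

Definition is_shape (p : {set {set edge_end m}} * {set {set edge_end m}}) :=
  [&& partition p.1 setT, p.2 \subset p.1 & [forall B in p.2, #|B| == 1%N]].

Lemma fibre_inj G : {in vertices G &, injective (fibre G)}.
Proof.
move=> _ v /imsetP[e _ ->] _ /setP/(_ e); rewrite !inE eqxx => /esym/eqP //.
Qed.

Lemma fibreP G B : reflect (exists e, B = fibre G (G e)) (B \in (shape G).1).
Proof.
apply: (iffP imsetP) => [[_ /imsetP[e _ ->] ->]|[e ->]]; first by exists e.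
by exists (G e) => //; apply: imset_f.
Qed.

Lemma fibre_outer G e : (fibre G (G e) \in (shape G).2) = ~~ inner (G e).
Proof.
have Ge : G e \in vertices G by apply: imset_f.
apply/imsetP/idP => [[v]|ou]; last by exists (G e); rewrite // inE Ge.
by rewrite inE => /andP[vG ou] /fibre_inj ->.
Qed.

Lemma shape_partition G : partition (shape G).1 setT.
Proof.
apply/and3P; split.
- rewrite -subTset; apply/subsetP => e _; apply/bigcupP.
  by exists (fibre G (G e)); [apply/fibreP; exists e|rewrite inE].
- apply/trivIsetP => _ _ /fibreP[e ->] /fibreP[e' ->] ne.
  rewrite -setI_eq0; apply: contra_neqT ne => /set0Pn[x].
  by rewrite !inE => /andP[/eqP <- /eqP <-].
- by apply/negP => /fibreP[e] /setP/(_ e); rewrite !inE eqxx.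
Qed.

Lemma shape_is_shape G : is_graph G -> is_shape (shape G).
Proof.
move=> gG; apply/and3P; split; first exact: shape_partition.
  by apply: imsetS; apply/subsetP => v; rewrite inE => /andP[].
apply/forall_inP => _ /imsetP[v + ->]; rewrite inE => /andP[/imsetP[e _ ->] ou].
apply/cards1P; exists e; apply/setP => e'; rewrite !inE.
apply/eqP/eqP => [ee'|-> //].
have /forallP/(_ e)/forallP/(_ e') := gG.
by rewrite ou ee' eqxx /= => /eqP.
Qed.

Lemma graph_iso_shape G H : graph_iso G H = (shape G == shape H).
Proof.
apply/idP/eqP => [/existsP[s /andP[/forallP ins /forallP hs]]|eGH].
  have fs v : fibre H (s v) = fibre G v.
    by apply/setP => e; rewrite !inE (eqP (hs e)) (inj_eq perm_inj).
  have vs : vertices H = [set s v | v in vertices G].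
    by rewrite -imset_comp; apply: eq_imset => e /=; rewrite (eqP (hs e)).
  have vo : [set v in vertices H | ~~ inner v]
          = [set s v | v in [set v in vertices G | ~~ inner v]].
    apply/setP => v; rewrite inE vs; apply/andP/imsetP => [[/imsetP[u uG ->]]|[u]].
      by rewrite (eqP (ins u)) => iu; exists u => //; rewrite inE uG.
    by rewrite inE => /andP[uG iu] ->; rewrite (eqP (ins u)) imset_f.
  rewrite /shape vo vs -!imset_comp; congr pair;
    by apply: eq_imset => v /=; rewrite fs.
have fe e : fibre G (G e) = fibre H (H e).
  have : fibre G (G e) \in (shape H).1 by rewrite -eGH; apply/fibreP; exists e.
  case/fibreP => e' ee'; rewrite ee'; have : e \in fibre G (G e) by rewrite inE.
  by rewrite ee' inE => /eqP ->.
have ker e e' : (G e == G e') = (H e == H e').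
  have : e \in fibre G (G e') = (e \in fibre H (H e')) by rewrite fe.
  by rewrite !inE.
have typ e : inner (G e) = inner (H e).
  by apply: negb_inj; rewrite -!fibre_outer fe eGH.
have [p [pt pG]] := extend_to_perm (s := enum {: edge_end m}) (type := @inner m)
  (in2W ker) (in1W typ).
apply/existsP; exists p; apply/andP; split; apply/forallP => x.
  by rewrite pt.
by rewrite pG ?mem_enum.
Qed.

(** Names for the vertices are found by picking an edge-end in each block: there
    are as many edge-ends as names. *)
Lemma shape_surj (p : {set {set edge_end m}} * {set {set edge_end m}}) :
  is_shape p -> exists2 G, is_graph G & shape G = p.
Proof.
case: p => P Q /and3P[/= pP QP /forall_inP Q1].
have cP e : e \in cover P by rewrite (cover_partition pP).
pose rep e := odflt e [pick x in pblock P e].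
have repP e : rep e \in pblock P e.
  by rewrite /rep; case: pickP => //= /(_ e); rewrite /= mem_pblock cP.
have eqr e e' : (rep e == rep e') = (pblock P e == pblock P e').
  apply/eqP/eqP => [er|ep].
    have t := partition_trivIset pP.
    by rewrite -(same_pblock t (repP e)) er (same_pblock t (repP e')).
  rewrite /rep ep; case: pickP => // /(_ e').
  by rewrite /= mem_pblock cP.
have cm : #|{: edge_end m}| = (2 * m)%N.
  by rewrite card_prod card_ord card_bool mulnC.
pose G : {ffun edge_end m -> vertex m} :=
  [ffun e => (pblock P e \notin Q, cast_ord cm (enum_rank (rep e)))].
have eqG e e' : (G e == G e') = (pblock P e == pblock P e').
  rewrite !ffunE xpair_eqE (inj_eq (@cast_ord_inj _ _ cm)) (inj_eq enum_rank_inj) eqr.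
  by case: (eqVneq (pblock P e) (pblock P e')) => [->|_]; rewrite ?eqxx ?andbF.
have fG e : fibre G (G e) = pblock P e.
  apply/setP => e'; rewrite inE eqG eq_sym eq_pblock //.
  exact: partition_trivIset pP.
exists G.
  apply/forallP => e; apply/forallP => e'; apply/implyP; rewrite eqG.
  rewrite /inner ffunE /= negbK => /Q1/cards1P[x px]; apply/implyP => /eqP pe.
  have : e \in pblock P e by rewrite mem_pblock.
  have : e' \in pblock P e by rewrite pe mem_pblock.
  by rewrite px !inE => /eqP -> /eqP ->.
have ->: shape G = ((shape G).1, (shape G).2) by case: (shape G).
have e1 : (shape G).1 = P.
  apply/setP => B; apply/fibreP/idP => [[e ->]|BP]; first by rewrite fG pblock_mem.
  have /set0Pn[e eB] := partition_neq0 pP BP; exists e.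
  by rewrite fG (def_pblock _ BP) //; exact: partition_trivIset pP.
congr pair => //; apply/setP => B; apply/idP/idP => BQ.
  have : B \in P.
    by rewrite -e1; move: B BQ; apply/subsetP/imsetS/subsetP => v; rewrite inE => /andP[].
  rewrite -e1 => /fibreP[e eB]; move: BQ; rewrite eB fibre_outer fG.
  by rewrite /inner ffunE /= negbK.
have := subsetP QP B BQ; rewrite -e1 => /fibreP[e eB].
by rewrite eB fibre_outer /inner ffunE /= negbK -fG -eB.
Qed.

Lemma Qbar_transversal :
  let D := [set G | is_graph G] in
  is_transversal (Qbar m) (equivalence_partition (@graph_iso m) D) D.
Proof.
apply/transversalP/equivalence_partitionP => G H K _ _ _.
by rewrite !graph_iso_shape eqxx; split => // /eqP ->.
Qed.

Lemma Qbar_shape_inj : {in Qbar m &, injective shape}.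
Proof.
move=> G H GQ HQ eGH; have tr := Qbar_transversal.
apply: (pblock_inj tr) => //.
have D K : K \in Qbar m -> K \in [set G | is_graph G].
  by move=> KQ; apply: (subsetP (transversal_sub tr)).
have eqv : {in [set G | is_graph G] & &, equivalence_rel (@graph_iso m)}.
  by move=> x y w _ _ _; rewrite !graph_iso_shape eqxx; split => // /eqP ->.
apply: same_pblock; first by case/and3P: tr => /and3P[].
by rewrite pblock_equivalence_partition ?D // graph_iso_shape eGH.
Qed.

Lemma Qbar_shape_image : [set shape G | G in Qbar m] = [set p | is_shape p].
Proof.
have /= tr := Qbar_transversal.
apply/setP => p; rewrite inE; apply/imsetP/idP => [[G GQ ->]|/shape_surj[G gG <-]].
  have := subsetP (transversal_sub tr) G GQ; rewrite inE; exact: shape_is_shape.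
have GD : G \in [set G | is_graph G] by rewrite inE.
have eqv : {in [set G | is_graph G] & &, equivalence_rel (@graph_iso m)}.
  by move=> x y w _ _ _; rewrite !graph_iso_shape eqxx; split => // /eqP ->.
set P := equivalence_partition _ _ in tr.
have Gc : G \in cover P by case/and3P: tr => /and3P[/eqP ->].
have BP := pblock_mem Gc.
have HQ := repr_mem_transversal tr G BP.
exists (transversal_repr G (Qbar m) (pblock P G)) => //.
apply/eqP; rewrite -graph_iso_shape.
rewrite -(pblock_equivalence_partition eqv) ?GD //; last first.
  exact: (subsetP (transversal_sub tr)).
exact: (repr_mem_pblock tr).
Qed.

(** Summing over representatives of the isomorphism classes amounts to summing
    over shapes: a partition and a set of singleton blocks. *)
Lemma Qbar_sum_shape (R : comNzRingType) (c : pred {set {set edge_end m}})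
    (F : {set {set edge_end m}} -> {set {set edge_end m}} -> R) :
  \sum_(G in Qbar m | c (shape G).1) F (shape G).1 (shape G).2
  = \sum_(P | partition P setT && c P)
      \sum_(Q : {set {set edge_end m}} | (Q \subset P) && [forall B in Q, #|B| == 1%N]) F P Q.
Proof.
rewrite pair_big_dep /= big_mkcondr.
rewrite -(big_imset (fun p => if c p.1 then F p.1 p.2 else 0) Qbar_shape_inj) /=.
rewrite Qbar_shape_image -big_mkcondr; apply: eq_bigl => p.
by rewrite inE /is_shape -!andbA; do !bool_congr.
Qed.

Lemma value_shape (D : finType) (R : comNzRingType) (k : seq D -> R) (ph : D -> R) G
    (X : {ffun 'I_m -> D}) :
  (\prod_(v in vertices G | inner v) k [seq X e.1 | e <- ends_at G v])
    * (\prod_(v in vertices G | ~~ inner v) \prod_(e <- ends_at G v) ph (X e.1))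
  = (\prod_(B in (shape G).1 :\: (shape G).2) k [seq X e.1 | e <- enum B])
    * (\prod_(B in (shape G).2) \prod_(e in B) ph (X e.1)).
Proof.
have endsE v : ends_at G v = enum (fibre G v).
  rewrite /ends_at [RHS]/enum_mem -enumT; apply: eq_filter => e.
  by rewrite /= inE.
have ii := @fibre_inj G.
congr (_ * _).
  have -> : (shape G).1 :\: (shape G).2
          = [set fibre G v | v in [set v in vertices G | inner v]].
    apply/setP => B; rewrite inE; apply/andP/imsetP => [[+ /fibreP[e eB]]|[v]].
      rewrite eB fibre_outer negbK => ie; exists (G e) => //.
      by rewrite inE ie andbT; apply: imset_f.
    rewrite inE => /andP[/imsetP[e _ ->] iv] ->; rewrite fibre_outer negbK iv.
    by split => //; apply/fibreP; exists e.
  rewrite big_imset /=; last first.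
    by move=> u v; rewrite !inE => /andP[uG _] /andP[vG _]; exact: ii.
  by apply: eq_big => [v|v _]; rewrite ?inE // endsE.
rewrite big_imset /=; last first.
  by move=> u v; rewrite !inE => /andP[uG _] /andP[vG _]; exact: ii.
by apply: eq_big => [v|v _]; rewrite ?inE // endsE big_enum.
Qed.

(** Choosing which singleton blocks are outer vertices is expanding a
    product of binomials. *)
Lemma prod_outer_choice (R : comNzRingType) P (f g : {set edge_end m} -> R) :
  \sum_(Q : {set {set edge_end m}} | (Q \subset P) && [forall B in Q, #|B| == 1%N])
     (\prod_(B in P :\: Q) f B) * (\prod_(B in Q) g B)
  = \prod_(B in P) (f B + (if #|B| == 1%N then g B else 0)).
Proof.
rewrite [RHS]big_mkcond /=.
under [RHS]eq_bigr => B _.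
  rewrite (_ : (if B \in P then _ else 1) =
     (if B \in P then if #|B| == 1%N then g B else 0 else 0)
     + (if B \in P then f B else 1)); last by case: ifP; rewrite ?add0r // addrC.
  over.
rewrite bigA_distr [LHS]big_mkcond /=; apply: eq_big => // Q _.
case: ifPn => [/andP[QP /forall_inP Q1]|].
  rewrite [X in X * _ = _]big_mkcond [X in _ * X = _]big_mkcond -big_split /=.
  apply: eq_bigr => B _; rewrite inE; case: (boolP (B \in Q)) => BQ /=.
    by rewrite (subsetP QP) // (eqP (Q1 B BQ)) eqxx mul1r.
  by rewrite mulr1.
rewrite negb_and => /orP[/subsetPn[B BQ nBP]|/forall_inPn[B BQ nB1]].
  by rewrite (bigD1 B) //= BQ (negPf nBP) mul0r.
by rewrite (bigD1 B) //= BQ (negPf nB1) if_same mul0r.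
Qed.

(** Vertices joined by a path have their edges in the same saturated sets;
    conversely the edges that can be reached from a vertex form a saturated
    set. *)
Lemma connected_graph_shape G :
  connected_graph G = edge_connected (shape G).1 setT.
Proof.
have adj j b b' : adjacent G (G (j, b)) (G (j, b')) || (b == b').
  case: (eqVneq b b') => [->|]; rewrite ?orbT //= => bb'.
  by rewrite orbF; apply/existsP; exists j; case: b b' bb' => [] [] //= _;
    rewrite !eqxx ?orbT.
have con j b b' : connect (adjacent G) (G (j, b)) (G (j, b')).
  by case/orP: (adj j b b') => [/connect1 //|/eqP ->]; exact: connect0.
apply/forall_inP/forall_inP => [cG T /and3P[_ /set0Pn[j0 j0T] sT]|eG u uG].
  have sat e e' : G e = G e' -> e.1 \in T -> e'.1 \in T.
    move=> ee' eT; have : fibre G (G e) \in (shape G).1 by apply/fibreP; exists e.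
    move=> /(saturatedP _ _ sT)/orP[/subsetP/(_ e')|]; first by rewrite !inE ee'; apply.
    by move/disjoint_setI0/setP/(_ e); rewrite !inE eqxx eT.
  pose a := [pred v | [exists e, (G e == v) && (e.1 \in T)]].
  have cl u v : adjacent G u v -> u \in a -> v \in a.
    move=> /existsP[j aj] /existsP[e /andP[/eqP Ge eT]].
    case/orP: aj => /andP[/eqP Gf /eqP Gt]; apply/existsP.
      exists (j, true); rewrite Gt eqxx.
      exact: (sat _ (j, false) (etrans Ge (esym Gf)) eT).
    exists (j, false); rewrite Gf eqxx.
    exact: (sat _ (j, true) (etrans Ge (esym Gt)) eT).
  have pa u v : connect (adjacent G) u v -> u \in a -> v \in a.
    case/connectP => p + ->; elim: p u => [//|w p IHp] u /= /andP[uw wp] ua.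
    by apply: IHp => //; exact: cl uw ua.
  apply/eqP/setP => j; rewrite inE.
  have /forall_inP/(_ (G (j, false)) (imset_f _ isT))/pa := cG (G (j0, false)) (imset_f _ isT).
  have ua : G (j0, false) \in a by apply/existsP; exists (j0, false); rewrite eqxx.
  by move=> /(_ ua)/existsP[e /andP[/eqP eG eT]]; rewrite (sat e (j, false)).
case/imsetP: uG => -[j b] _ eu.
pose T := [set i | connect (adjacent G) u (G (i, false))].
have TT : T = setT.
  apply/eqP/eG; rewrite subsetT /=; apply/andP; split.
    by apply/set0Pn; exists j; rewrite inE eu con.
  apply/saturatedP => _ /fibreP[e ->].
  have up e' : G e' = G e -> connect (adjacent G) u (G e) = (e'.1 \in T).
    case: e' => i c <-; rewrite inE /=.
    by apply/idP/idP => h; apply: connect_trans h (con _ _ _).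
  case h : (connect (adjacent G) u (G e)).
    by apply/orP; left; apply/subsetP => e'; rewrite !inE => /eqP/up; rewrite h inE => <-.
  apply/orP; right; rewrite -setI_eq0; apply/eqP/setP => e'; rewrite !inE.
  by apply/negP => /andP[/eqP/up]; rewrite h inE => <-.
apply/forall_inP => _ /imsetP[[i c] _ ->].
have : i \in T by rewrite TT inE.
by rewrite inE => h; apply: connect_trans h (con _ _ _).
Qed.

End GraphShapes.

Section GraphSums.
Variables (m d : nat) (R : comNzRingType) (k : seq 'I_d -> R) (ph : 'I_d -> R).

(** The two terms are the inner vertex and, for a single end, the outer
    vertex. *)
Definition vertex_weight (s : seq 'I_d) : R :=
  k s + (if s is [:: i] then ph i else 0).

Lemma Qbar_sum_partition (c : pred {set {set edge_end m}}) :
  \sum_(G in Qbar m | c (shape G).1) \sum_(X : {ffun 'I_m -> 'I_d})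
     (\prod_(v in vertices G | inner v) k [seq X e.1 | e <- ends_at G v])
     * (\prod_(v in vertices G | ~~ inner v) \prod_(e <- ends_at G v) ph (X e.1))
  = \sum_(X : {ffun 'I_m -> 'I_d}) \sum_(P | partition P setT && c P)
      \prod_(B in P) block_weight vertex_weight X B.
Proof.
rewrite exchange_big; apply: eq_bigr => X _ /=.
under eq_bigr do rewrite value_shape.
rewrite (Qbar_sum_shape c (fun P Q =>
   (\prod_(B in P :\: Q) k [seq X e.1 | e <- enum B])
    * (\prod_(B in Q) \prod_(e in B) ph (X e.1)))).
apply: eq_bigr => P _; rewrite prod_outer_choice; apply: eq_bigr => B _.
rewrite /block_weight /vertex_weight; congr (_ + _).
rewrite -(big_enum _ _ _ (fun e => ph (X e.1))) /= cardE.
by case: (enum B) => [|e [|e' s]] //=; rewrite big_seq1.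
Qed.

Lemma Qbar_sum_labelled :
  \sum_(G in Qbar m) \sum_(X : {ffun 'I_m -> 'I_d})
     (\prod_(v in vertices G | inner v) k [seq X e.1 | e <- ends_at G v])
     * (\prod_(v in vertices G | ~~ inner v) \prod_(e <- ends_at G v) ph (X e.1))
  = labelled_sum vertex_weight m.
Proof.
have := Qbar_sum_partition predT; under eq_bigl do rewrite andbT; move=> ->.
rewrite /labelled_sum endsT /partition_sum; apply: eq_bigr => X _.
by apply: eq_bigl => P; rewrite andbT.
Qed.

Lemma Qbar_c_sum_labelled :
  \sum_(G in Qbar_c m) \sum_(X : {ffun 'I_m -> 'I_d})
     (\prod_(v in vertices G | inner v) k [seq X e.1 | e <- ends_at G v])
     * (\prod_(v in vertices G | ~~ inner v) \prod_(e <- ends_at G v) ph (X e.1))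
  = labelled_connected_sum vertex_weight m.
Proof.
have := Qbar_sum_partition (fun P => edge_connected P setT).
rewrite /labelled_connected_sum /connected_sum endsT => <-.
by apply: eq_bigl => G; rewrite inE connected_graph_shape.
Qed.

End GraphSums.

From mathcomp Require Import complex ring lra.
From mathcomp Require Import all_classical all_reals all_analysis.
From mathcomp Require Import measurable_realfun.

Import numFieldNormedType.Exports.

Local Open Scope classical_set_scope.
Local Open Scope ring_scope.

Section ValueSums.
Variables (m d : nat) (R : realType) (a : 'rV[R]_d) (z t : R) (phi : 'rV[R]_d).
Variable r : {measure set (Rd R d) -> \bar R}.
Let weight := vertex_weight (fun s => t * Defs.coefC a z r s) (phi 0).

Lemma Qbar_value_sum :
  \sum_(G in Qbar m) value a z r t phi G = labelled_sum weight m.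
Proof. exact: Qbar_sum_labelled. Qed.

Lemma Qbar_c_value_sum :
  \sum_(G in Qbar_c m) value a z r t phi G = labelled_connected_sum weight m.
Proof. exact: Qbar_c_sum_labelled. Qed.

End ValueSums.

(** * Taylor estimates for the cosine and the exponential *)

Section Estimates.
Variable R : realType.
Implicit Types (x : R) (n : nat).

Lemma derive_continuous (f f' : R -> R) :
  (forall x, is_derive x 1 f (f' x)) -> continuous f.
Proof.
move=> df x; apply: differentiable_continuous; apply/derivable1_diffP.
by case: (df x).
Qed.

Lemma ge0_of_derive (f f' : R -> R) : (forall x, is_derive x 1 f (f' x)) ->
  f 0 = 0 -> (forall x, 0 <= x -> 0 <= f' x) -> forall x, 0 <= x -> 0 <= f x.
Proof.
move=> df f0 f'0 x x0.
have cf : {within `[0, x], continuous f}.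
  exact/continuous_subspaceT/(derive_continuous df).
have [c c0 e] := MVT_segment x0 (fun y _ => df y) cf.
rewrite f0 !subr0 in e; rewrite e mulr_ge0 // f'0 //.
by move: c0; rewrite in_itv /= => /andP[].
Qed.

Lemma is_derive_pow_fact n x :
  is_derive x 1 (fun y : R => y ^+ n.+1 / n.+1`!%:R) (x ^+ n / n`!%:R).
Proof.
have := is_derive_poly ((n.+1`!%:R)^-1 *: 'X^(n.+1)) x.
rewrite derivZ derivXn !hornerE hornerMn hornerXn => h.
have -> : (fun y : R => y ^+ n.+1 / n.+1`!%:R)
          = (fun y => ((n.+1`!%:R)^-1 *: 'X^(n.+1)).[y]).
  by apply/funext => y; rewrite !hornerE mulrC.
have -> // : x ^+ n / n`!%:R = (n.+1`!%:R)^-1 * (x ^+ n *+ n.+1).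
rewrite -[_ *+ n.+1]mulr_natl factS natrM; field.
by rewrite nat1r !pnatr_eq0 -lt0n fact_gt0.
Qed.

(** [(-1)^n] times the remainder of the Taylor polynomial of degree [2n - 2] of
    the cosine. In this form the recursion, the derivatives and the sign are all
    visible; likewise for [sin_rem] and [exp_rem]. *)
Fixpoint cos_rem n x : R :=
  if n is k.+1 then x ^+ (2 * k) / (2 * k)`!%:R - cos_rem k x else cos x.

Fixpoint sin_rem n x : R :=
  if n is k.+1 then x ^+ (2 * k).+1 / (2 * k).+1`!%:R - sin_rem k x else sin x.

Lemma is_derive_rem n x :
  is_derive x 1 (sin_rem n) (cos_rem n x)
  /\ is_derive x 1 (cos_rem n.+1) (sin_rem n x).
Proof.
elim: n => [|n [IHs IHc]].
  split; first exact: is_derive_sin.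
  have h : is_derive x 1 (cst 1 - cos) (0 - (- sin x)) by apply: is_deriveB.
  rewrite sub0r opprK in h.
  have -> // : cos_rem 1 = (cst 1 - cos).
  by apply/funext => y; rewrite /= muln0 expr0 divr1.
have hs : is_derive x 1 (sin_rem n.+1) (cos_rem n.+1 x).
  have := is_deriveB (is_derive_pow_fact (2 * n) x) IHs; exact.
split => //.
have -> : cos_rem n.+2
  = (fun y : R => y ^+ (2 * n).+2 / (2 * n).+2`!%:R) - cos_rem n.+1.
  apply/funext => y.
  by rewrite -[LHS]/(y ^+ (2 * n.+1) / (2 * n.+1)`!%:R - cos_rem n.+1 y) mulnS.
exact: is_deriveB (is_derive_pow_fact (2 * n).+1 x) IHc.
Qed.

Lemma rem0 n : sin_rem n 0 = 0 /\ cos_rem n.+1 0 = 0.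
Proof.
elim: n => [|n [IHs IHc]].
  by rewrite /= sin0 cos0 muln0 expr0 divr1 subrr.
split; first by rewrite /= IHs expr0n mul0r subrr.
by rewrite [LHS]/= -[X in _ - X]/(cos_rem n.+1 0) IHc mulnS expr0n mul0r subrr.
Qed.

Lemma cos_remN n x : cos_rem n (- x) = cos_rem n x.
Proof.
elim: n => [|n IHn] /=; first by rewrite cosN.
by rewrite IHn !exprM sqrrN.
Qed.

(** The derivatives of the remainders are the previous remainders, and all of
    them vanish at 0, so the sign propagates from [1 - cos]. *)
Lemma cos_rem_ge0 n x : 0 <= cos_rem n.+1 x.
Proof.
wlog x0 : x / 0 <= x.
  move=> h; have [/h //|/ltW] := leP 0 x.
  by rewrite -oppr_ge0 => /h; rewrite cos_remN.
move: x x0; elim: n => [|n IHn] x x0.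
  by rewrite /= muln0 expr0 divr1 subr_ge0 cos_le1.
apply: (ge0_of_derive (fun y => (is_derive_rem n.+1 y).2) _ _ x0).
  by case: (rem0 n.+1).
move=> y y0; apply: (ge0_of_derive (fun y => (is_derive_rem n.+1 y).1) _ _ y0).
  by case: (rem0 n.+1).
by move=> w w0; exact: IHn.
Qed.

Lemma cos_rem_le n x : cos_rem n.+1 x <= x ^+ (2 * n.+1) / (2 * n.+1)`!%:R.
Proof. by rewrite -subr_ge0; exact: (cos_rem_ge0 n.+1). Qed.

Lemma cos_rem_ge n x :
  x ^+ (2 * n.+1) / (2 * n.+1)`!%:R - x ^+ (2 * n.+2) / (2 * n.+2)`!%:R
  <= cos_rem n.+1 x.
Proof. by rewrite lerBlDr -lerBlDl; exact: (cos_rem_le n.+1). Qed.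

Fixpoint exp_rem n x : R :=
  if n is k.+1 then x ^+ k / k`!%:R - exp_rem k x else expR (- x).

Lemma exp_remE n x :
  expR (- x) - \sum_(j < n) (- x) ^+ j / j`!%:R = (-1) ^+ n * exp_rem n x.
Proof.
elim: n => [|n IHn]; first by rewrite big_ord0 subr0 expr0 mul1r.
rewrite big_ord_recr /= opprD addrA IHn exprS mulN1r mulNr mulrBr opprB.
by rewrite -[- x]mulN1r exprMn mulrA.
Qed.

Lemma is_derive_exp_rem n x : is_derive x 1 (exp_rem n.+1) (exp_rem n x).
Proof.
elim: n => [|n IHn].
  have h0 : is_derive x 1 (expR \o (fun y : R => - y)) (expR (- x) * -1).
    by apply: is_derive1_comp; exact: is_deriveNid.
  have := is_deriveB (is_derive_cst (1 : R) x 1) h0.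
  rewrite sub0r mulrN1 opprK => h.
  have -> // : exp_rem 1 = (cst 1 - expR \o (fun y : R => - y)).
  by apply/funext => y; rewrite /= expr0 divr1.
by have := is_deriveB (is_derive_pow_fact n x) IHn; exact.
Qed.

Lemma exp_rem_ge0 n x : 0 <= x -> 0 <= exp_rem n x.
Proof.
elim: n x => [|n IHn] x x0; first exact: expR_ge0.
apply: (ge0_of_derive (is_derive_exp_rem n) _ _ x0) => //.
elim: (n) => [|k IHk]; first by rewrite /= oppr0 expR0 expr0 divr1 subrr.
by rewrite [LHS]/= -[X in _ - X]/(exp_rem k.+1 0) IHk expr0n mul0r subrr.
Qed.

Lemma expRN_taylor n x : 0 <= x ->
  `|expR (- x) - \sum_(j < n) (- x) ^+ j / j`!%:R| <= x ^+ n / n`!%:R.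
Proof.
move=> x0; rewrite exp_remE normrM normrX normrN1 expr1n mul1r.
rewrite ger0_norm ?exp_rem_ge0 // -subr_ge0; exact: (exp_rem_ge0 n.+1).
Qed.

End Estimates.

(** * The complex exponential and first order expansions *)

Section ComplexExp.
Local Open Scope complex_scope.
Variable R : realType.
Implicit Types (x y h : R) (u v w : R[i]) (f g : R -> R[i]).
Local Notation nc := (@ComplexField.Normc.normc R).
Local Notation Re := (@complex.Re R).
Local Notation Im := (@complex.Im R).

Lemma nc_real x : nc x%:C = `|x|.
Proof. by rewrite /= expr0n /= addr0 sqrtr_sqr. Qed.

Lemma nc_ge0 u : 0 <= nc u.
Proof. by case: u => a b; exact: sqrtr_ge0. Qed.

Lemma nc_Re u : `|Re u| <= nc u.
Proof.
by case: u => a b /=; rewrite -sqrtr_sqr ler_sqrt ?addr_ge0 ?sqr_ge0 // lerDl sqr_ge0.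
Qed.

Lemma nc_Im u : `|Im u| <= nc u.
Proof.
by case: u => a b /=; rewrite -sqrtr_sqr ler_sqrt ?addr_ge0 ?sqr_ge0 // lerDr sqr_ge0.
Qed.

Lemma nc_le u : nc u <= `|Re u| + `|Im u|.
Proof.
case: u => a b /=.
rewrite -[leRHS]ger0_norm ?addr_ge0 // -sqrtr_sqr ler_sqrt ?sqr_ge0 //.
rewrite sqrrD !real_normK ?num_real // lerD2r lerDl.
by rewrite mulrn_wge0 // mulr_ge0.
Qed.

Lemma ncD u v : nc (u + v) <= nc u + nc v.
Proof. exact: le_normcD. Qed.

Lemma ncM u v : nc (u * v) = nc u * nc v.
Proof. exact: ComplexField.Normc.normcM. Qed.

Lemma cexpD u v : cexp (u + v) = cexp u * cexp v.
Proof.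
case: u => a b; case: v => c e; rewrite /cexp /= expRD cosD sinD.
by apply/eqP; rewrite eq_complex /=; apply/andP; split; apply/eqP; ring.
Qed.

Lemma cexp0 : cexp (0 : R[i]) = 1.
Proof. by rewrite /cexp /= expR0 cos0 sin0 mulr1 mulr0. Qed.

Lemma nc_cexp u : nc (cexp u) = expR (Re u).
Proof.
by rewrite /cexp /= !exprMn -mulrDr cos2Dsin2 mulr1 sqrtr_sqr ger0_norm ?expR_ge0.
Qed.

Lemma sin_le_id y : 0 <= y -> sin y <= y.
Proof.
move=> y0; rewrite -subr_ge0.
have := ge0_of_derive (fun y => (is_derive_rem 1 y).1) (rem0 R 1).1 _ y0.
rewrite /= muln0 expr1 divr1; apply.
by move=> x _; rewrite expr0 divr1 subr_ge0 cos_le1.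
Qed.

Lemma sin_sub_bound y : `|sin y - y| <= y ^+ 2.
Proof.
have pos (w : R) : 0 <= w -> w - sin w <= w ^+ 2.
  move=> w0.
  have d (z : R) : is_derive z 1 (fun w : R => w ^+ 2 / 2`!%:R - sin_rem 1 w)
              (z ^+ 1 / 1`!%:R - cos_rem 1 z).
    exact: is_deriveB (is_derive_pow_fact 1 z) (is_derive_rem 1 z).1.
  have : 0 <= w ^+ 2 / 2`!%:R - sin_rem 1 w.
    apply: (ge0_of_derive d) => //.
      by rewrite (rem0 R 1).1 expr0n mul0r subrr.
    move=> z z0; rewrite /= expr1 muln0 expr0 !divr1 subr_ge0.
    have d' (q : R) : is_derive q 1 (fun w : R => w ^+ 1 / 1`!%:R - cos_rem 1 w)
              (q ^+ 0 / 0`!%:R - sin_rem 0 q).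
      exact: is_deriveB (is_derive_pow_fact 0 q) (is_derive_rem 0 q).2.
    have := ge0_of_derive d' _ _ z0.
    rewrite (rem0 R 0).2 expr0n mul0r subrr /= muln0 expr1 expr0 !divr1 subr_ge0.
    by apply => // q _; rewrite subr_ge0 sin_le1.
  rewrite /= muln0 expr1 divr1 !subr_ge0 => h1.
  apply: le_trans h1 _; rewrite ler_pdivrMr ?ltr0n //.
  by rewrite ler_peMr ?sqr_ge0 // ler1n.
have [y0|/ltW y0] := leP 0 y.
  by rewrite distrC ger0_norm ?subr_ge0 ?sin_le_id // pos.
have ny : 0 <= - y by rewrite oppr_ge0.
rewrite ger0_norm; first by have := pos _ ny; rewrite sinN sqrrN; lra.
by have := sin_le_id ny; rewrite sinN; lra.
Qed.

Lemma expR_sub1_bound x : `|expR x - 1| <= `|x| * expR `|x|.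
Proof.
have e1 := expR_ge1Dx x; have e2 := expR_ge1Dx (- x).
have ex := expR_gt0 x.
have [x0|/ltW x0] := leP 0 x.
  rewrite ger0_norm ?subr_ge0 -?expR0 ?ler_expR // [expR 0]expR0 (ger0_norm x0).
  have : (1 - x) * expR x <= 1.
    by rewrite -ler_pdivlMr // mul1r -expRN.
  lra.
rewrite ler0_norm ?subr_le0 -?expR0 ?ler_expR // [expR 0]expR0 (ler0_norm x0).
have : 1 <= expR (- x) by rewrite -expR0 ler_expR; lra.
by nra.
Qed.

Lemma expR_sub1x_bound x : `|expR x - 1 - x| <= x ^+ 2 * expR `|x|.
Proof.
have e1 := expR_ge1Dx x; have e2 := expR_ge1Dx (- x); have ex := expR_gt0 x.
rewrite ger0_norm; last by lra.
have : (1 - x) * expR x <= 1.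
  by rewrite -ler_pdivlMr // mul1r -expRN.
have h2 := expR_sub1_bound x.
have h3 : x * (expR x - 1) <= `|x| * `|expR x - 1|.
  by rewrite -normrM ler_norm.
have h4 : `|x| * `|expR x - 1| <= `|x| * (`|x| * expR `|x|) by rewrite ler_wpM2l.
have h5 : `|x| * (`|x| * expR `|x|) = x ^+ 2 * expR `|x|.
  by rewrite mulrA -expr2 real_normK ?num_real.
rewrite -h5; lra.
Qed.

(** The factor [expR (nc u)] makes the bound uniform in [u]; after multiplication
    with a monomial it is integrable because of the exponential moments. *)
Lemma cexp_taylor1 u : nc (cexp u - 1 - u) <= 5 * nc u ^+ 2 * expR (nc u).
Proof.
apply: le_trans (nc_le _) _; case: u => x y; set N := nc _.
have Nx : `|x| <= N := nc_Re (x +i* y).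
have Ny : `|y| <= N := nc_Im (x +i* y).
have N0 : 0 <= N by apply: nc_ge0.
have eN : 1 <= expR N by rewrite -expR0 ler_expR.
have exN : expR x <= expR N by rewrite ler_expR (le_trans (ler_norm x)).
have exaN : expR `|x| <= expR N by rewrite ler_expR.
have ex0 := expR_gt0 x.
have x2 : x ^+ 2 <= N ^+ 2 by rewrite -real_normK ?num_real // lerXn2r.
have y2 : y ^+ 2 <= N ^+ 2 by rewrite -[y ^+ 2]real_normK ?num_real // lerXn2r.
have x20 := sqr_ge0 x; have y20 := sqr_ge0 y; have N20 := sqr_ge0 N.
rewrite /cexp /=.
have r1 : `|expR x * cos y - 1 - x| <= 2 * N ^+ 2 * expR N.
  have -> : expR x * cos y - 1 - x = (expR x - 1 - x) + expR x * (cos y - 1) by ring.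
  apply: le_trans (ler_normD _ _) _.
  have a1 := expR_sub1x_bound x.
  have a2 : `|expR x * (cos y - 1)| <= expR N * N ^+ 2.
    rewrite normrM gtr0_norm // ler_pM //.
    have c0 := cos_rem_ge0 0 y; have c1 := cos_rem_le 0 y.
    move: c0 c1; rewrite /= muln0 expr0 divr1 muln1 => c0 c1.
    rewrite distrC ger0_norm //; apply: le_trans c1 _.
    by rewrite ler_pdivrMr ?ltr0n // (le_trans y2) // ler_peMr // ler1n.
  have a3 : x ^+ 2 * expR `|x| <= N ^+ 2 * expR N by rewrite ler_pM // expR_ge0.
  lra.
have r2 : `|expR x * sin y - 0 - y| <= 3 * N ^+ 2 * expR N.
  have -> : expR x * sin y - 0 - y = expR x * (sin y - y) + (expR x - 1) * y by ring.
  apply: le_trans (ler_normD _ _) _; rewrite !normrM (gtr0_norm ex0).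
  have a1 : expR x * `|sin y - y| <= expR N * N ^+ 2.
    by rewrite ler_pM ?(ltW ex0) // (le_trans (sin_sub_bound y)).
  have a2 : `|expR x - 1| * `|y| <= (N * expR N) * N.
    rewrite ler_pM // (le_trans (expR_sub1_bound x)) // ler_pM // expR_ge0 //.
  nra.
by move: r1 r2; lra.
Qed.


(** Differentiability at 0 with a quadratic remainder. It is stable under sums,
    products and the exponential, and both the derivative
    ([first_order_diff_quotient]) and a bound for the second symmetric difference
    ([first_order_symm]) can be read off from it. *)
Definition first_order f (f1 : R[i]) :=
  exists C, forall h, `|h| <= 1 -> nc (f h - f 0 - h%:C * f1) <= C * h ^+ 2.

Lemma eq_first_order f g (f1 g1 : R[i]) : f =1 g -> f1 = g1 ->
  first_order f f1 -> first_order g g1.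
Proof. by move=> /funext -> ->. Qed.

Lemma first_order_ge0 f (f1 : R[i]) : first_order f f1 ->
  exists C, 0 <= C /\ forall h, `|h| <= 1 -> nc (f h - f 0 - h%:C * f1) <= C * h ^+ 2.
Proof.
case=> C hC; exists `|C|; split => // h h1.
by rewrite (le_trans (hC h h1)) // ler_wpM2r ?sqr_ge0 // ler_norm.
Qed.

Lemma sqr_le_norm h : `|h| <= 1 -> h ^+ 2 <= `|h|.
Proof. by move=> h1; rewrite -real_normK ?num_real // expr2 ler_piMr. Qed.

Lemma first_order_lip f (f1 : R[i]) : first_order f f1 ->
  exists C, 0 <= C /\ forall h, `|h| <= 1 -> nc (f h - f 0) <= C * `|h|.
Proof.
case/first_order_ge0 => C [C0 hC]; exists (C + nc f1).
split; first by rewrite addr_ge0 ?nc_ge0.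
move=> h h1; have -> : f h - f 0 = (f h - f 0 - h%:C * f1) + h%:C * f1 by rewrite subrK.
apply: le_trans (ncD _ _) _; rewrite ncM nc_real mulrDl [`|h| * _]mulrC lerD2r.
by apply: le_trans (hC h h1) _; rewrite ler_wpM2l // sqr_le_norm.
Qed.

Lemma first_order_bound f (f1 : R[i]) : first_order f f1 ->
  exists C, 0 <= C /\ forall h, `|h| <= 1 -> nc (f h) <= C.
Proof.
case/first_order_lip => C [C0 hC]; exists (C + nc (f 0)).
split; first by rewrite addr_ge0 ?nc_ge0.
move=> h h1; have -> : f h = (f h - f 0) + f 0 by rewrite subrK.
apply: le_trans (ncD _ _) _; rewrite lerD2r (le_trans (hC h h1)) //.
by rewrite ler_piMr.
Qed.

Lemma first_order_affine u v : first_order (fun h => u + h%:C * v) v.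
Proof.
exists 0 => h _; have -> : u + h%:C * v - (u + 0%:C * v) - h%:C * v = 0%:C by ring.
by rewrite nc_real normr0 mul0r.
Qed.

Lemma first_order_cst u : first_order (fun=> u) 0.
Proof. by exists 0 => h _; rewrite subrr mulr0 subrr (nc_real 0) normr0 mul0r. Qed.

Lemma first_orderD f g (f1 g1 : R[i]) : first_order f f1 -> first_order g g1 ->
  first_order (fun h => f h + g h) (f1 + g1).
Proof.
case=> [C hC] [D hD]; exists (C + D) => h h1.
have -> : f h + g h - (f 0 + g 0) - h%:C * (f1 + g1)
  = (f h - f 0 - h%:C * f1) + (g h - g 0 - h%:C * g1) by ring.
by rewrite (le_trans (ncD _ _)) // mulrDl lerD ?hC ?hD.
Qed.

Lemma first_orderM f g (f1 g1 : R[i]) : first_order f f1 -> first_order g g1 ->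
  first_order (fun h => f h * g h) (f1 * g 0 + f 0 * g1).
Proof.
move=> hf hg; have [C [C0 hC]] := first_order_ge0 hf.
have [D [D0 hD]] := first_order_ge0 hg; have [B [B0 hB]] := first_order_bound hg.
exists (C * B + (nc (f 0) + nc f1) * D + nc f1 * nc g1) => h h1.
set F := f h - f 0 - h%:C * f1; set G := g h - g 0 - h%:C * g1.
have -> : f h * g h - f 0 * g 0 - h%:C * (f1 * g 0 + f 0 * g1)
  = F * g h + (f 0 + h%:C * f1) * G + (h%:C * h%:C) * (f1 * g1) by rewrite /F /G; ring.
have hF : nc F <= C * h ^+ 2 by exact: hC.
have hG : nc G <= D * h ^+ 2 by exact: hD.
clearbody F G; rewrite [leRHS]mulrDl; apply: le_trans (ncD _ _) _; apply: lerD.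
  rewrite [leRHS]mulrDl; apply: le_trans (ncD _ _) _; rewrite !ncM; apply: lerD.
    by rewrite mulrAC ler_pM ?nc_ge0 ?hB.
  rewrite -mulrA ler_pM ?nc_ge0 //.
  by rewrite (le_trans (ncD _ _)) // lerD2l ncM nc_real ler_piMl ?nc_ge0.
by rewrite !ncM nc_real -expr2 real_normK ?num_real // mulrC.
Qed.

Lemma first_orderZ u f (f1 : R[i]) :
  first_order f f1 -> first_order (fun h => u * f h) (u * f1).
Proof.
move=> hf; have := first_orderM (first_order_cst u) hf.
by apply: eq_first_order => //; rewrite mul0r add0r.
Qed.

Lemma first_order_sum (I : finType) (P : pred I) (F : I -> R -> R[i]) (F1 : I -> R[i]) :
  (forall i, P i -> first_order (F i) (F1 i)) ->
  first_order (fun h => \sum_(i | P i) F i h) (\sum_(i | P i) F1 i).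
Proof.
move=> hF; elim: (index_enum I) => [|i s IHs].
  by apply: eq_first_order (first_order_cst 0) => [h|]; rewrite big_nil.
case Pi : (P i); last first.
  by apply: eq_first_order IHs => [h|]; rewrite big_cons Pi.
by apply: eq_first_order (first_orderD (hF i Pi) IHs) => [h|]; rewrite big_cons Pi.
Qed.

Lemma first_order_cexp f (f1 : R[i]) : first_order f f1 ->
  first_order (fun h => cexp (f h)) (f1 * cexp (f 0)).
Proof.
move=> hf; have [C [C0 hC]] := first_order_ge0 hf; have [L [L0 hL]] := first_order_lip hf.
exists (nc (cexp (f 0)) * (5 * L ^+ 2 * expR L + C)) => h h1.
set dl := f h - f 0.
have -> : cexp (f h) - cexp (f 0) - h%:C * (f1 * cexp (f 0))
  = cexp (f 0) * ((cexp dl - 1 - dl) + (dl - h%:C * f1)).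
  have -> : f h = f 0 + dl by rewrite /dl addrC subrK.
  by rewrite cexpD; ring.
rewrite ncM -[leRHS]mulrA ler_wpM2l ?nc_ge0 // [leRHS]mulrDl.
apply: le_trans (ncD _ _) _; apply: lerD; last exact: hC.
have dL : nc dl <= L by rewrite (le_trans (hL h h1)) // ler_piMr.
apply: le_trans (cexp_taylor1 _) _.
rewrite [leRHS]mulrAC ler_pM ?expR_ge0 ?ler_expR // ?mulr_ge0 ?sqr_ge0 ?nc_ge0 //.
rewrite -mulrA ler_wpM2l // -[h ^+ 2]real_normK ?num_real // -exprMn.
by rewrite lerXn2r ?nnegrE ?nc_ge0 ?mulr_ge0 ?hL.
Qed.

Lemma first_order_symm f (f1 : R[i]) : first_order f f1 ->
  exists C, forall h, `|h| <= 1 -> nc (f h + f (- h) - 2 * f 0) <= C * h ^+ 2.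
Proof.
case=> C hC; exists (C + C) => h h1.
have -> : f h + f (- h) - 2 * f 0
  = (f h - f 0 - h%:C * f1) + (f (- h) - f 0 - (- h)%:C * f1) by rewrite rmorphN; ring.
rewrite (le_trans (ncD _ _)) // mulrDl lerD ?hC //.
by rewrite -[h ^+ 2]sqrrN hC ?normrN.
Qed.

Lemma first_order_diff_quotient f (f1 : R[i]) : first_order f f1 ->
  exists C, forall h, 0 < h <= 1 -> nc ((h^-1)%:C * (f h - f 0) - f1) <= C * h.
Proof.
case=> C hC; exists C => h /andP[h0 h1].
have -> : (h^-1)%:C * (f h - f 0) - f1 = (h^-1)%:C * (f h - f 0 - h%:C * f1).
  rewrite [RHS]mulrBr [(h^-1)%:C * (h%:C * _)]mulrA -rmorphM /= mulVf ?gt_eqF //.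
  by rewrite mul1r.
rewrite ncM nc_real gtr0_norm ?invr_gt0 // mulrC ler_pdivrMr //.
by rewrite -mulrA -expr2 hC // gtr0_norm.
Qed.

End ComplexExp.

(** * Integrals of real and of complex functions *)

Section RealIntegrals.
Local Open Scope complex_scope.
Context {dsp : measure_display} {T : measurableType dsp} {R : realType}.
Variable mu : {measure set T -> \bar R}.
Implicit Types f g : T -> R.

Definition rintegrable f := mu.-integrable setT (EFin \o f).

Lemma rintegrable_measurable f : rintegrable f -> measurable_fun setT f.
Proof. by move=> /measurable_int /measurable_EFinP. Qed.

Lemma rintegrable_le f g : measurable_fun setT f -> (forall x, `|f x| <= g x) ->
  rintegrable g -> rintegrable f.
Proof.
move=> mf fg; apply: le_integrable => //; first exact/measurable_EFinP.
by move=> x _ /=; rewrite lee_fin (le_trans (fg x)) // ler_norm.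
Qed.

Lemma rintegrableD f g : rintegrable f -> rintegrable g -> rintegrable (fun x => f x + g x).
Proof. by move=> hf hg; exact: (integrableD measurableT hf hg). Qed.

Lemma rintegrableB f g : rintegrable f -> rintegrable g -> rintegrable (fun x => f x - g x).
Proof. by move=> hf hg; exact: (integrableB measurableT hf hg). Qed.

Lemma rintegrableZ c f : rintegrable f -> rintegrable (fun x => c * f x).
Proof. by move=> hf; exact: (integrableZl measurableT c hf). Qed.

Lemma rintegrable_sum (I : finType) (F : I -> T -> R) : (forall i, rintegrable (F i)) ->
  rintegrable (fun x => \sum_i F i x).
Proof.
move=> hF; rewrite /rintegrable.
have -> : EFin \o (fun x => \sum_i F i x) = (fun x => \sum_i (EFin \o F i) x)%E.
  by apply/funext => x /=; rewrite sumEFin.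
by apply: integrable_sum => // i _; exact: hF.
Qed.

Lemma rintegrable_norm f : rintegrable f -> rintegrable (fun x => `|f x|).
Proof. by move=> hf; exact: (integrable_norm hf). Qed.

Lemma rintegrable_EFin f : rintegrable f -> (\int[mu]_x (f x)%:E = (\int[mu]_x f x)%:E)%E.
Proof. by move=> hf; rewrite /Rintegral fineK // integrable_fin_num. Qed.

Lemma rintegralD f g : rintegrable f -> rintegrable g ->
  \int[mu]_x (f x + g x) = \int[mu]_x f x + \int[mu]_x g x.
Proof. by move=> hf hg; rewrite RintegralD. Qed.

Lemma rintegralB f g : rintegrable f -> rintegrable g ->
  \int[mu]_x (f x - g x) = \int[mu]_x f x - \int[mu]_x g x.
Proof. by move=> hf hg; rewrite RintegralB. Qed.

Lemma rintegralZ c f : rintegrable f -> \int[mu]_x (c * f x) = c * \int[mu]_x f x.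
Proof. by move=> hf; rewrite RintegralZl. Qed.

Lemma rintegral_sum (I : finType) (F : I -> T -> R) : (forall i, rintegrable (F i)) ->
  \int[mu]_x (\sum_i F i x) = \sum_i \int[mu]_x F i x.
Proof.
move=> hF; apply: EFin_inj; rewrite -rintegrable_EFin; last exact: rintegrable_sum.
under eq_integral do rewrite -sumEFin.
rewrite (integral_sum measurableT) // -sumEFin.
by apply: eq_bigr => i _; rewrite rintegrable_EFin.
Qed.

Lemma rintegral_le f g : rintegrable f -> rintegrable g -> (forall x, f x <= g x) ->
  \int[mu]_x f x <= \int[mu]_x g x.
Proof. by move=> hf hg fg; apply: le_Rintegral. Qed.

Lemma rintegral_norm_le f g : rintegrable f -> rintegrable g -> (forall x, `|f x| <= g x) ->
  `|\int[mu]_x f x| <= \int[mu]_x g x.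
Proof.
move=> hf hg fg; apply: le_trans (le_normr_Rintegral measurableT hf) _.
by apply: rintegral_le => //; exact: rintegrable_norm.
Qed.

(** Fatou's lemma as a criterion of integrability: the limit is integrable, and
    its integral is bounded by the limit of the bounds. *)
Lemma rintegrable_fatou (fn : nat -> T -> R) f (Cn : nat -> R) C :
  (forall n, rintegrable (fn n)) -> measurable_fun setT f ->
  (forall n x, 0 <= fn n x) -> (forall x, fn n x @[n --> \oo] --> f x) ->
  (forall n, \int[mu]_x fn n x <= Cn n) -> Cn n @[n --> \oo] --> C ->
  rintegrable f /\ \int[mu]_x f x <= C.
Proof.
move=> ifn mf fn0 fnf fnC CnC.
have f0 x : 0 <= f x by apply: (cvgr_to_ge (fnf x)); near=> n; exact: fn0.
have key : (\int[mu]_x (f x)%:E <= C%:E)%E.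
  have -> : (\int[mu]_x (f x)%:E = \int[mu]_x limn_einf (fun n => (fn n x)%:E))%E.
    apply: eq_integral => x _; rewrite limn_einf_lim; apply/esym/cvg_lim => //.
    apply: cvg_einfs; apply: cvg_EFin (fnf x); near=> n => //.
  apply: (le_trans (fatou mu measurableT _ _)).
  - by move=> n; apply/measurable_EFinP/rintegrable_measurable.
  - by move=> n x _; rewrite lee_fin.
  have CE : (Cn n)%:E @[n --> \oo] --> C%:E by apply: cvg_EFin CnC; near=> n.
  rewrite limn_einf_lim -(cvg_lim _ CE) //; apply: lee_lim.
  - exact: is_cvg_einfs.
  - by apply/cvg_ex; exists C%:E.
  near=> n; apply: (@le_trans _ _ (\int[mu]_x (fn n x)%:E)%E).
    by apply: ereal_inf_lbound; exists n => /=.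
  by rewrite rintegrable_EFin // lee_fin.
have hf : rintegrable f.
  apply/integrableP; split; first exact/measurable_EFinP.
  under eq_integral do rewrite /= ger0_norm //.
  by rewrite (le_lt_trans key) // ltry.
by split => //; rewrite -lee_fin -rintegrable_EFin.
Unshelve. all: by end_near.
Qed.

Lemma rintegrable_dominated (fn : nat -> T -> R) f g :
  (forall n, measurable_fun setT (fn n)) -> measurable_fun setT f ->
  (forall x, fn n x @[n --> \oo] --> f x) -> rintegrable g ->
  (forall n x, `|fn n x| <= g x) ->
  \int[mu]_x fn n x @[n --> \oo] --> \int[mu]_x f x.
Proof.
move=> mfn mf fnf ig fng.
have if_ n : rintegrable (fn n) by apply: rintegrable_le ig.
have [] := @dominated_convergence _ T R mu setT measurableT
  (fun n => EFin \o fn n) (EFin \o f) (EFin \o g).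
- by move=> n; exact/measurable_EFinP.
- exact/measurable_EFinP.
- by apply: aeW => x _; apply: cvg_EFin (fnf x); near=> n.
- exact: ig.
- by apply: aeW => x n _; rewrite /= lee_fin.
move=> rf _ h.
apply: fine_cvg.
rewrite fineK ?integrable_fin_num //.
Unshelve. all: by end_near.
Qed.

End RealIntegrals.

Section Measurability.
Local Open Scope complex_scope.
Variables (R : realType) (d : nat).
Local Notation Re := (@complex.Re R).
Local Notation Im := (@complex.Im R).
Implicit Types (f g : Rd R d -> R[i]) (p : Rd R d -> R) (V : Rd R d -> 'rV[R]_d).

(** The measurable sets are generated by the open ones. *)
Lemma measurable_continuous_Rd (p : 'rV[R]_d -> R) :
  continuous p -> measurable_fun setT (p : Rd R d -> R).
Proof.
move=> cp; apply: (measurability _ (RGenOInfty.measurableE R)).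
move=> /= _ [_ [a ->]] <-; rewrite setTI; apply: sub_sigma_algebra.
by move/continuousP : cp; apply; exact: interval_open.
Qed.

Lemma measurable_coord X : measurable_fun setT (fun y : Rd R d => (y : 'rV[R]_d) 0 X).
Proof. by apply: measurable_continuous_Rd; exact: coord_continuous. Qed.

Definition cmeasurable f :=
  measurable_fun setT (fun y => Re (f y)) /\ measurable_fun setT (fun y => Im (f y)).

Lemma cmeasurable_real p : measurable_fun setT p -> cmeasurable (fun y => (p y)%:C).
Proof. by move=> mp; split => //=; exact: measurable_cst. Qed.

Lemma cmeasurable_cst (u : R[i]) : cmeasurable (fun=> u).
Proof. by split; exact: measurable_cst. Qed.

Lemma complex_ReD (u v : R[i]) : Re (u + v) = Re u + Re v. Proof. by case: u; case: v. Qed.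
Lemma complex_ImD (u v : R[i]) : Im (u + v) = Im u + Im v. Proof. by case: u; case: v. Qed.
Lemma complex_ReN (u : R[i]) : Re (- u) = - Re u. Proof. by case: u. Qed.
Lemma complex_ImN (u : R[i]) : Im (- u) = - Im u. Proof. by case: u. Qed.
Lemma complex_ReM (u v : R[i]) : Re (u * v) = Re u * Re v - Im u * Im v.
Proof. by case: u; case: v. Qed.
Lemma complex_ImM (u v : R[i]) : Im (u * v) = Re u * Im v + Im u * Re v.
Proof. by case: u => a b; case: v => a' b' /=. Qed.

Lemma cmeasurableD f g : cmeasurable f -> cmeasurable g -> cmeasurable (fun y => f y + g y).
Proof.
move=> [f1 f2] [g1 g2]; split.
  by under eq_fun do rewrite complex_ReD; exact: measurable_funD.
by under eq_fun do rewrite complex_ImD; exact: measurable_funD.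
Qed.

Lemma cmeasurableM f g : cmeasurable f -> cmeasurable g -> cmeasurable (fun y => f y * g y).
Proof.
move=> [f1 f2] [g1 g2]; split.
  by under eq_fun do rewrite complex_ReM; apply: measurable_funB; exact: measurable_funM.
by under eq_fun do rewrite complex_ImM; apply: measurable_funD; exact: measurable_funM.
Qed.

Lemma cmeasurableB f g : cmeasurable f -> cmeasurable g -> cmeasurable (fun y => f y - g y).
Proof.
move=> hf hg; have := cmeasurableD hf (cmeasurableM (cmeasurable_cst (-1)) hg).
by under [X in cmeasurable X]eq_fun do rewrite mulN1r.
Qed.

Lemma cmeasurable_sum (I : finType) (F : I -> Rd R d -> R[i]) :
  (forall i, cmeasurable (F i)) -> cmeasurable (fun y => \sum_i F i y).
Proof.
move=> hF; elim: (index_enum I) => [|i s IHs].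
  by under [X in cmeasurable X]eq_fun do rewrite big_nil; exact: cmeasurable_cst.
by under [X in cmeasurable X]eq_fun do rewrite big_cons; exact: cmeasurableD.
Qed.

Lemma cmeasurable_cexp f : cmeasurable f -> cmeasurable (fun y => cexp (f y)).
Proof.
move=> [f1 f2]; split => /=; apply: measurable_funM.
- exact: measurableT_comp (@measurable_expR R) f1.
- apply: measurableT_comp f2; apply: continuous_measurable_fun; exact: continuous_cos.
- exact: measurableT_comp (@measurable_expR R) f1.
- apply: measurableT_comp f2; apply: continuous_measurable_fun; exact: continuous_sin.
Qed.

Definition vmeasurable V := forall X, measurable_fun setT (fun y => V y 0 X).

Lemma vmeasurable_id : vmeasurable (fun y => y).
Proof. by move=> X; exact: measurable_coord. Qed.

Lemma vmeasurable_sub (phi : 'rV[R]_d) : vmeasurable (fun y => phi - (y : 'rV[R]_d)).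
Proof.
move=> X; under eq_fun do rewrite !mxE; apply: measurable_funB => //.
exact: measurable_coord.
Qed.

Lemma cmeasurable_cdot V w : vmeasurable V -> cmeasurable (fun y => cdot w (V y)).
Proof.
move=> mV; apply: cmeasurable_sum => X; apply: cmeasurableM; first exact: cmeasurable_cst.
exact: cmeasurable_real.
Qed.

(** Products of coordinates are indexed by sequences of indices, as the
    coefficients of the expansion are. *)
Definition monomial (Xs : seq 'I_d) (y : 'rV[R]_d) : R := \prod_(X <- Xs) y 0 X.

Lemma measurable_monomial V Xs :
  vmeasurable V -> measurable_fun setT (fun y => monomial Xs (V y)).
Proof. by move=> mV; apply: measurable_prod => X _; exact: mV. Qed.

Lemma cmeasurable_monomial_cexp V Xs w : vmeasurable V ->
  cmeasurable (fun y => (monomial Xs (V y))%:C * cexp (cdot w (V y))).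
Proof.
move=> mV; apply: cmeasurableM; first by apply: cmeasurable_real; exact: measurable_monomial.
by apply: cmeasurable_cexp; exact: cmeasurable_cdot.
Qed.

Lemma monomial_perm Xs Ys y : perm_eq Xs Ys -> monomial Xs y = monomial Ys y.
Proof. exact: perm_big. Qed.

Lemma monomial_cons X Xs y : monomial (X :: Xs) y = y 0 X * monomial Xs y.
Proof. by rewrite /monomial big_cons. Qed.

Lemma coord_le_norm (y : 'rV[R]_d) X : `|y 0 X| <= `|y|.
Proof.
have -> : `|y| = mx_norm y by [].
by rewrite mx_normrE; apply: le_trans (le_bigmax _ _ (0, X)).
Qed.

Lemma monomial_le_norm Xs (y : 'rV[R]_d) : `|monomial Xs y| <= `|y| ^+ size Xs.
Proof.
elim: Xs => [|X Xs IH]; first by rewrite /monomial big_nil normr1 expr0.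
by rewrite monomial_cons normrM exprS ler_pM // coord_le_norm.
Qed.

Lemma cdot_delta (c : R[i]) (w : 'rV[R[i]]_d) X (y : 'rV[R]_d) :
  cdot (w + c *: delta_mx 0 X) y = cdot w y + c * (y 0 X)%:C.
Proof.
rewrite /cdot; under eq_bigr do rewrite !mxE eqxx /= mulrDl.
rewrite big_split /=; congr (_ + _).
rewrite (bigD1 X) //= big1 => [|Y /negPf nYX]; first by rewrite eqxx mulr1 addr0.
by rewrite nYX mulr0 mul0r.
Qed.

Lemma nc_cdot (w : 'rV[R[i]]_d) (y : 'rV[R]_d) :
  ComplexField.Normc.normc (cdot w y)
  <= (\sum_X ComplexField.Normc.normc (w 0 X)) * `|y|.
Proof.
rewrite /cdot mulr_suml; elim/big_ind2: _ => [|a b a' b' h1 h2|X _].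
- by rewrite (nc_real 0) normr0.
- by rewrite (le_trans (ncD _ _)) // lerD.
- by rewrite ncM nc_real ler_wpM2l ?nc_ge0 ?coord_le_norm.
Qed.

End Measurability.

Section ComplexIntegrals.
Local Open Scope complex_scope.
Variables (R : realType) (d : nat) (mu : {measure set (Rd R d) -> \bar R}).
Local Notation Re := (@complex.Re R).
Local Notation Im := (@complex.Im R).
Local Notation nc := (@ComplexField.Normc.normc R).
Implicit Types (f g : 'rV[R]_d -> R[i]) (p : 'rV[R]_d -> R).

Definition cintegrable f :=
  rintegrable mu (fun y : Rd R d => Re (f y)) /\ rintegrable mu (fun y : Rd R d => Im (f y)).

Lemma cintegrable_le f p : cmeasurable (f : Rd R d -> R[i]) -> (forall y, nc (f y) <= p y) ->
  rintegrable mu (p : Rd R d -> R) -> cintegrable f.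
Proof.
move=> [m1 m2] fp ip; split; apply: rintegrable_le ip => // y.
  exact: le_trans (nc_Re _) (fp y).
exact: le_trans (nc_Im _) (fp y).
Qed.

Lemma cintegralD f g : cintegrable f -> cintegrable g ->
  cintegral mu (fun y => f y + g y) = cintegral mu f + cintegral mu g.
Proof.
move=> [f1 f2] [g1 g2]; rewrite /cintegral.
rewrite -[RHS]/((_ + _) +i* (_ + _)); congr (_ +i* _).
  by under eq_Rintegral do rewrite complex_ReD; rewrite rintegralD.
by under eq_Rintegral do rewrite complex_ImD; rewrite rintegralD.
Qed.

Lemma cintegrableD f g : cintegrable f -> cintegrable g -> cintegrable (fun y => f y + g y).
Proof.
move=> [f1 f2] [g1 g2]; split.
  by have := rintegrableD f1 g1; under [X in _ -> rintegrable _ X]eq_fun do rewrite complex_ReD.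
by have := rintegrableD f2 g2; under [X in _ -> rintegrable _ X]eq_fun do rewrite complex_ImD.
Qed.

Lemma cintegrableZ u f : cintegrable f -> cintegrable (fun y => u * f y).
Proof.
move=> [f1 f2]; split.
  have := rintegrableB (rintegrableZ (Re u) f1) (rintegrableZ (Im u) f2).
  by under [X in _ -> rintegrable _ X]eq_fun do rewrite complex_ReM.
have := rintegrableD (rintegrableZ (Re u) f2) (rintegrableZ (Im u) f1).
by under [X in _ -> rintegrable _ X]eq_fun do rewrite complex_ImM.
Qed.

Lemma cintegralZ u f : cintegrable f ->
  cintegral mu (fun y => u * f y) = u * cintegral mu f.
Proof.
move=> [f1 f2]; rewrite /cintegral; apply/eqP; rewrite eq_complex complex_ReM complex_ImM /=.
apply/andP; split; apply/eqP.
  under eq_Rintegral do rewrite complex_ReM.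
  by rewrite rintegralB ?rintegralZ //; exact: rintegrableZ.
under eq_Rintegral do rewrite complex_ImM.
by rewrite rintegralD ?rintegralZ //; exact: rintegrableZ.
Qed.

Lemma cintegralB f g : cintegrable f -> cintegrable g ->
  cintegral mu (fun y => f y - g y) = cintegral mu f - cintegral mu g.
Proof.
move=> hf hg; have := cintegralD hf (cintegrableZ (-1) hg).
rewrite cintegralZ // mulN1r => <-; congr cintegral.
by apply/funext => y; rewrite mulN1r.
Qed.

Lemma cintegrableB f g : cintegrable f -> cintegrable g -> cintegrable (fun y => f y - g y).
Proof.
move=> hf hg; have := cintegrableD hf (cintegrableZ (-1) hg).
by under [X in cintegrable X]eq_fun do rewrite mulN1r.
Qed.

Lemma nc_cintegral_le f p : cintegrable f -> (forall y, nc (f y) <= p y) ->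
  rintegrable mu (p : Rd R d -> R) ->
  nc (cintegral mu f) <= 2 * \int[mu]_y p y.
Proof.
move=> [f1 f2] fp ip; apply: le_trans (nc_le _) _.
rewrite mulrDl !mul1r; apply: lerD; apply: rintegral_norm_le => // y.
  exact: le_trans (nc_Re _) (fp y).
exact: le_trans (nc_Im _) (fp y).
Qed.

Lemma eq_cintegral f g : f =1 g -> cintegral mu f = cintegral mu g.
Proof. by move=> /funext ->. Qed.

End ComplexIntegrals.

(** * Exponential moments from an entire Fourier transform *)

Section SeqLimits.
Variable R : realType.

Definition inv_seq (n : nat) : R := n.+1%:R^-1.

Lemma inv_seq_gt0 n : 0 < inv_seq n.
Proof. by rewrite invr_gt0 ltr0n. Qed.

Lemma inv_seq_le1 n : inv_seq n <= 1.
Proof. by rewrite invf_le1 ?ltr0n // ler1n. Qed.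

Lemma cvg_inv_seq : inv_seq n @[n --> \oo] --> (0 : R).
Proof. exact: cvg_harmonic. Qed.

Lemma cvg_of_bound (x : nat -> R) (l C : R) :
  (forall n, `|x n - l| <= C * inv_seq n) -> x n @[n --> \oo] --> l.
Proof.
move=> h; have hC : C * inv_seq n @[n --> \oo] --> (0 : R).
  by rewrite -(mulr0 C); apply: cvgMr; exact: cvg_inv_seq.
have h0 : (x n - l) @[n --> \oo] --> (0 : R).
  apply: (@squeeze_cvgr _ _ _ _ (fun n => - (C * inv_seq n)) (fun n => C * inv_seq n)).
  - by near=> n; rewrite -ler_norml.
  - by rewrite -oppr0; apply: cvgN.
  - exact: hC.
have e : x = (fun n => (x n - l) + l) by apply/funext => n; rewrite subrK.
rewrite e -[X in _ --> X]add0r; apply: cvgD => //; exact: cvg_cst.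
Unshelve. all: by end_near.
Qed.

End SeqLimits.

Section CosineMoments.
Context {dsp : measure_display} {T : measurableType dsp} {R : realType}.
Variables (mu : {finite_measure set T -> \bar R}) (X : T -> R) (u : nat -> R).
Hypothesis mX : measurable_fun setT X.
Hypothesis u_odd : forall k, odd k -> u k = 0.
Hypothesis u_bound : forall s, 0 <= s ->
  exists C, forall n, \sum_(k < n) `|u k| * s ^+ k <= C.
Hypothesis u_cos : forall s,
  \sum_(k < n) u k * s ^+ k @[n --> \oo] --> \int[mu]_x cos (s * X x).

Let U s := \int[mu]_x cos (s * X x).
Let a k := (-1) ^+ k * u (2 * k)%N.

(** The sums converge absolutely at [s = 1], which bounds the tails at smaller
    [s] by a power of [s]. *)
Lemma cos_transform_tail : exists2 C, 0 <= C & forall n s, 0 <= s <= 1 ->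
  `|U s - \sum_(k < n) u k * s ^+ k| <= C * s ^+ n.
Proof.
have [C hC] := u_bound ler01.
exists C; first by have := hC 0%N; rewrite big_ord0.
move=> n s /andP[s0 s1].
have cv : `|\sum_(k < N) u k * s ^+ k - \sum_(k < n) u k * s ^+ k| @[N --> \oo]
          --> `|U s - \sum_(k < n) u k * s ^+ k|.
  by apply: cvg_norm; apply: cvgB; [exact: u_cos|exact: cvg_cst].
apply: (cvgr_to_le cv); near=> N.
have nN : (n <= N)%N by near: N; exact: nbhs_infty_ge.
rewrite -(subnKC nN) big_split_ord /= [X in `|X|]addrAC subrr add0r.
apply: le_trans (ler_norm_sum _ _ _) _.
have hC' : (\sum_(k < (N - n)%N) `|u (n + k)%N|) * s ^+ n <= C * s ^+ n.
  rewrite ler_wpM2r ?exprn_ge0 //; apply: le_trans (hC N).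
  rewrite -[in leRHS](subnKC nN) big_split_ord /=.
  under [X in _ <= _ + X]eq_bigr do rewrite expr1n mulr1.
  by rewrite lerDr sumr_ge0 // => i _; rewrite expr1n mulr1.
apply: le_trans hC'; rewrite mulr_suml; apply: ler_sum => k _.
rewrite normrM ler_wpM2l // ger0_norm ?exprn_ge0 //.
by rewrite exprD ler_piMr ?exprn_ge0 // exprn_ile1.
Unshelve. all: by end_near.
Qed.

Definition cos_transform_rem k s : R :=
  (-1) ^+ k * (U s - \sum_(j < 2 * k) u j * s ^+ j).

Lemma cos_transform_remS k s :
  cos_transform_rem k.+1 s = a k * s ^+ (2 * k) - cos_transform_rem k s.
Proof.
have uo : u (2 * k).+1 = 0 by apply: u_odd; rewrite /= mul2n odd_double.
rewrite /cos_transform_rem mulnS !big_ord_recr /= uo.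
by rewrite /a exprS; ring.
Qed.

Lemma rintegrable_bounded (f : T -> R) C : measurable_fun setT f ->
  (forall x, `|f x| <= C) -> rintegrable mu f.
Proof.
move=> mf fC; apply: (rintegrable_le mf fC).
exact: finite_measure_integrable_cst.
Qed.

Lemma measurable_cos_rem k : measurable_fun setT (@cos_rem R k).
Proof.
elim: k => [|k IHk]; first by apply: continuous_measurable_fun; exact: continuous_cos.
apply: measurable_funB => //; exact: measurable_funM.
Qed.

(** Divide by [s^(2k)] and let [s] tend to 0. The integrand
    [cos_rem k (s X) / s^(2k)] is nonnegative, at most [X^(2k) / (2k)!], and tends
    to this bound; Fatou's lemma gives one inequality between the moment and the
    coefficient of the power series, monotonicity the other. *)
Lemma cos_moment_step k :
  (forall s, rintegrable mu (fun x => cos_rem k (s * X x))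
             /\ \int[mu]_x cos_rem k (s * X x) = cos_transform_rem k s) ->
  rintegrable mu (fun x => X x ^+ (2 * k)) /\
  \int[mu]_x (X x ^+ (2 * k) / (2 * k)`!%:R) = a k.
Proof.
have [C C0 hC] := cos_transform_tail.
case: k => [|k] hk.
  split; first by under eq_fun do rewrite muln0 expr0; exact: finite_measure_integrable_cst.
  have := hC 1%N 0; rewrite lexx ler01 => /(_ isT).
  rewrite expr1 mulr0 big_ord1 expr0 mulr1 normr_le0 subr_eq0 => /eqP U0.
  rewrite /a expr0 mul1r muln0 -U0.
  by apply: eq_Rintegral => x _; rewrite expr0 divr1 mul0r cos0.
pose f x := X x ^+ (2 * k.+1) / (2 * k.+1)`!%:R.
pose q (n : nat) := inv_seq R n ^+ (2 * k.+1).
have q0 n : 0 < q n by rewrite exprn_gt0 // inv_seq_gt0.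
pose fn n x := (q n)^-1 * cos_rem k.+1 (inv_seq R n * X x).
have mf : measurable_fun setT f.
  by apply: measurable_funM => //; exact: measurable_funX.
have fn_le n x : fn n x <= f x.
  rewrite /fn mulrC ler_pdivrMr // (le_trans (cos_rem_le _ _)) //.
  by rewrite exprMn -mulrA mulrC lexx.
have fn_ge n x : f x - (inv_seq R n) ^+ 2 * (X x ^+ (2 * k.+2) / (2 * k.+2)`!%:R) <= fn n x.
  rewrite /fn [leRHS]mulrC ler_pdivlMr // (le_trans _ (cos_rem_ge _ _)) //.
  have es : inv_seq R n ^+ (2 * k.+2) = inv_seq R n ^+ 2 * inv_seq R n ^+ (2 * k.+1).
    by rewrite -exprD -mulnS.
  rewrite !exprMn es /f /q le_eqVlt; apply/orP; left; apply/eqP.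
  move: (_ ^+ (2 * k.+2)) (_ ^+ (2 * k.+1)) (_ ^+ (2 * k.+1)) => A B D.
  by ring.
have ifn n : rintegrable mu (fn n) by apply: rintegrableZ; exact: (hk _).1.
have intfn n : \int[mu]_x fn n x = (q n)^-1 * cos_transform_rem k.+1 (inv_seq R n).
  by rewrite /fn rintegralZ ?(hk _).2 //; exact: (hk _).1.
have Cn : (q n)^-1 * cos_transform_rem k.+1 (inv_seq R n) @[n --> \oo] --> a k.+1.
  apply: (@cvg_of_bound _ _ _ C) => n.
  set s := inv_seq R n.
  have s01 : 0 <= s <= 1 by rewrite ltW ?inv_seq_gt0 // inv_seq_le1.
  have := hC (2 * k.+1).+1 s s01; rewrite big_ord_recr /=.
  set W := \sum_(i < _) _ => h.
  have -> : (q n)^-1 * cos_transform_rem k.+1 s - a k.+1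
    = (-1) ^+ k.+1 * ((q n)^-1 * (U s - (W + u (2 * k.+1) * s ^+ (2 * k.+1)))).
    rewrite /cos_transform_rem /a -/W opprD addrA !mulrBr -/(q n).
    have e : (q n)^-1 * (u (2 * k.+1) * q n) = u (2 * k.+1).
      by rewrite mulrCA mulVf ?mulr1 // gt_eqF.
    rewrite e; ring.
  rewrite normrM normrX normrN1 expr1n mul1r normrM gtr0_norm ?invr_gt0 //.
  by rewrite mulrC ler_pdivrMr // (le_trans h) // exprSr mulrA mulrAC.
have fnf x : fn n x @[n --> \oo] --> f x.
  apply: (@cvg_of_bound _ _ _ `|X x ^+ (2 * k.+2) / (2 * k.+2)`!%:R|) => n.
  rewrite ler0_norm ?subr_le0 // opprB.
  have := fn_ge n x.
  set K := X x ^+ _ / _ => h.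
  have h2 : inv_seq R n ^+ 2 * K <= `|K| * inv_seq R n.
    have s0 := inv_seq_gt0 R n; have s1 := inv_seq_le1 R n.
    apply: (@le_trans _ _ (inv_seq R n ^+ 2 * `|K|)).
      by rewrite ler_wpM2l ?sqr_ge0 // ler_norm.
    by rewrite mulrC ler_wpM2l // expr2 ler_piMr // ltW.
  lra.
have [rf fa] : rintegrable mu f /\ \int[mu]_x f x <= a k.+1.
  apply: (rintegrable_fatou (fn := fn)) Cn => //.
    by move=> n x; rewrite mulr_ge0 ?cos_rem_ge0 // invr_ge0 ltW.
  by move=> n; rewrite intfn.
split.
  have := rintegrableZ (2 * k.+1)`!%:R rf.
  have nf : (2 * k.+1)`!%:R != 0 :> R by rewrite pnatr_eq0 -lt0n fact_gt0.
  by under eq_fun do rewrite /f mulrC divfK //.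
apply/eqP; rewrite eq_le fa /=.
apply: (cvgr_to_le Cn); near=> n.
by rewrite -intfn; apply: rintegral_le.
Unshelve. all: by end_near.
Qed.

(** Knowing the moment of order [2k], the remainder of order [k.+1] is obtained
    from that of order [k] on both sides. *)
Lemma cos_moments k :
  rintegrable mu (fun x => X x ^+ (2 * k)) /\
  \int[mu]_x (X x ^+ (2 * k) / (2 * k)`!%:R) = a k.
Proof.
apply: cos_moment_step; elim: k => [|k IHk] s.
  split; last by rewrite /cos_transform_rem muln0 big_ord0 subr0 expr0 mul1r.
  apply: (@rintegrable_bounded _ 1) => [|x].
    apply: measurableT_comp; first exact: (measurable_cos_rem 0).
    exact: measurable_funM.
  by rewrite ler_norml cos_geN1 cos_le1.
have [ik mk] := cos_moment_step IHk; have [ic ec] := IHk s.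
have ik' : rintegrable mu (fun x => s ^+ (2 * k) * (X x ^+ (2 * k) / (2 * k)`!%:R)).
  apply: rintegrableZ; have := rintegrableZ (2 * k)`!%:R^-1 ik.
  by under eq_fun do rewrite mulrC.
have e x : cos_rem k.+1 (s * X x)
  = s ^+ (2 * k) * (X x ^+ (2 * k) / (2 * k)`!%:R) - cos_rem k (s * X x).
  by rewrite /= exprMn mulrA.
split.
  by under eq_fun do rewrite e; exact: rintegrableB.
under eq_Rintegral do rewrite e.
rewrite rintegralB // rintegralZ; last first.
  have := rintegrableZ (2 * k)`!%:R^-1 ik.
  by under eq_fun do rewrite mulrC.
by rewrite mk ec cos_transform_remS mulrC.
Qed.

(** [E cosh (l X)] is the sum of the even moments with the weights
    [l^(2k) / (2k)!], hence bounded by the absolutely convergent power series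
    at [l]. *)
Lemma rintegrable_exp_abs l : 0 <= l -> rintegrable mu (fun x => expR (l * `|X x|)).
Proof.
move=> l0; have [C hC] := u_bound l0.
pose term j x := (l * X x) ^+ j / j`!%:R + (- (l * X x)) ^+ j / j`!%:R.
have term_odd j x : odd j -> term j x = 0.
  by move=> oj; rewrite /term exprNn -signr_odd oj expr1 mulN1r mulNr subrr.
have term_even k x : term (2 * k)%N x
    = (2 * l ^+ (2 * k)) * (X x ^+ (2 * k) / (2 * k)`!%:R).
  by rewrite /term !exprM sqrrN -!exprM exprMn; ring.
have iterm j : rintegrable mu (term j) /\ \int[mu]_x term j x <= 2 * (`|u j| * l ^+ j).
  case oj : (odd j).
    have -> : term j = (fun=> 0) by apply/funext => x; exact: term_odd.
    split; first exact: finite_measure_integrable_cst.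
    rewrite Rintegral_cst // mul0r.
    by rewrite mulr_ge0 // mulr_ge0 // exprn_ge0.
  have -> : j = (2 * j./2)%N by rewrite mul2n; have := odd_double_half j; rewrite oj.
  set k := j./2; have [ik mk] := cos_moments k.
  have ik' : rintegrable mu (fun x => X x ^+ (2 * k) / (2 * k)`!%:R).
    have := rintegrableZ (2 * k)`!%:R^-1 ik.
    by under eq_fun do rewrite mulrC.
  rewrite (funext (term_even k)); split; first exact: rintegrableZ.
  rewrite rintegralZ // mk -mulrA ler_wpM2l // mulrC.
  rewrite ler_wpM2r ?exprn_ge0 // (le_trans (ler_norm _)) //.
  by rewrite normrM normrX normrN1 expr1n mul1r.
have [] := @rintegrable_fatou _ T R mu (fun n x => \sum_(j < n) term j x)
   (fun x => expR (l * X x) + expR (- (l * X x))) (fun=> 2 * C) (2 * C).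
- by move=> n; apply: rintegrable_sum => j; exact: (iterm j).1.
- have mlX : measurable_fun setT (fun x => l * X x) by exact: measurable_funM.
  apply: measurable_funD; apply: measurableT_comp => //.
  exact: measurable_funN.
- move=> n x; apply: sumr_ge0 => j _; case oj : (odd j); first by rewrite term_odd.
  have -> : val j = (2 * j./2)%N by rewrite mul2n; have := odd_double_half j; rewrite oj.
  rewrite term_even; apply: mulr_ge0; first by rewrite mulr_ge0 // exprn_ge0.
  by rewrite divr_ge0 // exprM exprn_ge0 // sqr_ge0.
- move=> x; have cvE (y : R) : \sum_(j < n) (y ^+ j / j`!%:R) @[n --> \oo] --> expR y.
    have := is_cvg_series_exp_coeff y; rewrite /expR => h.
    rewrite (_ : (fun n => _) = series (exp_coeff y)) //.
    by apply/funext => n; rewrite /series /= big_mkord.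
  have -> : (fun n => \sum_(j < n) term j x)
    = (fun n => \sum_(j < n) ((l * X x) ^+ j / j`!%:R)
                + \sum_(j < n) ((- (l * X x)) ^+ j / j`!%:R)).
    by apply/funext => n; rewrite big_split.
  by apply: cvgD; exact: cvE.
- move=> n; rewrite rintegral_sum; last by move=> j; exact: (iterm j).1.
  apply: (@le_trans _ _ (\sum_(j < n) 2 * (`|u j| * l ^+ j))).
    by apply: ler_sum => j _; exact: (iterm j).2.
  by rewrite -mulr_sumr ler_wpM2l.
- exact: cvg_cst.
move=> ie _; apply: rintegrable_le ie.
  have ma : measurable_fun setT (fun x => l * `|X x|).
    by apply: measurable_funM => //; exact: measurableT_comp.
  exact: measurableT_comp.
move=> x; rewrite ger0_norm ?expR_ge0 //.
case: (ger0P (X x)) => _; first by rewrite lerDl expR_ge0.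
by rewrite mulrN lerDr expR_ge0.
Qed.

End CosineMoments.

Section EntireAxis.
Local Open Scope complex_scope.
Variables (R : realType) (d : nat).
Local Notation Re := (@complex.Re R).
Local Notation nc := (@ComplexField.Normc.normc R).

Lemma sum_axis (V : zmodType) (n : nat) (X : 'I_d) (f : ('I_d -> nat) -> V) :
  (forall al, (exists2 Y, Y != X & al Y != 0%N) -> f al = 0) ->
  \sum_(al : {ffun 'I_d -> 'I_n}) f (fun Y => al Y : nat)
  = \sum_(k < n) f (fun Y => if Y == X then k : nat else 0%N).
Proof.
move=> f0; case: n => [|n].
  rewrite big_ord0; apply: big1 => al _; by case: (al X).
rewrite (bigID (fun al : {ffun 'I_d -> 'I_n.+1} =>
  [forall Y, (Y != X) ==> (al Y == ord0)])) /=.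
rewrite [X in _ + X]big1 ?addr0; last first.
  move=> al /forallPn[Y]; rewrite negb_imply => /andP[nY aY].
  by apply: f0; exists Y.
rewrite (reindex_onto (fun k : 'I_n.+1 => [ffun Y => if Y == X then k else ord0])
   (fun al : {ffun 'I_d -> 'I_n.+1} => al X)) /=.
  apply: eq_big => [k|k _].
    rewrite ffunE eqxx eqxx andbT; apply/forallP => Y; apply/implyP => nY.
    by rewrite ffunE (negPf nY).
  by congr f; apply/funext => Y; rewrite ffunE; case: (Y == X).
move=> al /forallP h; apply/ffunP => Y; rewrite ffunE.
by case: eqP => [->//|/eqP nY]; have := h Y; rewrite nY => /eqP ->.
Qed.

(** On a coordinate axis only the multi-indices supported by that coordinate
    contribute, so that no rearrangement of the multiple series is needed. *)
Lemma entire_axis (F : 'rV[R[i]]_d -> R[i]) (X : 'I_d) : entire F ->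
  exists g : nat -> R[i], forall s : R,
    (exists C, forall n, \sum_(k < n) nc (g k) * `|s| ^+ k <= C) /\
    Re (\sum_(k < n) g k * s%:C ^+ k) @[n --> \oo] --> Re (F (s%:C *: delta_mx 0 X)).
Proof.
case=> c hc; exists (fun k => c (fun Y => if Y == X then k else 0%N)) => s.
have [] := hc (s%:C *: delta_mx 0 X).
set w := _ *: _; pose f (al : 'I_d -> nat) := c al * \prod_(Y < d) w 0 Y ^+ al Y.
have f0 al : (exists2 Y, Y != X & al Y != 0%N) -> f al = 0.
  case=> Y nY aY; rewrite /f (bigD1 Y) //= /w !mxE eqxx (negPf nY) mulr0.
  by rewrite expr0n (negPf aY) mul0r mulr0.
have fX k : f (fun Y => if Y == X then k else 0%N)
          = c (fun Y => if Y == X then k else 0%N) * s%:C ^+ k.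
  rewrite /f (bigD1 X) //= eqxx /w !mxE !eqxx mulr1 big1 ?mulr1 // => Y nY.
  by rewrite (negPf nY) expr0.
have e1 : (fun n => \sum_(al : {ffun 'I_d -> 'I_n}) nc (f (fun Y => al Y : nat)))
   = (fun n => \sum_(k < n) nc (c (fun Y => if Y == X then k : nat else 0%N)) * `|s| ^+ k).
  apply/funext => n; rewrite (@sum_axis _ n X (fun al => nc (f al))).
    apply: eq_bigr => k _; rewrite fX ncM; congr (_ * _).
    by rewrite -rmorphXn nc_real normrX.
  by move=> al h; rewrite f0 // (nc_real 0) normr0.
have e2 : (fun n => \sum_(al : {ffun 'I_d -> 'I_n}) f (fun Y => al Y : nat))
   = (fun n => \sum_(k < n) c (fun Y => if Y == X then k : nat else 0%N) * s%:C ^+ k).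
  by apply/funext => n; rewrite (sum_axis n f0); apply: eq_bigr => k _; exact: fX.
rewrite /= -/(f _) e1 => cv1 cv2; split.
  pose S n := \sum_(k < n) nc (c (fun Y => if Y == X then k : nat else 0%N))
     * `|s| ^+ k.
  exists (limn S) => n; apply: (@nondecreasing_cvgn_le _ S) => //.
  apply/nondecreasing_seqP => k; rewrite /S big_ord_recr /= lerDl.
  by rewrite mulr_ge0 ?nc_ge0 // exprn_ge0.
move: cv2; rewrite /= e2 => cv2.
apply/cvgrPdist_lt => e e0.
have ec : 0 < e%:C by rewrite ltcR.
have /cvgrPdist_lt/(_ _ ec) := cv2.
apply: filterS => n; rewrite normc_def ltcR => h.
rewrite -complex_ReN -complex_ReD; apply: le_lt_trans (nc_Re _) _.
by have -> // : forall z, nc z = Num.sqrt (Re z ^+ 2 + complex.Im z ^+ 2); case.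
Qed.

End EntireAxis.

Section ExponentialMoments.
Local Open Scope complex_scope.
Variables (R : realType) (d : nat).
Variable r : probability (Rd R d) R.
Hypothesis hr : entire_analytic (fourier r).
Local Notation Re := (@complex.Re R).
Local Notation nc := (@ComplexField.Normc.normc R).

Lemma cdot_axis (s : R) X (y : 'rV[R]_d) :
  cdot (toC (s *: delta_mx 0 X)) y = (s * y 0 X)%:C.
Proof.
have -> : toC (s *: delta_mx 0 X) = 0 + s%:C *: delta_mx 0 X :> 'rV[R[i]]_d.
  apply/rowP => Y; rewrite !mxE add0r rmorphM /=; congr (_ * _).
  exact: rmorph_nat.
rewrite cdot_delta /cdot big1 ?add0r ?rmorphM // => Y _.
by rewrite !mxE mul0r.
Qed.

Lemma Re_fourier_axis s X :
  Re (fourier r (s *: delta_mx 0 X)) = \int[r]_y cos (s * (y : 'rV[R]_d) 0 X).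
Proof.
rewrite /fourier /cintegral /=; apply: eq_Rintegral => y _.
rewrite cdot_axis /=; rewrite !(mul0r, mul1r, mulr0, subr0, sub0r, addr0, add0r).
by rewrite ?oppr0 expR0 mul1r.
Qed.

(** The real part of the Fourier transform is even on the axis; averaging its
    expansions at [s] and [- s] removes the odd coefficients. *)
Lemma coord_exp_integrable X l : 0 <= l ->
  rintegrable r (fun y : Rd R d => expR (l * `|(y : 'rV[R]_d) 0 X|)).
Proof.
case: hr => F [eF Ff] l0; have [g hg] := entire_axis X eF.
pose u k := if odd k then 0 else Re (g k).
apply: (@rintegrable_exp_abs _ _ _ r (fun y : Rd R d => (y : 'rV[R]_d) 0 X) u) => //.
- exact: measurable_coord.
- by move=> k ok; rewrite /u ok.
- move=> s s0; have [[C hC] _] := hg s; exists C => n; apply: le_trans (hC n).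
  apply: ler_sum => k _; rewrite (ger0_norm s0) ler_wpM2r ?exprn_ge0 //.
  by rewrite /u; case: ifP => _; rewrite ?normr0 ?nc_ge0 ?nc_Re.
move=> s.
have toCs t : t%:C *: delta_mx 0 X = toC (t *: delta_mx 0 X) :> 'rV[R[i]]_d.
  by apply/rowP => Y; rewrite !mxE rmorphM /=; congr (_ * _); exact/esym/rmorph_nat.
have cvs := (hg s).2; have cvNs := (hg (- s)).2.
rewrite toCs Ff Re_fourier_axis in cvs; rewrite toCs Ff Re_fourier_axis in cvNs.
have Reg n (t : R) : Re (\sum_(k < n) g k * t%:C ^+ k) = \sum_(k < n) Re (g k) * t ^+ k.
  elim/big_ind2: _ => [//|a b a' b' <- <-|k _]; first exact: complex_ReD.
  by rewrite -rmorphXn complex_ReM /= mulr0 subr0.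
have -> : (fun n => \sum_(k < n) u k * s ^+ k)
  = (fun n => 2^-1 * (Re (\sum_(k < n) g k * s%:C ^+ k)
                      + Re (\sum_(k < n) g k * (- s)%:C ^+ k))).
  apply/funext => n; rewrite !Reg -big_split mulr_sumr; apply: eq_bigr => k _ /=.
  rewrite /u exprNn -signr_odd; case: (odd k); rewrite ?expr1 ?expr0.
    by rewrite mul0r mulN1r mulrN subrr mulr0.
  by rewrite mul1r; field.
have -> : \int[r]_y cos (s * (y : 'rV[R]_d) 0 X)
  = 2^-1 * (\int[r]_y cos (s * (y : 'rV[R]_d) 0 X)
            + \int[r]_y cos (- s * (y : 'rV[R]_d) 0 X)).
  under [X in _ + X]eq_Rintegral do rewrite mulNr cosN.
  by field.
by apply: cvgMr; apply: cvgD.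
Qed.

(** The sup norm is attained at some coordinate. *)
Lemma norm_exp_integrable l : 0 <= l ->
  rintegrable r (fun y : Rd R d => expR (l * `|y : 'rV[R]_d|)).
Proof.
move=> l0.
have ib : rintegrable r (fun y : Rd R d => 1 + \sum_X expR (l * `|(y : 'rV[R]_d) 0 X|)).
  apply: rintegrableD; first exact: finite_measure_integrable_cst.
  by apply: rintegrable_sum => X; exact: coord_exp_integrable.
apply: rintegrable_le ib.
  apply: measurableT_comp => //; apply: measurable_funM => //.
  by apply: measurable_continuous_Rd; exact: norm_continuous.
move=> y; rewrite ger0_norm ?expR_ge0 //.
have -> : `|y : 'rV[R]_d| = mx_norm (y : 'rV[R]_d) by [].
have [->|/mx_norm_neq0[[i X] /= ->]] := eqVneq (mx_norm (y : 'rV[R]_d)) 0.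
  by rewrite mulr0 expR0 lerDl sumr_ge0 // => X _; exact: expR_ge0.
rewrite ord1 (bigD1 X) //= addrCA lerDl addr_ge0 //.
by apply: sumr_ge0 => Y _; exact: expR_ge0.
Qed.

End ExponentialMoments.

(** * Derivatives of the symbol of the jump part *)

Section LaplaceDerivatives.
Local Open Scope complex_scope.
Variables (R : realType) (d : nat).
Variable r : probability (Rd R d) R.
Hypothesis hexp : forall l, 0 <= l ->
  rintegrable r (fun y : Rd R d => expR (l * `|y : 'rV[R]_d|)).
Local Notation Re := (@complex.Re R).
Local Notation Im := (@complex.Im R).
Local Notation nc := (@ComplexField.Normc.normc R).
Implicit Types (Xs : seq 'I_d) (w : 'rV[R[i]]_d) (y : 'rV[R]_d).

(** The derivative of order [Xs] of the Laplace transform of [r] at the complex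
    point [w]. *)
Definition laplace Xs w : R[i] :=
  cintegral r (fun y => (monomial Xs y)%:C * cexp (cdot w y)).

Lemma pow_le_exp n (x : R) : 0 <= x -> x ^+ n <= expR (n%:R * x).
Proof.
move=> x0; rewrite expRM_natl lerXn2r ?nnegrE ?expR_ge0 //.
by have := expR_ge1Dx x; lra.
Qed.

Definition row_norm1 w : R := \sum_X nc (w 0 X).

Lemma row_norm1_ge0 w : 0 <= row_norm1 w.
Proof. by apply: sumr_ge0 => X _; exact: nc_ge0. Qed.

Lemma nc_monomial_cexp Xs w y : nc ((monomial Xs y)%:C * cexp (cdot w y))
  <= expR (((size Xs)%:R + row_norm1 w) * `|y|).
Proof.
rewrite ncM nc_real nc_cexp mulrDl expRD ler_pM ?expR_ge0 //.
  by apply: le_trans (monomial_le_norm _ _) _; exact: pow_le_exp.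
by rewrite ler_expR (le_trans (ler_norm _)) // (le_trans (nc_Re _)) // nc_cdot.
Qed.

Lemma cintegrable_monomial_cexp Xs w :
  cintegrable r (fun y => (monomial Xs y)%:C * cexp (cdot w y)).
Proof.
apply: (cintegrable_le (p := fun y => expR (((size Xs)%:R + row_norm1 w) * `|y|))).
- by apply: (@cmeasurable_monomial_cexp R d (fun y => y)); exact: vmeasurable_id.
- exact: nc_monomial_cexp.
- by apply: hexp; rewrite addr_ge0 ?row_norm1_ge0.
Qed.

(** Differentiation under the integral sign, in the direction of any complex
    multiple of a basis vector: with [c = 1] it yields the real derivatives that
    define the coefficients, with [c = 'i] those of the characteristic
    function. *)
Lemma first_order_laplace Xs w X (c : R[i]) :
  first_order (fun h => laplace Xs (w + (h%:C * c) *: delta_mx 0 X))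
              (c * laplace (X :: Xs) w).
Proof.
(* The four exponents dominate the monomial, the exponential at w, and the two
   factors of the Taylor remainder in the direction c. *)
pose l := (size Xs)%:R + row_norm1 w + 2 + nc c.
have l0 : 0 <= l by rewrite !addr_ge0 ?row_norm1_ge0 ?nc_ge0.
have il := hexp l0.
exists (2 * (5 * nc c ^+ 2 * \int[r]_y expR (l * `|y : 'rV[R]_d|))) => h h1.
have ix v := cintegrable_monomial_cexp Xs v.
rewrite /laplace mul0r scale0r addr0 mulrA.
rewrite -cintegralB // -cintegralZ; last exact: cintegrable_monomial_cexp.
rewrite -cintegralB //; last 2 first.
- exact: cintegrableB.
- exact/cintegrableZ/cintegrable_monomial_cexp.
set f := (X in cintegral _ X).
have fE y : f y = ((monomial Xs y)%:C * cexp (cdot w y)) *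
   (cexp (h%:C * c * (y 0 X)%:C) - 1 - h%:C * c * (y 0 X)%:C).
  by rewrite /f cdot_delta cexpD monomial_cons rmorphM /=; ring.
have fb y : nc (f y) <= h ^+ 2 * (5 * nc c ^+ 2) * expR (l * `|y|).
  rewrite fE ncM.
  set v := h%:C * c * _.
  have vb : nc v <= `|h| * (nc c * `|y|).
    rewrite /v !ncM !nc_real -mulrA ler_wpM2l // ler_wpM2l ?nc_ge0 //.
    exact: coord_le_norm.
  have v2 : nc v ^+ 2 <= h ^+ 2 * nc c ^+ 2 * expR (2 * `|y|).
    apply: (@le_trans _ _ ((`|h| * (nc c * `|y|)) ^+ 2)).
      by rewrite lerXn2r ?nnegrE ?nc_ge0 // !mulr_ge0 ?nc_ge0.
    rewrite !exprMn real_normK ?num_real // -mulrA ler_wpM2l ?sqr_ge0 //.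
    by rewrite ler_wpM2l ?sqr_ge0 //; exact: (pow_le_exp 2).
  have ev : expR (nc v) <= expR (nc c * `|y|).
    by rewrite ler_expR (le_trans vb) // ler_piMl // mulr_ge0 ?nc_ge0.
  have hm := nc_monomial_cexp Xs w y; have ht := cexp_taylor1 v.
  have -> : expR (l * `|y|) = expR (((size Xs)%:R + row_norm1 w) * `|y|)
      * expR (2 * `|y|) * expR (nc c * `|y|) by rewrite -!expRD -!mulrDl.
  apply: (@le_trans _ _ (expR (((size Xs)%:R + row_norm1 w) * `|y|) *
     (5 * (h ^+ 2 * nc c ^+ 2 * expR (2 * `|y|)) * expR (nc c * `|y|)))).
    rewrite ler_pM ?nc_ge0 // (le_trans ht) // ler_pM ?expR_ge0 //.
      by rewrite mulr_ge0 // sqr_ge0.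
    by rewrite ler_wpM2l.
  by rewrite le_eqVlt; apply/orP; left; apply/eqP; ring.
have fi : cintegrable r f.
  by apply: cintegrableB; [exact: cintegrableB|exact/cintegrableZ/cintegrable_monomial_cexp].
apply: le_trans (nc_cintegral_le fi fb _) _; first exact: rintegrableZ.
by rewrite rintegralZ // le_eqVlt; apply/orP; left; apply/eqP; ring.
Qed.

(** The derivative of order [Xs] of [cdot w v] with respect to [w]. *)
Definition linear_deriv (v : 'rV[R]_d) Xs w : R[i] :=
  match Xs with [::] => cdot w v | [:: X] => (v 0 X)%:C | _ => 0 end.

Lemma first_order_linear v Xs w X (c : R[i]) :
  first_order (fun h => linear_deriv v Xs (w + (h%:C * c) *: delta_mx 0 X))
              (c * linear_deriv v (X :: Xs) w).
Proof.
case: Xs => [|Y [|Y' Xs]] /=; last 2 first.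
- by rewrite mulr0; exact: first_order_cst.
- by rewrite mulr0; exact: first_order_cst.
apply: eq_first_order (first_order_affine (cdot w v) (c * (v 0 X)%:C)) => // h.
by rewrite cdot_delta mulrA.
Qed.

Variables (a : 'rV[R]_d) (z : R).

(** The derivative of order [Xs] of [Psi_jump]; the constant 1 under its integral
    matters only for [Xs = [::]]. *)
Definition psi_deriv Xs w : R[i] :=
  - linear_deriv a Xs w + z%:C * (laplace Xs w - (nilp Xs)%:R).

Lemma cintegral_cst (u : R[i]) : cintegrable r (fun=> u) /\ cintegral r (fun=> u) = u.
Proof.
split; first by split; exact: finite_measure_integrable_cst.
have r1 : r setT = 1%E by exact: probability_setT.
rewrite /cintegral !Rintegral_cst //.
by rewrite [X in fine X]r1 /= !mulr1; case: u.
Qed.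

Lemma psi_deriv0 w : psi_deriv [::] w = Psi_jump a z r w.
Proof.
rewrite /psi_deriv /Psi_jump /=; congr (_ + _ * _).
have [i1 e1] := cintegral_cst 1.
have i2 := cintegrable_monomial_cexp [::] w.
rewrite /laplace -{1}e1 -cintegralB //; apply: eq_cintegral => y.
by rewrite /monomial big_nil mul1r.
Qed.

Lemma first_order_psi Xs w X (c : R[i]) :
  first_order (fun h => psi_deriv Xs (w + (h%:C * c) *: delta_mx 0 X))
              (c * psi_deriv (X :: Xs) w).
Proof.
have := first_orderD (first_orderZ (-1) (first_order_linear a Xs w X c))
  (first_orderZ z%:C (first_orderD (first_order_laplace Xs w X c)
                                   (first_order_cst (- (nilp Xs)%:R)))).
apply: eq_first_order => [h|]; rewrite /psi_deriv ?mulN1r //=.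
by rewrite addr0 subr0; ring.
Qed.

(** The quadratic remainder shows that the limit defining the directional
    derivative exists. *)
Lemma partial_of_first_order (g : 'rV[R]_d -> R) X eta (f : R -> R[i]) (f1 : R[i]) :
  first_order f f1 -> (forall h, g (h *: delta_mx 0 X + eta) = Re (f h)) ->
  partial X g eta = Re f1.
Proof.
move=> [C hC] gf; apply: cvg_lim => //.
have ge : g eta = Re (f 0) by rewrite -gf scale0r add0r.
apply/cvgrPdist_le => e e0.
have D0 : 0 < Num.max C 1 by rewrite lt_max ltr01 orbT.
near=> h.
have hn0 : h != 0 by near: h; exact: nbhs_dnbhs_neq.
have h1 : `|h| <= 1 by near: h; exact: (@dnbhs0_le R R 1 ltr01).
have he : `|h| <= e / Num.max C 1.
  by near: h; exact: (@dnbhs0_le R R _ (divr_gt0 e0 D0)).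
rewrite /= gf ge /GRing.scale /=.
have -> : Re f1 - h^-1 * (Re (f h) - Re (f 0))
   = - (h^-1 * Re (f h - f 0 - h%:C * f1)).
  rewrite !complex_ReD !complex_ReN complex_ReM /= mul0r subr0; field; exact: hn0.
rewrite normrN normrM normfV ler_pdivrMl ?normr_gt0 //.
apply: le_trans (nc_Re _) _; apply: le_trans (hC h h1) _.
apply: (@le_trans _ _ (Num.max C 1 * h ^+ 2)).
  by rewrite ler_wpM2r ?sqr_ge0 // le_max lexx.
rewrite -real_normK ?num_real // expr2 mulrCA ler_wpM2l //.
by rewrite mulrC -ler_pdivlMr.
Unshelve. all: by end_near.
Qed.

Lemma toC_shift h X (eta : 'rV[R]_d) :
  toC (h *: delta_mx 0 X + eta) = toC eta + h%:C *: delta_mx 0 X.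
Proof.
apply/rowP => Y; rewrite !mxE rmorphD rmorphM /= addrC.
by congr (_ * _ + _); exact: rmorph_nat.
Qed.

(** The derivatives are taken at all real points, not only at 0, since
    [coefC] iterates partial derivatives. *)
Lemma coefC_psi_deriv Xs : Defs.coefC a z r Xs = Re (psi_deriv Xs 0).
Proof.
rewrite /Defs.coefC.
have -> : (0 : 'rV[R[i]]_d) = toC 0 by apply/rowP => Y; rewrite !mxE.
suff -> : foldr (@partial R d) (fun eta => Re (Psi_jump a z r (toC eta))) Xs
   = (fun eta => Re (psi_deriv Xs (toC eta))) by [].
elim: Xs => [|X Xs IHXs] /=; apply/funext => eta; first by rewrite psi_deriv0.
rewrite IHXs -[X in _ = Re X]mul1r.
apply: (partial_of_first_order (first_order_psi Xs (toC eta) X 1)) => h.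
by rewrite toC_shift mulr1.
Qed.

Lemma psi_deriv_real Xs : Im (psi_deriv Xs 0) = 0.
Proof.
have hl : Im (linear_deriv a Xs 0) = 0.
  case: Xs => [|X [|Y Xs]] //=; rewrite /cdot big1 // => X _.
  by rewrite mxE mul0r.
have hL : Im (laplace Xs 0) = 0.
  have e y : (monomial Xs y)%:C * cexp (cdot 0 y) = (monomial Xs y)%:C.
    rewrite (_ : cdot 0 y = 0) ?cexp0 ?mulr1 //.
    by rewrite /cdot big1 // => X _; rewrite mxE mul0r.
  by rewrite /laplace (eq_cintegral _ e) /cintegral /= Rintegral_cst // mul0r.
rewrite /psi_deriv complex_ImD complex_ImN hl complex_ImM complex_ImD hL complex_ImN /=.
by case: nilp; rewrite /= !(oppr0, mulr0, mul0r, addr0).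
Qed.

End LaplaceDerivatives.

(** * Derivatives of sums over partitions *)

Section Cumulants.
Local Open Scope complex_scope.
Variables (R : realType) (d : nat).
Variable r : probability (Rd R d) R.
Hypothesis hexp : forall l, 0 <= l ->
  rintegrable r (fun y : Rd R d => expR (l * `|y : 'rV[R]_d|)).
Local Notation Re := (@complex.Re R).
Local Notation Im := (@complex.Im R).
Local Notation nc := (@ComplexField.Normc.normc R).
Implicit Types (Xs : seq 'I_d) (w : 'rV[R[i]]_d).
Variables (a phi : 'rV[R]_d) (z t : R).

(** The derivative of order [Xs] of the exponent [<w, phi> + t Psi_jump w] of the
    characteristic function of [phi - y]. *)
Definition cumulant Xs w : R[i] :=
  linear_deriv phi Xs w + t%:C * psi_deriv r a z Xs w.

Lemma first_order_cumulant Xs w X (c : R[i]) :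
  first_order (fun h => cumulant Xs (w + (h%:C * c) *: delta_mx 0 X))
              (c * cumulant (X :: Xs) w).
Proof.
have := first_orderD (first_order_linear phi Xs w X c)
  (first_orderZ t%:C (first_order_psi hexp a z Xs w X c)).
by apply: eq_first_order => //; rewrite /cumulant; ring.
Qed.

Lemma linear_deriv_perm (v : 'rV[R]_d) Xs Ys w :
  perm_eq Xs Ys -> linear_deriv v Xs w = linear_deriv v Ys w.
Proof.
move=> p; have [s|s] := leqP (size Ys) 1; first by rewrite (perm_small_eq s p).
have s' : (1 < size Xs)%N by rewrite (perm_size p).
by case: Xs Ys s s' {p} => [|? [|? ?]] [|? [|? ?]].
Qed.

Lemma cumulant_perm Xs Ys w : perm_eq Xs Ys -> cumulant Xs w = cumulant Ys w.
Proof.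
move=> p; rewrite /cumulant /psi_deriv !(linear_deriv_perm _ _ p).
have -> : nilp Xs = nilp Ys by rewrite /nilp (perm_size p).
congr (_ + _ * (_ + _ * (_ - _))); apply: eq_cintegral => y.
by rewrite (monomial_perm _ p).
Qed.

Lemma cumulant_real Xs : cumulant Xs 0 = (Re (cumulant Xs 0))%:C.
Proof.
have h : Im (cumulant Xs 0) = 0.
  rewrite /cumulant complex_ImD complex_ImM psi_deriv_real /=.
  rewrite mulr0 mul0r !addr0; case: Xs => [|X [|Y Xs]] //=.
  by rewrite /cdot big1 // => X _; rewrite mxE mul0r.
by move: h; case: (cumulant Xs 0) => x y /= ->.
Qed.

(** At 0 the derivatives of the exponent are the vertex weights of the graphs;
    the linear term [<w, phi>] accounts for the outer vertices. *)
Lemma cumulant_weight Xs : Xs != [::] ->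
  Re (cumulant Xs 0)
  = vertex_weight (fun s => t * Defs.coefC a z r s) (phi 0) Xs.
Proof.
rewrite /vertex_weight (coefC_psi_deriv hexp) => nX.
rewrite /cumulant complex_ReD complex_ReM /= mul0r subr0 addrC.
by case: Xs nX => [|X [|Y Xs]].
Qed.

Lemma cumulant0 : cumulant [::] 0 = 0.
Proof.
have c0 v : cdot 0 v = 0 :> R[i] by rewrite /cdot big1 // => X _; rewrite mxE mul0r.
rewrite /cumulant /psi_deriv /= !c0 oppr0 !add0r.
have [_ e1] := cintegral_cst r 1.
have -> : laplace r [::] 0 = 1.
  rewrite -[RHS]e1; apply: eq_cintegral => y.
  by rewrite /monomial big_nil mul1r c0 cexp0.
by rewrite subrr !mulr0.
Qed.

Section Labelled.
Variables (E : finType) (x : E -> 'I_d).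
Implicit Types (B D : {set E}).

Definition labels D : seq 'I_d := [seq x e | e <- enum D].

Definition block_cumulant w B : R[i] := cumulant (labels B) w.

Lemma perm_labelsU1 f D : f \notin D -> perm_eq (labels (f |: D)) (x f :: labels D).
Proof.
move=> fD; rewrite -[_ :: _]/(map x (f :: enum D)); apply: perm_map.
apply: uniq_perm; rewrite ?enum_uniq //= ?mem_enum ?fD ?enum_uniq //.
by move=> y; rewrite inE !mem_enum !inE.
Qed.

(** Multiplying by the exponential of the exponent, whose derivative contributes
    [cumulant [:: x f]], one sees that differentiating
    (partition sum) * exponential in the direction [x f] adjoins [f] to [D]. *)
Lemma first_order_partition_sum f D w (c : R[i]) : f \notin D ->
  first_order
    (fun h => partition_sum (block_cumulant (w + (h%:C * c) *: delta_mx 0 (x f))) D)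
    (c * (partition_sum (block_cumulant w) (f |: D)
          - cumulant [:: x f] w * partition_sum (block_cumulant w) D)).
Proof.
have w0 : w + (0%:C * c) *: delta_mx 0 (x f) = w by rewrite mul0r scale0r addr0.
have [n] := ubnP #|D|; elim: n D => // n IHn D; rewrite ltnS => Dn fD.
have [D0|[e eD]] := set_0Vmem D.
  rewrite D0; apply: eq_first_order (first_order_cst 1) => [h|].
    by rewrite partition_sum0.
  rewrite partition_sum0 partition_sum1 mulr1 /block_cumulant.
  rewrite (@cumulant_perm _ [:: x f]) ?subrr ?mulr0 //.
  have := @perm_labelsU1 f finset.set0; rewrite inE => /(_ isT).
  by rewrite {2}/labels enum_set0.
pose F B h := block_cumulant (w + (h%:C * c) *: delta_mx 0 (x f)) B
  * partition_sum (block_cumulant (w + (h%:C * c) *: delta_mx 0 (x f))) (D :\: B).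
have hF B : (e \in B) && (B \subset D) -> first_order (F B)
   (c * block_cumulant w (f |: B) * partition_sum (block_cumulant w) (D :\: B)
    + block_cumulant w B * (c * (partition_sum (block_cumulant w) (f |: (D :\: B))
          - cumulant [:: x f] w * partition_sum (block_cumulant w) (D :\: B)))).
  move=> /andP[eB BD].
  have fB : f \notin B by apply: contra fD; exact: (fintype.subsetP BD).
  have h1 : first_order (fun h => block_cumulant (w + (h%:C * c) *: delta_mx 0 (x f)) B)
     (c * block_cumulant w (f |: B)).
    apply: eq_first_order (first_order_cumulant (labels B) w (x f) c) => //.
    by congr (_ * _); apply/esym/cumulant_perm/perm_labelsU1.
  have cD : (#|D :\: B| < n)%N.
    apply: leq_trans Dn; apply: proper_card; apply/properP; split.
      exact: subsetDl.
    by exists e; rewrite // !inE eB.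
  have fDB : f \notin D :\: B by rewrite inE (negPf fD) andbF.
  have := first_orderM h1 (IHn (D :\: B) cD fDB).
  by apply: eq_first_order => //; rewrite w0.
have := first_order_sum hF; apply: eq_first_order => [h|].
  by rewrite (partition_sum_rec _ eD).
rewrite (partition_sumU1 _ fD eD) [in RHS](partition_sum_rec (block_cumulant w) eD).
rewrite mulr_sumr -sumrB mulr_sumr; apply: eq_bigr => B _.
by move: (cumulant _ w) => K; ring.
Qed.

End Labelled.
End Cumulants.

Section DominatedComplex.
Local Open Scope complex_scope.
Variables (R : realType) (d : nat) (mu : {measure set (Rd R d) -> \bar R}).
Local Notation Re := (@complex.Re R).
Local Notation Im := (@complex.Im R).
Local Notation nc := (@ComplexField.Normc.normc R).

(** If complex functions converge pointwise with a dominating function, and their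
    integrals tend to [L], then [L] is the integral of the limit. The rates make
    both convergences explicit. *)
Lemma cintegral_limit (cn : nat -> 'rV[R]_d -> R[i]) (c : 'rV[R]_d -> R[i])
    (p K : 'rV[R]_d -> R) (L : R[i]) C :
  (forall n, cmeasurable (cn n : Rd R d -> R[i])) -> cmeasurable (c : Rd R d -> R[i]) ->
  rintegrable mu (p : Rd R d -> R) -> (forall n y, nc (cn n y) <= p y) ->
  (forall n y, nc (cn n y - c y) <= K y * inv_seq R n) ->
  (forall n, nc (cintegral mu (cn n) - L) <= C * inv_seq R n) ->
  cintegral mu c = L.
Proof.
move=> mcn mc ip cnp cnc cnL.
have hRe : \int[mu]_y Re (c y) = Re L.
  have h1 : \int[mu]_y Re (cn n y) @[n --> \oo] --> \int[mu]_y Re (c y).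
    apply: (rintegrable_dominated _ _ _ ip).
    - by move=> n; exact: (mcn n).1.
    - exact: mc.1.
    - move=> y; apply: (@cvg_of_bound _ _ _ (K y)) => n.
      by apply: le_trans (cnc n y); rewrite -complex_ReN -complex_ReD; exact: nc_Re.
    - by move=> n y; exact: le_trans (nc_Re _) (cnp n y).
  apply: (cvg_unique _ h1) => //; apply: (@cvg_of_bound _ _ _ C) => n.
  apply: le_trans (cnL n).
  rewrite -[\int[mu]_y Re (cn n y)]/(Re (cintegral mu (cn n))).
  by rewrite -complex_ReN -complex_ReD; exact: nc_Re.
have hIm : \int[mu]_y Im (c y) = Im L.
  have h1 : \int[mu]_y Im (cn n y) @[n --> \oo] --> \int[mu]_y Im (c y).
    apply: (rintegrable_dominated _ _ _ ip).
    - by move=> n; exact: (mcn n).2.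
    - exact: mc.2.
    - move=> y; apply: (@cvg_of_bound _ _ _ (K y)) => n.
      by apply: le_trans (cnc n y); rewrite -complex_ImN -complex_ImD; exact: nc_Im.
    - by move=> n y; exact: le_trans (nc_Im _) (cnp n y).
  apply: (cvg_unique _ h1) => //; apply: (@cvg_of_bound _ _ _ C) => n.
  apply: le_trans (cnL n).
  rewrite -[\int[mu]_y Im (cn n y)]/(Im (cintegral mu (cn n))).
  by rewrite -complex_ImN -complex_ImD; exact: nc_Im.
by rewrite /cintegral hRe hIm; case: L {cnL hRe hIm}.
Qed.

End DominatedComplex.

(** * Moments of a measure with given Fourier transform *)

Section ImaginaryExp.
Local Open Scope complex_scope.
Variable R : realType.
Local Notation nc := (@ComplexField.Normc.normc R).

(** A linear bound is needed, as the quadratic one would use up one more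
    moment than is available in [moment_transform_derivative]. *)
Lemma nc_cexp_imag_sub1 (x : R) : nc (cexp ('i * x%:C) - 1) <= 2 * `|x|.
Proof.
have e : cexp ('i * x%:C) = cos x +i* sin x.
  rewrite /cexp /= !(mul0r, mul1r, subr0, add0r, mulr0, sub0r, addr0) ?oppr0.
  by rewrite expR0 !mul1r.
rewrite e; apply: le_trans (nc_le _) _; rewrite /= subr0 mulrDl mul1r.
have hs : `|sin x| <= `|x|.
  wlog x0 : x {e} / 0 <= x.
    move=> h; have [/h //|/ltW] := leP 0 x.
    by rewrite -oppr_ge0 => /h; rewrite sinN !normrN.
  rewrite (ger0_norm x0) ler_norml sin_le_id // andbT.
  have [x1|x1] := leP 1 x; first by have := sin_geN1 x; lra.
  have : 0 <= sin x.
    by apply: sin_ge0_pi; rewrite x0 /=; have := pi_ge2 R; lra.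
  lra.
apply: lerD => //.
rewrite distrC ger0_norm ?subr_ge0 ?cos_le1 //.
have [x2|x2] := leP `|x| 2; last by have := cos_geN1 x; lra.
have := cos_rem_le 0 x; rewrite /= muln0 expr0 divr1 => h.
apply: le_trans h _; rewrite ler_pdivrMr ?ltr0n // muln1 -real_normK ?num_real //.
by rewrite expr2 ler_wpM2l.
Qed.

End ImaginaryExp.

Section Moments.
Local Open Scope complex_scope.
Variables (R : realType) (d : nat).
Variable r : probability (Rd R d) R.
Hypothesis hexp : forall l, 0 <= l ->
  rintegrable r (fun y : Rd R d => expR (l * `|y : 'rV[R]_d|)).
Local Notation Re := (@complex.Re R).
Local Notation Im := (@complex.Im R).
Local Notation nc := (@ComplexField.Normc.normc R).
Variables (a phi : 'rV[R]_d) (z t : R).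
Variable nu : {finite_measure set (Rd R d) -> \bar R}.
Hypothesis hnu : is_nu a z r t nu.
Local Notation cumulant := (cumulant r a phi z t).
Local Notation block_cumulant := (block_cumulant r a phi z t).
Implicit Types (Xs : seq 'I_d) (xi y : 'rV[R]_d).

Definition imag_row xi : 'rV[R[i]]_d := 'i *: toC xi.

Lemma imag_row_shift xi h X :
  imag_row (xi + h *: delta_mx 0 X) = imag_row xi + (h%:C * 'i) *: delta_mx 0 X.
Proof.
rewrite /imag_row addrC toC_shift scalerDr scalerA; congr (_ + _ *: _); exact: mulrC.
Qed.

Lemma imag_row0 : imag_row 0 = 0.
Proof.
by rewrite /imag_row (_ : toC 0 = 0) ?scaler0 //; apply/rowP => X; rewrite !mxE.
Qed.

Lemma cdot_imag xi y : cdot (imag_row xi) y = 'i * (\sum_X xi 0 X * y 0 X)%:C.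
Proof.
rewrite /cdot rmorph_sum mulr_sumr; apply: eq_bigr => X _.
by rewrite !mxE rmorphM /= mulrA.
Qed.

Lemma Re_cdot_imag xi y : Re (cdot (imag_row xi) y) = 0.
Proof. by rewrite cdot_imag /= mul0r mulr0 subr0. Qed.

Lemma nc_cexp_imag xi y : nc (cexp (cdot (imag_row xi) y)) = 1.
Proof. by rewrite nc_cexp Re_cdot_imag expR0. Qed.

(** The Fourier transform of the measure [monomial Xs (phi - y) * nu]. *)
Definition moment_transform Xs xi : R[i] :=
  cintegral nu (fun y => (monomial Xs (phi - y))%:C * cexp (cdot (imag_row xi) (phi - y))).

Lemma cmeasurable_moment Xs xi :
  cmeasurable (fun y : Rd R d => (monomial Xs (phi - (y : 'rV[R]_d)))%:C
     * cexp (cdot (imag_row xi) (phi - (y : 'rV[R]_d)))).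
Proof.
apply: (@cmeasurable_monomial_cexp R d (fun y => phi - (y : 'rV[R]_d))).
exact: vmeasurable_sub.
Qed.

Lemma measurable_moment Xs :
  measurable_fun setT (fun y : Rd R d => monomial Xs (phi - (y : 'rV[R]_d))).
Proof.
by apply: (@measurable_monomial R d (fun y => phi - (y : 'rV[R]_d))); exact: vmeasurable_sub.
Qed.

Lemma nc_moment Xs xi y :
  nc ((monomial Xs (phi - y))%:C * cexp (cdot (imag_row xi) (phi - y)))
  = `|monomial Xs (phi - y)|.
Proof. by rewrite ncM nc_cexp_imag mulr1 nc_real. Qed.

Definition moment_integrable Xs :=
  rintegrable nu (fun y : Rd R d => monomial Xs (phi - (y : 'rV[R]_d))).

Lemma cintegrable_moment Xs xi : moment_integrable Xs ->
  cintegrable nu (fun y => (monomial Xs (phi - y))%:C * cexp (cdot (imag_row xi) (phi - y))).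
Proof.
move=> iX; apply: (cintegrable_le (p := fun y => `|monomial Xs (phi - y)|)).
- exact: cmeasurable_moment.
- by move=> y; rewrite nc_moment.
- exact: rintegrable_norm iX.
Qed.

Lemma moment_integrable_nil : moment_integrable [::].
Proof.
rewrite /moment_integrable; under eq_fun do rewrite /monomial big_nil.
exact: finite_measure_integrable_cst.
Qed.

Lemma moment_transform_nil xi :
  moment_transform [::] xi = cexp (cumulant [::] (imag_row xi)).
Proof.
have := hnu (- xi).
have -> : - 'i *: toC (- xi) = imag_row xi.
  apply/rowP => X; rewrite !mxE rmorphN /=; ring.
rewrite /cumulant psi_deriv0 //= cexpD => <-.
rewrite /fourier -cintegralZ; last first.
  apply: (cintegrable_le (p := fun=> 1)).
  - apply: cmeasurable_cexp; apply: cmeasurableM; first exact: cmeasurable_cst.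
    by apply: (@cmeasurable_cdot R d (fun y => y)); exact: vmeasurable_id.
  - move=> y; have := nc_cexp_imag (- xi) y; rewrite /imag_row => e.
    rewrite (_ : 'i * cdot _ y = cdot ('i *: toC (- xi)) y) ?e //.
    by rewrite /cdot mulr_sumr; apply: eq_bigr => X _; rewrite !mxE mulrA.
  - exact: finite_measure_integrable_cst.
apply: eq_cintegral => y; rewrite /monomial big_nil mul1r -cexpD; congr cexp.
rewrite /cdot mulr_sumr -big_split; apply: eq_bigr => X _ /=.
by rewrite !mxE rmorphN rmorphB /=; ring.
Qed.

(** Differentiating [moment_transform Xs] in the direction [X] adjoins [X] to
    [Xs], by dominated convergence. The derivative is given as [f1] from the
    outside; that it exists is known from the right-hand side of
    [moment_transformE]. Since it is only identified here, integrability of the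
    monomial [X :: Xs] suffices and no further moment is needed. *)
Lemma moment_transform_derivative Xs X xi (f1 : R[i]) :
  moment_integrable Xs -> moment_integrable (X :: Xs) ->
  first_order (fun h => moment_transform Xs (xi + h *: delta_mx 0 X)) f1 ->
  f1 = 'i * moment_transform (X :: Xs) xi.
Proof.
move=> iXs iX f_f1; have [C hC] := first_order_diff_quotient f_f1.
pose h n : R := inv_seq R n.
have h0 n : 0 < h n := inv_seq_gt0 R n.
have h1 n : h n <= 1 := inv_seq_le1 R n.
pose g xi' y := (monomial Xs (phi - y))%:C * cexp (cdot (imag_row xi') (phi - y)).
pose cn n y := ((h n)^-1)%:C * (g (xi + h n *: delta_mx 0 X) y - g xi y).
pose c y := 'i * ((monomial (X :: Xs) (phi - y))%:C * cexp (cdot (imag_row xi) (phi - y))).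
have cnE n y : cn n y = g xi y * (((h n)^-1)%:C
     * (cexp ('i * (h n * (phi - y) 0 X)%:C) - 1)).
  rewrite /cn /g imag_row_shift cdot_delta cexpD.
  rewrite (_ : (h n)%:C * 'i * _ = 'i * (h n * (phi - y) 0 X)%:C) ?rmorphM; ring.
have cE y : c y = g xi y * ('i * ((phi - y) 0 X)%:C).
  by rewrite /c /g monomial_cons rmorphM /=; ring.
have hV n : ((h n)^-1)%:C * (h n)%:C = 1 by rewrite -rmorphM /= mulVf ?gt_eqF.
rewrite -cintegralZ; last exact: cintegrable_moment.
apply/esym; apply: (@cintegral_limit _ _ nu cn c
   (fun y => 2 * `|monomial (X :: Xs) (phi - y)|)
   (fun y => `|monomial Xs (phi - y)| * (5 * `|(phi - y) 0 X| ^+ 2 * expR `|(phi - y) 0 X|))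
   f1 C).
- move=> n; apply: cmeasurableM; first exact: cmeasurable_cst.
  by apply: cmeasurableB; exact: cmeasurable_moment.
- by apply: cmeasurableM; [exact: cmeasurable_cst|exact: cmeasurable_moment].
- by apply: rintegrableZ; exact: rintegrable_norm.
- move=> n y; rewrite cnE 2!ncM nc_moment nc_real monomial_cons normrM.
  set q := (phi - y) 0 X.
  have hq : `|(h n)^-1| * nc (cexp ('i * (h n * q)%:C) - 1) <= 2 * `|q|.
    rewrite gtr0_norm ?invr_gt0 // ler_pdivrMl // (le_trans (nc_cexp_imag_sub1 _)) //.
    by rewrite normrM gtr0_norm // mulrCA.
  by rewrite /= [leRHS]mulrA [leRHS]mulrC; apply: ler_wpM2l.
- move=> n y; rewrite cnE cE -mulrBr ncM nc_moment; cbv beta.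
  rewrite -[leRHS]mulrA; apply: ler_wpM2l => //.
  set q := (phi - y) 0 X.
  have -> : ((h n)^-1)%:C * (cexp ('i * (h n * q)%:C) - 1) - 'i * q%:C
    = ((h n)^-1)%:C * (cexp ('i * (h n * q)%:C) - 1 - 'i * (h n * q)%:C).
    rewrite [RHS]mulrBr; congr (_ - _).
    by rewrite rmorphM /= mulrCA (mulrA _ (h n)%:C) hV mul1r.
  rewrite ncM nc_real gtr0_norm ?invr_gt0 // ler_pdivrMl //.
  apply: le_trans (cexp_taylor1 _) _.
  have -> : nc ('i * (h n * q)%:C) = h n * `|q|.
    rewrite ncM nc_real normrM (gtr0_norm (h0 n)).
    by rewrite /= expr0n expr1n add0r sqrtr1 mul1r.
  apply: (@le_trans _ _ (5 * (h n * `|q|) ^+ 2 * expR `|q|)).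
    apply: ler_wpM2l; first by rewrite mulr_ge0 // sqr_ge0.
    by rewrite ler_expR ler_piMl.
  by rewrite exprMn le_eqVlt; apply/orP; left; apply/eqP; rewrite /h; ring.
move=> n; have := hC (h n); rewrite h0 h1 => /(_ isT).
rewrite scale0r addr0 -cintegralB; [|exact: cintegrable_moment|exact: cintegrable_moment].
by rewrite -cintegralZ //; apply: cintegrableB; exact: cintegrable_moment.
Qed.

(** By induction on [D]: differentiate both sides in the direction of the label
    of a new element. *)
Lemma moment_transformE (E : finType) (x : E -> 'I_d) n (D : {set E}) xi :
  (forall Xs, (size Xs <= n)%N -> moment_integrable Xs) -> (#|D| <= n)%N ->
  moment_transform (labels x D) xi
  = partition_sum (block_cumulant x (imag_row xi)) D * cexp (cumulant [::] (imag_row xi)).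
Proof.
move=> iX; move: xi; have [k] := ubnP #|D|; elim: k D => // k IHk D; rewrite ltnS.
move=> Dk xi Dn; have [->|[f fD]] := set_0Vmem D.
  by rewrite /labels enum_set0 partition_sum0 mul1r moment_transform_nil.
pose D' := D :\ f.
have fD' : f \notin D' by rewrite !inE eqxx.
have eD : D = f |: D' by rewrite finset.setD1K.
have cD : #|D| = #|D'|.+1 by rewrite (cardsD1 f) fD.
have D'k : (#|D'| < k)%N by rewrite -cD.
have D'n : (#|D'| <= n)%N by rewrite ltnW // -cD.
have sz (B : {set E}) : size (labels x B) = #|B| by rewrite size_map -cardE.
have xiE : imag_row xi + (0%:C * 'i) *: delta_mx 0 (x f) = imag_row xi.
  by rewrite mul0r scale0r addr0.
have := first_orderM
  (first_order_partition_sum hexp a phi z t x (imag_row xi) 'i%R fD')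
  (first_order_cexp (first_order_cumulant hexp a phi z t [::] (imag_row xi) (x f) 'i%R)).
rewrite xiE => hfo.
have hfo' : first_order
   (fun h => moment_transform (labels x D') (xi + h *: delta_mx 0 (x f)))
   ('i * (partition_sum (block_cumulant x (imag_row xi)) D
           * cexp (cumulant [::] (imag_row xi)))).
  apply: eq_first_order hfo => [h|].
    rewrite (IHk D' D'k _ D'n).
    rewrite imag_row_shift.
    reflexivity.
  by rewrite eD; ring.
have := moment_transform_derivative (iX _ _) (iX _ _) hfo'.
rewrite sz D'n /= sz -cD Dn => /(_ isT isT) e.
have i0 : 'i != 0 :> R[i].
  by apply/eqP => -[] /eqP; rewrite oner_eq0.
rewrite (mulfI i0 e); apply: eq_cintegral => y.
by rewrite {1}eD (monomial_perm _ (perm_labelsU1 x fD')).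
Qed.

(** The function [S] of [h] is, up to the order considered, a sum of products of
    smooth functions, so its second symmetric difference at 0 is O(h^2). This
    difference is the integral of [W^(2k) (2 - 2 cos (h W))], and
    [(2 - 2 cos (h W)) / h^2] tends to [W^2]. *)
Lemma moment_pow_integrable k X :
  (forall Xs, (size Xs <= 2 * k)%N -> moment_integrable Xs) ->
  rintegrable nu (fun y : Rd R d => (phi - (y : 'rV[R]_d)) 0 X ^+ (2 * k).+2).
Proof.
move=> iX; pose x := fun _ : 'I_(2 * k).+1 => X.
(* All elements of D carry the label X; the additional element f is the
   direction in which the sum for D is differentiated. *)
pose f : 'I_(2 * k).+1 := ord0; pose D := ~: (f |: finset.set0).
have fD : f \notin D by rewrite !inE eqxx.
have cD : #|D| = (2 * k)%N.
  by have := cardsC1 f; rewrite card_ord /= /D finset.setU0.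
have monoE y : monomial (labels x D) y = y 0 X ^+ (2 * k).
  rewrite /monomial big_map /x big_const_seq count_predT -cardE cD.
  by elim: (2 * k)%N => //= m ->; rewrite exprS.
pose S h := moment_transform (labels x D) (0 + h *: delta_mx 0 X).
have [C hC] : exists C, forall h, `|h| <= 1 -> nc (S h + S (- h) - 2 * S 0) <= C * h ^+ 2.
  have hfo := first_orderM
    (first_order_partition_sum hexp a phi z t x (imag_row 0) 'i%R fD)
    (first_order_cexp (first_order_cumulant hexp a phi z t [::] (imag_row 0) X 'i%R)).
  have Dle : (#|D| <= 2 * k)%N by rewrite cD.
  apply: (first_order_symm (f := S)).
  apply: eq_first_order hfo => [h|]; last reflexivity.
  rewrite /S (moment_transformE x _ iX Dle) imag_row_shift; reflexivity.
pose W y : R := (phi - y) 0 X.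
have im : moment_integrable (labels x D) by apply: iX; rewrite size_map -cardE cD.
have cosE h y : Re ((monomial (labels x D) (phi - y))%:C
    * cexp (cdot (imag_row (0 + h *: delta_mx 0 X)) (phi - y)))
    = W y ^+ (2 * k) * cos (h * W y).
  rewrite monoE imag_row_shift imag_row0 cdot_delta.
  rewrite (_ : cdot 0 _ = 0) ?add0r; last by rewrite /cdot big1 // => Y _; rewrite mxE mul0r.
  rewrite (_ : h%:C * 'i * _ = 'i * (h * W y)%:C); last by rewrite rmorphM /= /W; ring.
  rewrite complex_ReM /cexp /= !(mul0r, mul1r, subr0, add0r, mulr0, sub0r, addr0) ?oppr0.
  by rewrite expR0 mul1r.
have SRe h : rintegrable nu (fun y : Rd R d => W y ^+ (2 * k) * cos (h * W y)) /\
    Re (S h) = \int[nu]_y (W y ^+ (2 * k) * cos (h * W y)).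
  have [i1 _] := cintegrable_moment (0 + h *: delta_mx 0 X) im.
  split; first by under eq_fun do rewrite -cosE.
  rewrite -[LHS]/(\int[nu]_y Re ((monomial (labels x D) (phi - y))%:C
    * cexp (cdot (imag_row (0 + h *: delta_mx 0 X)) (phi - y)))).
  by apply: eq_Rintegral => y _; exact: cosE.
pose u n : R := inv_seq R n.
have u0 n : 0 < u n := inv_seq_gt0 R n.
(* The values cos (0 * W y) = 1 are kept in this form to match the integrals
   that represent S 0. *)
pose fn n (y : Rd R d) : R := (u n ^+ 2)^-1 * (2 * (W y ^+ (2 * k) * cos (0 * W y))
   - (W y ^+ (2 * k) * cos (u n * W y) + W y ^+ (2 * k) * cos (- u n * W y))).
have fnE n y : fn n y = (u n ^+ 2)^-1 * (2 * W y ^+ (2 * k) * cos_rem 1 (u n * W y)).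
  by rewrite /fn mul0r cos0 mulNr cosN /= muln0 expr0 divr1; ring.
have ifn n : rintegrable nu (fn n).
  apply: rintegrableZ; apply: rintegrableB; first by apply: rintegrableZ; exact: (SRe 0).1.
  by apply: rintegrableD; [exact: (SRe (u n)).1|exact: (SRe (- u n)).1].
have mW : measurable_fun setT (W : Rd R d -> R) by exact: vmeasurable_sub.
apply: (@rintegrable_fatou _ _ R nu fn _ (fun=> C) C _ _ _ _ _ _).1 => //.
- exact: measurable_funX.
- move=> n y; rewrite fnE mulr_ge0 ?invr_ge0 ?sqr_ge0 // mulr_ge0 ?cos_rem_ge0 //.
  by rewrite mulr_ge0 // exprM exprn_ge0 // sqr_ge0.
- move=> y; set q := W y; apply: (@cvg_of_bound _ _ _ (`|q ^+ (2 * k) * q ^+ 4|)) => n.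
  rewrite fnE -/q.
  have c1 := cos_rem_le 0 (u n * q); have c2 := cos_rem_ge 0 (u n * q).
  have u1 : u n <= 1 := inv_seq_le1 R n.
  have qk : 0 <= q ^+ (2 * k) by rewrite exprM exprn_ge0 // sqr_ge0.
  move: c1 c2; set K := cos_rem 1 _ => c1 c2.
  have -> : (u n ^+ 2)^-1 * (2 * q ^+ (2 * k) * K) - q ^+ (2 * k).+2
    = - (q ^+ (2 * k) * (u n ^+ 2)^-1 * (2 * ((u n * q) ^+ 2 / 2 - K))).
    have -> : q ^+ (2 * k).+2 = q ^+ (2 * k) * q ^+ 2 by rewrite -exprD addn2.
    rewrite exprMn; field; exact: lt0r_neq0.
  have hb : 0 <= 2 * ((u n * q) ^+ 2 / 2 - K) <= (u n * q) ^+ 4.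
    move: c1 c2; rewrite !muln1 (_ : (2 * 2)%N = 4%N) //.
    rewrite (_ : 2`!%:R = 2 :> R) // (_ : 4`!%:R = 24 :> R) // => c1 c2.
    have q4 : 0 <= (u n * q) ^+ 4 by rewrite (exprM _ 2 2) exprn_ge0 // sqr_ge0.
    apply/andP; split; lra.
  have /andP[hb0 hb1] := hb.
  rewrite normrN ger0_norm; last by rewrite mulr_ge0 // mulr_ge0 // invr_ge0 sqr_ge0.
  apply: (@le_trans _ _ (q ^+ (2 * k) * (u n ^+ 2)^-1 * (u n * q) ^+ 4)).
    by rewrite ler_wpM2l // mulr_ge0 // invr_ge0 sqr_ge0.
  have q4 : 0 <= q ^+ 4 by rewrite (exprM _ 2 2) exprn_ge0 // sqr_ge0.
  rewrite ger0_norm ?(mulr_ge0 qk q4) //.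
  have -> : q ^+ (2 * k) * (u n ^+ 2)^-1 * (u n * q) ^+ 4
          = q ^+ (2 * k) * q ^+ 4 * (u n * u n).
    by rewrite exprMn; field; exact: lt0r_neq0.
  apply: ler_wpM2l; first exact: (mulr_ge0 qk q4).
  by rewrite -/(u n) ler_piMl // ltW.
- move=> n; rewrite /fn rintegralZ; last first.
    apply: rintegrableB; first by apply: rintegrableZ; exact: (SRe 0).1.
    by apply: rintegrableD; [exact: (SRe (u n)).1|exact: (SRe (- u n)).1].
  rewrite rintegralB; last 2 first.
  + by apply: rintegrableZ; exact: (SRe 0).1.
  + by apply: rintegrableD; [exact: (SRe (u n)).1|exact: (SRe (- u n)).1].
  rewrite rintegralZ ?(SRe 0).1 // rintegralD ?(SRe (u n)).1 ?(SRe (- u n)).1 //.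
  rewrite -(SRe 0).2 -(SRe (u n)).2 -(SRe (- u n)).2.
  rewrite ler_pdivrMl ?exprn_gt0 // [leRHS]mulrC.
  have u1 : `|u n| <= 1 by rewrite gtr0_norm // inv_seq_le1.
  apply: le_trans (hC (u n) u1).
  apply: le_trans (nc_Re _); rewrite -normrN; apply: le_trans (ler_norm _).
  move: (S 0) (S (u n)) (S (- u n)) => p q s.
  by rewrite !mulr_natl !mulr2n complex_ReD complex_ReN !complex_ReD opprB.
- exact: cvg_cst.
Qed.

Lemma all_moments_integrable Xs : moment_integrable Xs.
Proof.
suff h k : forall Xs, (size Xs <= 2 * k)%N -> moment_integrable Xs.
  by apply: (h (size Xs)); rewrite leq_pmull.
elim: k => [|k IHk] Ys.
  by rewrite muln0 leqn0 => /nilP ->; exact: moment_integrable_nil.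
rewrite mulnS => sY.
have ib : rintegrable nu (fun y : Rd R d =>
   1 + \sum_X (phi - (y : 'rV[R]_d)) 0 X ^+ (2 * k).+2).
  apply: rintegrableD; first exact: finite_measure_integrable_cst.
  by apply: rintegrable_sum => X; exact: moment_pow_integrable.
apply: rintegrable_le ib; first exact: measurable_moment.
have ev (x : R) : 0 <= x ^+ (2 * k).+2.
  have -> : (2 * k).+2 = (2 * k.+1)%N by rewrite mulnS.
  by rewrite exprM exprn_ge0 // sqr_ge0.
move=> y; apply: le_trans (monomial_le_norm _ _) _.
set v := phi - y.
have [v1|v1] := leP `|v| 1.
  rewrite (@le_trans _ _ 1) ?exprn_ile1 // lerDl sumr_ge0 //.
apply: (@le_trans _ _ (`|v| ^+ (2 * k).+2)).
  by rewrite ler_weXn2l // ltW.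
have vn : `|v| = mx_norm v by [].
have [v0|/mx_norm_neq0[[i X] /= e]] := eqVneq (mx_norm v) 0.
  by move: v1; rewrite vn v0 ltr10.
rewrite vn e ord1 (bigD1 X) //= addrCA.
have -> : `|v 0 X| ^+ (2 * k).+2 = v 0 X ^+ (2 * k).+2.
  by rewrite -normrX ger0_norm.
by rewrite lerDl addr_ge0 // sumr_ge0.
Qed.

(** The moments of [phi - y] in terms of its cumulants. *)
Lemma moment_partition_sum (E : finType) (x : E -> 'I_d) (D : {set E}) :
  \int[nu]_y monomial (labels x D) (phi - y)
  = partition_sum (fun B =>
      vertex_weight (fun s => t * Defs.coefC a z r s) (phi 0) (labels x B)) D.
Proof.
have := @moment_transformE E x #|D| D 0 (fun Xs _ => all_moments_integrable Xs) (leqnn _).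
rewrite imag_row0 cumulant0 cexp0 mulr1.
have -> : partition_sum (block_cumulant x 0) D =
  (partition_sum (fun B =>
    vertex_weight (fun s => t * Defs.coefC a z r s) (phi 0) (labels x B)) D)%:C.
  rewrite [RHS]rmorph_partition_sum; apply: eq_partition_sum => B B0.
  rewrite /block_cumulant cumulant_real /= -(cumulant_weight hexp) //.
  by rewrite -size_eq0 size_map -cardE cards_eq0.
have e y : (monomial (labels x D) (phi - y))%:C * cexp (cdot (imag_row 0) (phi - y))
    = (monomial (labels x D) (phi - y))%:C.
  rewrite imag_row0 (_ : cdot 0 _ = 0) ?cexp0 ?mulr1 //.
  by rewrite /cdot big1 // => X _; rewrite mxE mul0r.
by rewrite /moment_transform (eq_cintegral _ e) => /(congr1 Re).
Qed.

End Moments.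

(** * Asymptotic series and their logarithms *)

Section AsymptoticSeries.
Variable R : realType.
Implicit Types (h : R -> R) (b c : nat -> R) (N : nat).

(** A quantitative form of asymptotic series, in which remainders are O of the
    next power; for series with terms of all orders this is equivalent, and it
    is the form in which expansions can be multiplied and composed. *)
Definition taylor_bound h b := forall N, exists C delta,
  [/\ 0 < delta, delta <= 1 & forall beta, 0 < beta <= delta ->
    `|h beta - \sum_(m < N.+1) b m * beta ^+ m| <= C * beta ^+ N.+1].

Lemma asymptotic_of_bound h b : taylor_bound h b -> asymptotic_series h b.
Proof.
move=> hb N; have [C [delta [d0 d1 hC]]] := hb N.
have D0 : 0 < Num.max C 1 by rewrite lt_max ltr01 orbT.
apply/cvgrPdist_le => e e0; near=> beta.
have b0 : 0 < beta by near: beta; exact: nbhs_right_gt.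
have bd : beta <= delta by near: beta; exact: nbhs_right_le.
have be : beta <= e / Num.max C 1.
  by near: beta; apply: nbhs_right_le; exact: divr_gt0.
rewrite sub0r normrN ger0_norm; last first.
  by rewrite mulr_ge0 // invr_ge0 exprn_ge0 // ltW.
rewrite ler_pdivrMl ?exprn_gt0 //; apply: le_trans (hC _ _) _; first by rewrite b0.
rewrite exprSr mulrCA ler_wpM2l ?exprn_ge0 ?(ltW b0) //.
apply: (@le_trans _ _ (Num.max C 1 * beta)).
  by rewrite ler_wpM2r ?(ltW b0) // le_max lexx.
by rewrite mulrC -ler_pdivlMr.
Unshelve. all: by end_near.
Qed.

Lemma poly_bound (p : {poly R}) x : 0 <= x <= 1 ->
  `|p.[x]| <= \sum_(i < size p) `|p`_i|.
Proof.
move=> /andP[x0 x1]; rewrite horner_coef; apply: le_trans (ler_norm_sum _ _ _) _.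
apply: ler_sum => i _; rewrite normrM ler_piMr // ger0_norm ?exprn_ge0 //.
exact: exprn_ile1.
Qed.

(** The hypothesis says that the derivative of [p exp (- q)] vanishes to order
    [N] at 0. *)
Lemma poly_exp_bound (p q : {poly R}) N : p`_0 = 1 -> q`_0 = 0 ->
  (forall j, (j < N)%N -> (p^`() - q^`() * p)`_j = 0) ->
  exists C, forall x, 0 <= x <= 1 -> `|p.[x] * expR (- q.[x]) - 1| <= C * x ^+ N.+1.
Proof.
move=> p0 q0 hq; pose s := drop_poly N (p^`() - q^`() * p).
have es : p^`() - q^`() * p = s * 'X^N.
  rewrite -[LHS](poly_take_drop N) (_ : take_poly N _ = 0) ?add0r //.
  apply/polyP => j; rewrite coef_take_poly coef0; case: ifP => // jN.
  exact: hq.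
pose g x := p.[x] * expR (- q.[x]).
have dg (x : R) : is_derive x 1 g (s.[x] * x ^+ N * expR (- q.[x])).
  have dE : is_derive x 1 (expR \o (fun y => (- q).[y])) (expR (- q).[x] * (- q)^`().[x]).
    exact: (is_derive1_comp (is_derive_expR _) (is_derive_poly (- q) x)).
  have := is_deriveM (is_derive_poly p x) dE.
  have -> : horner p * (expR \o (fun y => (- q).[y])) = g.
    by apply/funext => y; rewrite /g /= -hornerN.
  have e : p.[x] *: (expR (- q).[x] * (- q)^`().[x])
      + (expR \o (fun y => (- q).[y])) x *: p^`().[x]
    = s.[x] * x ^+ N * expR (- q.[x]).
    rewrite /GRing.scale /= -[X in _ = s.[x] * X * _]hornerXn -hornerM -es.
    by rewrite derivN !(hornerD, hornerN, hornerM); ring.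
  by rewrite e.
exists ((\sum_(i < size s) `|s`_i|) * expR (\sum_(i < size q) `|q`_i|)) => x /andP[x0 x1].
have cg : {within `[0, x], continuous g}.
  exact/continuous_subspaceT/(derive_continuous dg).
have [y yx e] := MVT_segment x0 (fun y _ => dg y) cg.
have g0 : g 0 = 1 by rewrite /g !horner_coef0 p0 q0 oppr0 expR0 mulr1.
rewrite -/(g x) -g0 e subr0 exprSr mulrA normrM (ger0_norm x0) ler_wpM2r //.
move: yx; rewrite in_itv /= => /andP[y0 yx].
have y01 : 0 <= y <= 1 by rewrite y0 (le_trans yx).
rewrite !normrM (ger0_norm (expR_ge0 _)) mulrAC ler_pM //.
- rewrite ler_pM ?expR_ge0 //; first exact: poly_bound.
  by rewrite ler_expR (le_trans (ler_norm _)) // normrN poly_bound.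
- by rewrite ger0_norm ?exprn_ge0 // lerXn2r.
Qed.

Lemma ln_bound (x : R) : `|x - 1| <= 2^-1 -> `|ln x| <= 2 * `|x - 1|.
Proof.
move=> hx; have x2 : 2^-1 <= x by move: hx; rewrite ler_norml => /andP[]; lra.
have x0 : 0 < x by rewrite (lt_le_trans _ x2) // invr_gt0.
have h1 := expR_ge1Dx (ln x); rewrite lnK in h1; last by rewrite posrE.
have h2 := expR_ge1Dx (- ln x); rewrite expRN lnK in h2; last by rewrite posrE.
have h3 : x^-1 <= 2 by rewrite invf_ple ?posrE.
have h4 : x * x^-1 = 1 by rewrite mulfV // gt_eqF.
have h5 := ler_norm (x - 1); have h6 := ler_norm (1 - x); rewrite distrC in h6.
have n0 := normr_ge0 (x - 1).
have h7 : x^-1 - 1 = (1 - x) * x^-1 by rewrite mulrBl mul1r h4.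
have h8 : (1 - x) * x^-1 <= `|x - 1| * 2.
  apply: (@le_trans _ _ (`|x - 1| * x^-1)).
    by rewrite ler_wpM2r // invr_ge0 ltW.
  by rewrite ler_wpM2l.
by rewrite ler_norml; apply/andP; split; lra.
Qed.

(** The recursion is the coefficient form of [b' = c' b], that is of
    [b = exp c] for formal power series. *)
Lemma taylor_bound_ln h b c : b 0%N = 1 -> c 0%N = 0 ->
  (forall m, m.+1%:R * b m.+1
     = \sum_(k < m.+1) (k.+1%:R * c k.+1) * b (m - k)%N) ->
  taylor_bound h b -> taylor_bound (fun beta => ln (h beta)) c.
Proof.
move=> b0 c0 rec hb N; have [C [delta [d0 d1 hC]]] := hb N.
pose p := \poly_(m < N.+1) b m; pose q := \poly_(m < N.+1) c m.
have pE x : p.[x] = \sum_(m < N.+1) b m * x ^+ m by rewrite horner_poly.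
have qE x : q.[x] = \sum_(m < N.+1) c m * x ^+ m by rewrite horner_poly.
(* By the recursion, exp q reproduces p up to O(x^(N+1)). *)
have [D hD] : exists D, forall x, 0 <= x <= 1 ->
    `|p.[x] * expR (- q.[x]) - 1| <= D * x ^+ N.+1.
  apply: poly_exp_bound; rewrite ?coef_poly //.
  move=> j jN; rewrite coefB coef_deriv coefM coef_poly ltnS jN -mulr_natl rec.
  apply/eqP; rewrite subr_eq0; apply/eqP; apply: eq_bigr => k _.
  have kj : (k <= j)%N by rewrite -ltnS.
  rewrite coef_deriv !coef_poly ltnS (leq_ltn_trans kj jN).
  have jk : (j - k <= N)%N by apply: leq_trans (leq_subr _ _) (ltnW jN).
  by rewrite ltnS jk mulr_natl.
pose M := expR (\sum_(i < size q) `|q`_i|).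
pose K := `|C| * M + `|D|.
have K0 : 0 <= K by rewrite addr_ge0 // mulr_ge0 // expR_ge0.
have K1 : 0 < 2 * (K + 1) by rewrite mulr_gt0 // ltr_wpDl.
(* Below this bound h x * expR (- q.[x]) is within 1/2 of 1, so that h x is
   positive and the logarithm is Lipschitz with constant 2. *)
exists (2 * K), (Num.min delta (2 * (K + 1))^-1); split.
- by rewrite lt_min d0 invr_gt0.
- by rewrite ge_min d1.
move=> x /andP[x0]; rewrite le_min => /andP[xd xK].
have x01 : 0 <= x <= 1 by rewrite ltW //= (le_trans xd).
have eM : expR (- q.[x]) <= M.
  by rewrite ler_expR (le_trans (ler_norm _)) // normrN poly_bound.
have xN : 0 <= x ^+ N.+1 by rewrite exprn_ge0 // ltW.
have key : `|h x * expR (- q.[x]) - 1| <= K * x ^+ N.+1.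
  have -> : h x * expR (- q.[x]) - 1
     = (h x - p.[x]) * expR (- q.[x]) + (p.[x] * expR (- q.[x]) - 1) by ring.
  apply: le_trans (ler_normD _ _) _; rewrite [leRHS]mulrDl; apply: lerD.
    rewrite normrM (ger0_norm (expR_ge0 _)) mulrAC ler_pM ?expR_ge0 // pE.
    apply: le_trans (hC x _) _; first by rewrite x0.
    by rewrite ler_wpM2r // ler_norm.
  by apply: le_trans (hD x x01) _; rewrite ler_wpM2r // ler_norm.
have half : `|h x * expR (- q.[x]) - 1| <= 2^-1.
  apply: le_trans key _; apply: (@le_trans _ _ (K * x)).
    by rewrite ler_wpM2l // exprS ler_piMr ?(ltW x0) // exprn_ile1 //; case/andP: x01.
  have : x * (2 * (K + 1)) <= 1 by rewrite -ler_pdivlMr // mul1r.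
  have := mulr_ge0 K0 (ltW x0); lra.
have pos : 0 < h x * expR (- q.[x]).
  by move: half; rewrite ler_norml => /andP[]; lra.
have hx0 : 0 < h x by rewrite -(pmulr_lgt0 _ (expR_gt0 (- q.[x]))).
have -> : ln (h x) - \sum_(m < N.+1) c m * x ^+ m = ln (h x * expR (- q.[x])).
  by rewrite lnM ?posrE ?expR_gt0 // expRK qE.
apply: le_trans (ln_bound half) _.
by rewrite -mulrA ler_wpM2l.
Qed.

End AsymptoticSeries.

(** * The large diffusion expansion *)

Section Expansion.
Variables (R : realType) (d : nat) (a : 'rV[R]_d) (z t : R) (phi : 'rV[R]_d).
Variable r : probability (Rd R d) R.
Hypothesis hexp : forall l, 0 <= l ->
  rintegrable r (fun y : Rd R d => expR (l * `|y : 'rV[R]_d|)).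
Variable nu : {finite_measure set (Rd R d) -> \bar R}.
Hypothesis hnu : is_nu a z r t nu.
Let weight := vertex_weight (fun s => t * Defs.coefC a z r s) (phi 0).

Lemma weight_perm s1 s2 : perm_eq s1 s2 -> weight s1 = weight s2.
Proof.
move=> p; case: (eqVneq s1 [::]) => [s0|n1].
  by rewrite s0 in p *; have /nilP <- : nilp s2 by rewrite /nilp -(perm_size p).
have n2 : s2 != [::] by rewrite -size_eq0 -(perm_size p) size_eq0.
rewrite /weight -!(cumulant_weight hexp) //.
by congr complex.Re; exact: cumulant_perm.
Qed.

Lemma sqnorm_pow m (y : 'rV[R]_d) :
  sqnorm y ^+ m = \sum_(X : {ffun 'I_m -> 'I_d})
     monomial (labels (fun e : 'I_m * bool => X e.1) (ends (finset.setTfor 'I_m))) y.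
Proof.
rewrite /sqnorm -[in LHS](card_ord m) -prodr_const bigA_distr_bigA /=.
apply: eq_bigr => X _; rewrite /monomial /labels big_map big_enum /=.
transitivity (\prod_(e : 'I_m * bool) y 0 (X e.1)); last first.
  by apply: eq_bigl => e; rewrite !inE.
rewrite -(pair_bigA _ (fun j (b : bool) => y 0 (X j))) /=.
by apply: eq_bigr => j _; rewrite big_bool /= expr2.
Qed.

Lemma rintegrable_labels m (X : {ffun 'I_m -> 'I_d}) :
  rintegrable nu (fun y : Rd R d =>
    monomial (labels (fun e : 'I_m * bool => X e.1) (ends (finset.setTfor 'I_m)))
         (phi - (y : 'rV[R]_d))).
Proof. exact: (all_moments_integrable hexp phi hnu). Qed.

Lemma rintegrable_sqnorm m :
  rintegrable nu (fun y : Rd R d => sqnorm (phi - (y : 'rV[R]_d)) ^+ m).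
Proof.
by under eq_fun do rewrite sqnorm_pow; apply: rintegrable_sum => X; exact: rintegrable_labels.
Qed.

Lemma sqnorm_moment m :
  \int[nu]_y sqnorm (phi - y) ^+ m = labelled_sum weight m.
Proof.
under eq_Rintegral do rewrite sqnorm_pow.
rewrite rintegral_sum; last exact: rintegrable_labels.
by apply: eq_bigr => X _; rewrite (moment_partition_sum hexp phi hnu).
Qed.

Lemma sqnorm_ge0 (y : 'rV[R]_d) : 0 <= sqnorm y.
Proof. by apply: sumr_ge0 => X _; exact: sqr_ge0. Qed.

Definition gaussian_average beta : R := \int[nu]_y expR (- (beta * sqnorm (phi - y))).

Lemma rintegrable_gauss beta : 0 <= beta ->
  rintegrable nu (fun y : Rd R d => expR (- (beta * sqnorm (phi - (y : 'rV[R]_d))))).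
Proof.
move=> b0.
have mS : measurable_fun setT (fun y : Rd R d => sqnorm (phi - (y : 'rV[R]_d))).
  by have /rintegrable_measurable := rintegrable_sqnorm 1; under eq_fun do rewrite expr1.
apply: (@rintegrable_le _ _ _ nu _ (fun=> 1)).
- apply: measurableT_comp => //; apply: measurable_funN; exact: measurable_funM.
- move=> y; rewrite ger0_norm ?expR_ge0 // -expR0 ler_expR oppr_le0.
  by rewrite mulr_ge0 ?sqnorm_ge0.
- exact: finite_measure_integrable_cst.
Qed.

(** The Taylor polynomials of [exp (- x)] approximate it within the first
    neglected term for all [x >= 0], hence also after integration. *)
Lemma gaussian_average_taylor :
  taylor_bound gaussian_average (fun m => (-1) ^+ m / m`!%:R * labelled_sum weight m).
Proof.
move=> N; exists (labelled_sum weight N.+1 / N.+1`!%:R), 1; split => // beta /andP[b0 _].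
have im m := rintegrable_sqnorm m.
have ie := rintegrable_gauss (ltW b0).
have it m : rintegrable nu (fun y : Rd R d =>
    (- (beta * sqnorm (phi - (y : 'rV[R]_d)))) ^+ m / m`!%:R).
  have := rintegrableZ ((- beta) ^+ m / m`!%:R) (im m).
  by under eq_fun do rewrite mulrAC -exprMn mulNr.
have et m : \int[nu]_y ((- (beta * sqnorm (phi - y))) ^+ m / m`!%:R)
    = (-1) ^+ m / m`!%:R * labelled_sum weight m * beta ^+ m.
  rewrite -sqnorm_moment.
  under eq_Rintegral do rewrite -mulNr exprMn mulrAC.
  by rewrite rintegralZ // -[- beta]mulN1r exprMn; ring.
under eq_bigr do rewrite -et.
rewrite -(rintegral_sum (F := fun (m : 'I_N.+1) (y : Rd R d) => _)) //.
rewrite /gaussian_average -rintegralB //; last exact: rintegrable_sum.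
have -> : labelled_sum weight N.+1 / N.+1`!%:R * beta ^+ N.+1
   = \int[nu]_y (beta ^+ N.+1 / N.+1`!%:R * sqnorm (phi - y) ^+ N.+1).
  by rewrite rintegralZ // sqnorm_moment; ring.
apply: rintegral_norm_le.
- by apply: rintegrableB => //; exact: rintegrable_sum.
- exact: rintegrableZ.
move=> y; apply: le_trans (expRN_taylor _ _) _.
  by rewrite mulr_ge0 ?sqnorm_ge0 // ltW.
by rewrite exprMn mulrAC.
Qed.

Lemma labelled_sum_taylor0 : labelled_sum weight 0 = 1.
Proof.
rewrite /labelled_sum (eq_bigr (fun=> 1)) => [|X _].
  by rewrite sumr_const card_ffun !card_ord expn0.
rewrite (_ : ends _ = finset.set0) ?partition_sum0 //.
by apply/setP => -[[]].
Qed.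

(** [labelled_sum_rec] in terms of exponential generating functions in
    [- beta]. *)
Lemma labelled_sum_coef_rec m :
  m.+1%:R * ((-1) ^+ m.+1 / m.+1`!%:R * labelled_sum weight m.+1)
  = \sum_(k < m.+1) (k.+1%:R * (if k.+1 == 0%N then 0 else
       (-1) ^+ k.+1 / k.+1`!%:R * labelled_connected_sum weight k.+1))
       * ((-1) ^+ (m - k) / (m - k)`!%:R * labelled_sum weight (m - k)).
Proof.
rewrite (labelled_sum_rec weight_perm) !mulr_sumr; apply: eq_bigr => k _ /=.
have km : (k <= m)%N by rewrite -ltnS.
have f0 n : n`!%:R != 0 :> R by rewrite pnatr_eq0 -lt0n fact_gt0.
have eb : m`!%:R = 'C(m, k)%:R * (k`!%:R * (m - k)`!%:R) :> R.
  by rewrite -!natrM bin_fact.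
have c0 : 'C(m, k)%:R != 0 :> R by rewrite pnatr_eq0 -lt0n bin_gt0.
have es : (-1) ^+ m.+1 = (-1) ^+ k.+1 * (-1) ^+ (m - k) :> R.
  by rewrite -exprD addSn subnKC.
rewrite es !factS !natrM eb; field.
by rewrite ?f0 ?c0 ?nat1r ?pnatr_eq0.
Qed.

End Expansion.

Theorem theorem3p1 (R : realType) (d : nat) (a : 'rV[R]_d) (z : R) (hz : 0 <= z)
  (r : probability (Rd R d) R) (hr0 : r [set (0 : 'rV[R]_d)] = 0%E)
  (hr : entire_analytic (fourier r))
  (t : R) (ht : 0 < t) (phi : 'rV[R]_d)
  (nu : {finite_measure set (Rd R d) -> \bar R}) (hnu : is_nu a z r t nu) :
  let h (beta : R) : R :=
    (beta / pi) `^ (- (d%:R / 2)) * levy_solution nu (1 / (4 * beta * t)) t phi in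
  asymptotic_series h
    (fun m => (-1) ^+ m / m`!%:R * \sum_(G in Qbar m) value a z r t phi G) /\
  asymptotic_series (fun beta => ln (h beta))
    (fun m => if m == 0%N then 0 else
       (-1) ^+ m / m`!%:R * \sum_(G in Qbar_c m) value a z r t phi G).
Proof.
move=> h; have hexp := @norm_exp_integrable R d r hr.
pose weight := vertex_weight (fun s => t * Defs.coefC a z r s) (phi 0).
have hE beta : 0 < beta -> h beta = gaussian_average phi nu beta.
  move=> b0; have p0 : 0 < pi :> R := pi_gt0 R.
  have e1 (p : R) : 0 < p -> 4 * p * (1 / (4 * beta * t)) * t = (beta / p)^-1.
    by move=> ?; field; rewrite !gt_eqF.
  have e2 y : - sqnorm (phi - y) / (4 * (1 / (4 * beta * t)) * t)
      = - (beta * sqnorm (phi - y)).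
    by field; rewrite !gt_eqF.
  rewrite /h /levy_solution /convolution /Phi_diff (e1 _ p0).
  under eq_Rintegral do rewrite e2.
  rewrite rintegralZ ?mulrA; last exact: (rintegrable_gauss phi hexp hnu (ltW b0)).
  have bp : 0 < beta / pi by rewrite divr_gt0.
  rewrite -powRM ?invr_ge0 ?(ltW bp) // mulfV ?gt_eqF // powR1 mul1r.
  reflexivity.
have tb : taylor_bound h (fun m => (-1) ^+ m / m`!%:R * labelled_sum weight m).
  move=> N; have [C [dl [d0 d1 hC]]] := gaussian_average_taylor phi hexp hnu N.
  exists C, dl; split => // beta /andP[b0 bd]; rewrite hE //.
  by apply: hC; rewrite b0.
split.
  apply: asymptotic_of_bound.
  under [X in taylor_bound _ X]eq_fun do rewrite Qbar_value_sum.
  exact: tb.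
apply: asymptotic_of_bound.
have -> : (fun m => if m == 0%N then 0 else
       (-1) ^+ m / m`!%:R * \sum_(G in Qbar_c m) value a z r t phi G)
  = (fun m => if m == 0%N then 0 else
       (-1) ^+ m / m`!%:R * labelled_connected_sum weight m).
  by apply/funext => m; case: eqVneq => // _; rewrite Qbar_c_value_sum.
apply: taylor_bound_ln tb => //.
  by rewrite /= labelled_sum_taylor0 fact0 divr1 mulr1 expr0.
exact: (labelled_sum_coef_rec a z t phi hexp).
Qed.
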